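(* The space $\mathfrak D_0^\perp$ is infinite dimensional, it is the $L^2$-orthogonal complement of $\mathfrak D_0$ in $\mathfrak D$ (so $\mathfrak D=\mathfrak D_0\oplus\mathfrak D_0^\perp$), every $\dot\varphi\in\mathfrak D_0^\perp$ solves the linearized obstruction flatness equation $D\mathcal O(\dot\varphi)=0$, and no nonzero element of $\mathfrak D_0^\perp$ is a trivial infinitesimal deformation, i.e. of the form $iZ_1^2f$ with $f\in C^\infty(S^3,\mathbb R)$.
   Context: Let $S^3=\{(z,w)\in\mathbb C^2:|z|^2+|w|^2=1\}$ with standard contact form $\theta=-i(\bar z\,dz+\bar w\,dw)|_{TS^3}$, $Z_1=\bar w\,\partial_z-\bar z\,\partial_w$, $Z_{\bar1}=\overline{Z_1}$, Reeb field $T=i(z\partial_z+w\partial_w)-i(\bar z\partial_{\bar z}+\bar w\partial_{\bar w})$; $L^2=L^2(S^3,\theta\wedge d\theta)$. Spherical harmonics: $H_{p,q}$ ($p,q\ge0$) is the space of restrictions to $S^3$ of harmonic polynomials on $\mathbb C^2$ homogeneous of degree $p$ in $(z,w)$ and $q$ in $(\bar z,\bar w)$; $L^2=\bigoplus H_{p,q}$ orthogonally and $u_{p,q}$ denotes the $H_{p,q}$-component. Let $\mathfrak D=C^\infty(S^3,\mathbb C)$ (infinitesimal deformation tensors of the standard CR structure, the deformed $(1,0)$-bundle being spanned by $Z_1+\varphi Z_{\bar1}$ with the contact distribution fixed); $\mathfrak D_0=\{\varphi:\varphi_{p,q}=0\text{ for }q\in\{0,1\}\}$ (the tangent space at the standard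 structure to the embeddable deformations); $\mathfrak D_0^\perp=\{\varphi:\varphi_{p,q}=0\text{ unless }q\in\{0,1\}\}$. Linearized operators: $D\mathcal Q$ is the real-linear operator $D\mathcal Q(\dot\varphi)=\frac16Z_1^2Z_{\bar1}^2\dot\varphi+\frac16Z_1^4\overline{\dot\varphi}-(T+4i)^2\dot\varphi-\frac{2i}3Z_1Z_{\bar1}(T+4i)\dot\varphi+i(T+4i)\dot\varphi$ (operator compositions), which is the linearization at $\varphi=0$ of the map sending a deformation tensor $\varphi$ to the component $\tilde Q_1{}^{\bar1}$ of the Cartan umbilical tensor of the deformed structure (w.r.t. $\theta$ and the coframe dual to $(T,Z_1+\varphi Z_{\bar1},\overline{Z_1+\varphi Z_{\bar1}})$). $D\mathcal O=Z_{\bar1}^2D\mathcal Q$ is the linearization at $0$ of the map $\varphi\mapsto\mathcal O(\varphi)$ sending a deformation tensor to the CR obstruction density of the deformed structure computed w.r.t. $\theta$. *)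

(* Defs.v *)
From Stdlib Require Import Reals List.
From Coquelicot Require Import Coquelicot.

Open Scope C_scope.

(* A point of C^2 is given by two complex coordinates (z, w).  Functions on C^2
   (and, by restriction, on S^3) are curried maps  C -> C -> C. *)

Definition onS3 (z w : C) : Prop := (Cmod z ^ 2 + Cmod w ^ 2)%R = 1%R.

Definition dR (g : R -> C) (t : R) : C :=
  (Derive (fun s => Re (g s)) t, Derive (fun s => Im (g s)) t).

Definition dir (v : C * C) (F : C -> C -> C) : C -> C -> C :=
  fun z w => dR (fun t => F (z + RtoC t * fst v) (w + RtoC t * snd v)) 0%R.

Definition iter_dir (l : list (C * C)) (F : C -> C -> C) : C -> C -> C :=
  fold_right dir F l.

Definition smooth (F : C -> C -> C) : Prop :=
  forall l : list (C * C),
    (forall (v : C * C) (z w : C),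
        ex_derive (fun t => Re (iter_dir l F (z + RtoC t * fst v) (w + RtoC t * snd v))) 0%R /\
        ex_derive (fun t => Im (iter_dir l F (z + RtoC t * fst v) (w + RtoC t * snd v))) 0%R) /\
    (forall z w : C, continuous (fun p : C * C => iter_dir l F (fst p) (snd p)) (z, w)).

Definition dz  (F : C -> C -> C) : C -> C -> C :=
  fun z w => / 2 * (dir (RtoC 1, RtoC 0) F z w - Ci * dir (Ci, RtoC 0) F z w).
Definition dzb (F : C -> C -> C) : C -> C -> C :=
  fun z w => / 2 * (dir (RtoC 1, RtoC 0) F z w + Ci * dir (Ci, RtoC 0) F z w).
Definition dw  (F : C -> C -> C) : C -> C -> C :=
  fun z w => / 2 * (dir (RtoC 0, RtoC 1) F z w - Ci * dir (RtoC 0, Ci) F z w).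
Definition dwb (F : C -> C -> C) : C -> C -> C :=
  fun z w => / 2 * (dir (RtoC 0, RtoC 1) F z w + Ci * dir (RtoC 0, Ci) F z w).

(* Z_1 = wbar d_z - zbar d_w,  Z_1bar = w d_zbar - z d_wbar,
   T = i(z d_z + w d_w) - i(zbar d_zbar + wbar d_wbar).  These vector fields are
   tangent to the spheres |z|^2+|w|^2 = const, so applied to a smooth extension
   of a function on S^3 their values on S^3 only depend on the function on S^3. *)
Definition Z1 (F : C -> C -> C) : C -> C -> C :=
  fun z w => Cconj w * dz F z w - Cconj z * dw F z w.
Definition Zb1 (F : C -> C -> C) : C -> C -> C :=
  fun z w => w * dzb F z w - z * dwb F z w.
Definition T (F : C -> C -> C) : C -> C -> C :=
  fun z w => Ci * (z * dz F z w + w * dw F z w)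
             - Ci * (Cconj z * dzb F z w + Cconj w * dwb F z w).
Definition T4 (F : C -> C -> C) : C -> C -> C :=
  fun z w => T F z w + 4 * Ci * F z w.

Definition conjf (F : C -> C -> C) : C -> C -> C := fun z w => Cconj (F z w).

Definition DQ (F : C -> C -> C) : C -> C -> C :=
  fun z w =>
    / 6 * Z1 (Z1 (Zb1 (Zb1 F))) z w
    + / 6 * Z1 (Z1 (Z1 (Z1 (conjf F)))) z w
    - T4 (T4 F) z w
    - (2 * Ci / 3) * Z1 (Zb1 (T4 F)) z w
    + Ci * T4 F z w.

Definition DO (F : C -> C -> C) : C -> C -> C := Zb1 (Zb1 (DQ F)).

Definition CInt (f : R -> C) (a b : R) : C :=
  (RInt (fun t => Re (f t)) a b, RInt (fun t => Im (f t)) a b).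

Definition expi (a : R) : C := (cos a, sin a).

(* L^2(S^3) inner product <F,G> = int_{S^3} F conj(G), computed in Hopf
   coordinates z = cos(eta) e^{i alpha}, w = sin(eta) e^{i beta}, in which the
   volume element is sin(eta) cos(eta) d eta d alpha d beta.  (theta /\ d theta
   is a nonzero constant multiple of this volume form, which does not affect
   orthogonality.) *)
Definition ip (F G : C -> C -> C) : C :=
  CInt (fun eta =>
    CInt (fun alpha =>
      CInt (fun beta =>
        let z := RtoC (cos eta) * expi alpha in
        let w := RtoC (sin eta) * expi beta in
        F z w * Cconj (G z w) * RtoC (sin eta * cos eta)%R)
      0 (2 * PI)) 0 (2 * PI)) 0 (PI / 2).

Fixpoint Cpow (z : C) (n : nat) : C :=
  match n with O => 1 | S k => z * Cpow z k end.

Definition Csum (l : list nat) (f : nat -> C) : C :=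
  fold_right (fun a acc => f a + acc) 0 l.

Definition hpoly (p q : nat) (c : nat -> nat -> C) : C -> C -> C :=
  fun z w =>
    Csum (seq 0 (S p)) (fun a =>
      Csum (seq 0 (S q)) (fun b =>
        c a b * Cpow z a * Cpow w (p - a) * Cpow (Cconj z) b * Cpow (Cconj w) (q - b))).

(* harmonic on C^2: Laplacian = 4 (d_z d_zbar + d_w d_wbar) vanishes *)
Definition harmonic (P : C -> C -> C) : Prop :=
  forall z w : C, dz (dzb P) z w + dw (dwb P) z w = 0.

(* The H_{p,q}-component of F vanishes, i.e. F is L^2-orthogonal to every
   element of H_{p,q} (restrictions to S^3 of harmonic polynomials of
   bidegree (p,q)). *)
Definition comp_zero (F : C -> C -> C) (p q : nat) : Prop :=
  forall c : nat -> nat -> C, harmonic (hpoly p q c) -> ip F (hpoly p q c) = 0.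

Definition inD0 (F : C -> C -> C) : Prop :=
  forall p q : nat, (q = 0 \/ q = 1)%nat -> comp_zero F p q.
Definition inD0perp (F : C -> C -> C) : Prop :=
  forall p q : nat, (2 <= q)%nat -> comp_zero F p q.

Definition trivial_deformation (F : C -> C -> C) : Prop :=
  exists f : C -> C -> C, smooth f /\
    (forall z w, onS3 z w -> Im (f z w) = 0%R) /\
    (forall z w, onS3 z w -> F z w = Ci * Z1 (Z1 f) z w).

(* Main.v *)
(** Both [Z1] and [Zb1] are, up to sign, adjoint to each other on the sphere; [Zb1] maps [H_{p,q}] to
    [H_{p+1,q-1}], and [Z1 Zb1 = - q (p + 1)] on [H_{p,q}].  Hence everything reduces to moving vector
    fields onto spherical harmonics, plus the completeness of the latter: a smooth [F] orthogonal to
    all [H_{p,q}] vanishes on the sphere.  For [F] in [D_0^perp] and [Y] harmonic, [<DO F, Y>] is a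
    combination of products [<F, Y'>] and conjugates of such, with [Y'] in some [H_{p,q}], [q >= 2],
    so [DO F = 0]; and [i Z1^2 f] is orthogonal to [H_{p,0}] and [H_{p,1}], so it lies in [D_0].

    Completeness: the span of the harmonics is stable under multiplication by the coordinates on the
    sphere, hence contains all polynomials, and powers of a polynomial peaking at a point detect the
    value there.

    The splitting needs that the projection onto [q = 0, 1] preserves smoothness.  The part
    [q = 0] of [F] is the series of [(n + 1) / vol * (int F(s) <x, s>^n ds)], whose terms decay faster
    than any power of [n] since [T] acts on [<x, s>^n] by [- i n].  It converges with all derivatives
    on the closed unit ball, and composing with [x -> exp ((1 - |x|^2) / 2) x], which maps [C^2] into
    the ball and fixes the sphere, extends it smoothly to [C^2].  The part [q = 1] is obtained from the
    part [q = 0] of [Zb1 F]. *)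

From Stdlib Require Import Reals List Lra Lia FunctionalExtensionality Classical ClassicalEpsilon.
From Coquelicot Require Import Coquelicot.
Require Import Defs.
Open Scope C_scope.

(** * Calculus of smooth functions *)

(** The series that defines the projection is controlled only on the closed ball, and the sphere,
    where it matters, is the boundary of that ball. Termwise differentiation is therefore avoided: a
    Taylor estimate with quadratic remainder, uniform up to the boundary, shows that a first
    derivative is a series of the same kind, with $F$ multiplied by $\bar z$ or $\bar w$ and with
    coefficients $n\lambda_n$ shifted by one. Allowing all coefficient sequences of polynomial
    growth closes this family under differentiation, so one step gives all orders. The projection
    also yields orthogonality: membership in $\mathfrak D_0^\perp$ only tests against harmonics, and
    equality on the sphere with a uniformly convergent series is what permits pairing with an
    arbitrary element of $\mathfrak D_0$. The constant $(n+1)/\mathrm{vol}$ comes from two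
    recursions for the norms of $z^aw^b$, one from $|z|^2+|w|^2=1$, the other from $Z_{\bar1}$
    killing holomorphic polynomials; only the volume is integrated explicitly. *)

Notation fn := (C -> C -> C) (only parsing).

Definition fadd (F G : fn) : fn := fun z w => F z w + G z w.
Definition fmul (F G : fn) : fn := fun z w => F z w * G z w.
Definition fcst (c : C) : fn := fun _ _ => c.
Definition fz : fn := fun z _ => z.
Definition fw : fn := fun _ w => w.

Lemma fext (F G : fn) : (forall z w, F z w = G z w) -> F = G.
Proof.
  intros H. apply functional_extensionality; intros z.
  apply functional_extensionality; intros w. apply H.
Qed.

Lemma C_ext (a b : C) : Re a = Re b -> Im a = Im b -> a = b.
Proof. destruct a, b; simpl; intros -> ->; reflexivity. Qed.

Definition is_dR (g : R -> C) (t : R) (l : C) : Prop :=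
  is_derive (fun s => Re (g s)) t (Re l) /\ is_derive (fun s => Im (g s)) t (Im l).

Lemma is_dR_unique g t l : is_dR g t l -> dR g t = l.
Proof.
  intros [H1 H2]. unfold dR. apply C_ext; simpl; apply is_derive_unique; assumption.
Qed.

Lemma is_dR_dR g t :
  ex_derive (fun s => Re (g s)) t -> ex_derive (fun s => Im (g s)) t -> is_dR g t (dR g t).
Proof. intros H1 H2. split; simpl; apply Derive_correct; assumption. Qed.

Lemma is_dR_ext f g t l : (forall s, f s = g s) -> is_dR f t l -> is_dR g t l.
Proof.
  intros H [H1 H2]. split.
  - apply is_derive_ext with (2 := H1). intros s; now rewrite H.
  - apply is_derive_ext with (2 := H2). intros s; now rewrite H.
Qed.

Lemma is_dR_eq f t a b : is_dR f t a -> a = b -> is_dR f t b.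
Proof. intros H <-. exact H. Qed.

Lemma is_dR_const c t : is_dR (fun _ => c) t 0.
Proof. split; simpl; apply @is_derive_const. Qed.

Lemma is_derive_Rmult (f g : R -> R) t a b :
  is_derive f t a -> is_derive g t b ->
  is_derive (fun s => (f s * g s)%R) t (a * g t + f t * b)%R.
Proof. intros H1 H2. apply (is_derive_mult f g t a b H1 H2). intros; apply Rmult_comm. Qed.

Lemma is_dR_plus f g t a b :
  is_dR f t a -> is_dR g t b -> is_dR (fun s => f s + g s) t (a + b).
Proof.
  intros [H1 H2] [H3 H4]. split; simpl.
  - exact (is_derive_plus _ _ _ _ _ H1 H3).
  - exact (is_derive_plus _ _ _ _ _ H2 H4).
Qed.

Lemma is_dR_mult f g t a b :
  is_dR f t a -> is_dR g t b -> is_dR (fun s => f s * g s) t (a * g t + f t * b).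
Proof.
  intros [H1 H2] [H3 H4]. split; simpl.
  - pose proof (is_derive_minus _ _ _ _ _ (is_derive_Rmult _ _ _ _ _ H1 H3)
       (is_derive_Rmult _ _ _ _ _ H2 H4)) as H.
    evar_last. exact H. unfold minus, plus, opp; simpl. unfold Re, Im. ring.
  - pose proof (is_derive_plus _ _ _ _ _ (is_derive_Rmult _ _ _ _ _ H1 H4)
       (is_derive_Rmult _ _ _ _ _ H2 H3)) as H.
    evar_last. exact H. unfold minus, plus, opp; simpl. unfold Re, Im. ring.
Qed.

Lemma is_dR_conj f t a : is_dR f t a -> is_dR (fun s => Cconj (f s)) t (Cconj a).
Proof.
  intros [H1 H2]. split; simpl; [exact H1|]. exact (is_derive_opp _ _ _ H2).
Qed.

Lemma is_dR_RtoC f t a : is_derive f t a -> is_dR (fun s => RtoC (f s)) t (RtoC a).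
Proof. intros H. split; simpl; [exact H|]. apply @is_derive_const. Qed.

Lemma is_dR_shift (g : R -> C) t l :
  is_dR (fun s => g (t + s)%R) 0 l -> is_dR g t l.
Proof.
  assert (K : forall (f : R -> R) a, is_derive (fun s => f (t + s)%R) 0%R a -> is_derive f t a).
  { intros f a H.
    apply is_derive_ext with (f := fun y => (fun s => f (t + s)%R) (y - t)%R).
    { intros y. f_equal. ring. }
    replace a with (scal 1%R a) by (unfold scal; simpl; unfold mult; simpl; ring).
    apply (is_derive_comp (fun s => f (t + s)%R) (fun y => (y - t)%R)).
    - replace (t - t)%R with 0%R by ring. exact H.
    - auto_derive; [exact I|ring]. }
  intros [H1 H2]. split; [apply (K (fun s => Re (g s)))|apply (K (fun s => Im (g s)))]; assumption.
Qed.

Lemma continuous_C {U : UniformSpace} (f : U -> C) x :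
  continuous (fun u => Re (f u)) x -> continuous (fun u => Im (f u)) x -> continuous f x.
Proof.
  intros H1 H2.
  apply continuous_ext with (f := fun u => (Re (f u), Im (f u))).
  { intros u. now destruct (f u). }
  unfold continuous. apply filterlim_filter_le_2 with (2 := filterlim_pair _ _ H1 H2).
  intros P [eps HP]. exists (ball (Re (f x)) eps) (ball (Im (f x)) eps).
  - now exists eps.
  - now exists eps.
  - intros a b Ha Hb. apply HP. now split.
Qed.

Lemma continuous_Re {U : UniformSpace} (f : U -> C) x :
  continuous f x -> continuous (fun u => Re (f u)) x.
Proof.
  intros H. apply (continuous_comp f (fun c : C => fst c)); [exact H|].
  destruct (f x). apply continuous_fst.
Qed.

Lemma continuous_Im {U : UniformSpace} (f : U -> C) x :
  continuous f x -> continuous (fun u => Im (f u)) x.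
Proof.
  intros H. apply (continuous_comp f (fun c : C => snd c)); [exact H|].
  destruct (f x). apply continuous_snd.
Qed.

Lemma continuous_Rmult {U : UniformSpace} (f g : U -> R) x :
  continuous f x -> continuous g x -> continuous (fun u => (f u * g u)%R) x.
Proof. intros H1 H2. exact (continuous_mult f g x H1 H2). Qed.

Lemma continuous_Rplus {U : UniformSpace} (f g : U -> R) x :
  continuous f x -> continuous g x -> continuous (fun u => (f u + g u)%R) x.
Proof. intros H1 H2. exact (continuous_plus f g x H1 H2). Qed.

Lemma continuous_Ropp {U : UniformSpace} (f : U -> R) x :
  continuous f x -> continuous (fun u => (- f u)%R) x.
Proof. intros H1. exact (continuous_opp f x H1). Qed.

Lemma continuous_Cplus {U : UniformSpace} (f g : U -> C) x :
  continuous f x -> continuous g x -> continuous (fun u => f u + g u) x.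
Proof.
  intros Hf Hg. apply continuous_C.
  - exact (continuous_Rplus _ _ _ (continuous_Re f x Hf) (continuous_Re g x Hg)).
  - exact (continuous_Rplus _ _ _ (continuous_Im f x Hf) (continuous_Im g x Hg)).
Qed.

Lemma continuous_Cmult {U : UniformSpace} (f g : U -> C) x :
  continuous f x -> continuous g x -> continuous (fun u => f u * g u) x.
Proof.
  intros Hf Hg.
  pose proof (continuous_Re f x Hf) as H1. pose proof (continuous_Im f x Hf) as H2.
  pose proof (continuous_Re g x Hg) as H3. pose proof (continuous_Im g x Hg) as H4.
  apply continuous_C.
  - exact (continuous_Rplus _ _ _ (continuous_Rmult _ _ _ H1 H3)
      (continuous_Ropp _ _ (continuous_Rmult _ _ _ H2 H4))).
  - exact (continuous_Rplus _ _ _ (continuous_Rmult _ _ _ H1 H4)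
      (continuous_Rmult _ _ _ H2 H3)).
Qed.

Lemma continuous_Cconj {U : UniformSpace} (f : U -> C) x :
  continuous f x -> continuous (fun u => Cconj (f u)) x.
Proof.
  intros Hf. apply continuous_C; simpl.
  - now apply continuous_Re.
  - apply continuous_Ropp. now apply continuous_Im.
Qed.

Lemma continuous_RtoC {U : UniformSpace} (f : U -> R) x :
  continuous f x -> continuous (fun u => RtoC (f u)) x.
Proof. intros H. apply continuous_C; simpl; [exact H|apply continuous_const]. Qed.

Definition contF (F : fn) : Prop :=
  forall z w : C, continuous (fun p : C * C => F (fst p) (snd p)) (z, w).

Lemma contF_comp {U : UniformSpace} (F : fn) (f g : U -> C) x :
  contF F -> continuous f x -> continuous g x -> continuous (fun u => F (f u) (g u)) x.
Proof. intros HF Hf Hg. apply continuous_comp_2; auto. Qed.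

Definition diffF (F : fn) : Prop :=
  forall v z w, is_dR (fun t => F (z + RtoC t * fst v) (w + RtoC t * snd v)) 0 (dir v F z w).

(** Smoothness constrains every iterated directional derivative, so it is the largest class of
    line-differentiable, continuous functions stable under [dir]. To prove a function smooth it
    suffices to put it into some stable class. *)
Lemma smooth_coind (P : fn -> Prop) :
  (forall F, P F -> diffF F /\ contF F /\ forall v, P (dir v F)) ->
  forall F, P F -> smooth F.
Proof.
  intros H F HF l.
  assert (K : P (iter_dir l F)).
  { induction l as [|v l IH]; [exact HF|]. simpl. apply H. exact IH. }
  destruct (H _ K) as (H1 & H2 & _). split; [|exact H2].
  intros v z w. destruct (H1 v z w) as [A B]. split; eexists; eassumption.
Qed.

Lemma smooth_diffF F : smooth F -> diffF F.
Proof.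
  intros HF v z w. destruct (HF nil) as [H _]. destruct (H v z w) as [A B].
  apply is_dR_dR; assumption.
Qed.

Lemma smooth_contF F : smooth F -> contF F.
Proof. intros HF. exact (proj2 (HF nil)). Qed.

Lemma smooth_dir v F : smooth F -> smooth (dir v F).
Proof.
  intros HF l. replace (iter_dir l (dir v F)) with (iter_dir (l ++ v :: nil) F).
  apply HF. unfold iter_dir. now rewrite fold_right_app.
Qed.

(** Needed for functions whose derivatives are not of the same form but are sums of products of such
    functions and smooth ones, as for exponentials and for the series extension below. *)
Inductive gen (B : fn -> Prop) : fn -> Prop :=
| gen_base F : B F -> gen B F
| gen_add F G : gen B F -> gen B G -> gen B (fadd F G)
| gen_mul F G : gen B F -> gen B G -> gen B (fmul F G).

Lemma diffF_dir_add F G v : diffF F -> diffF G ->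
  dir v (fadd F G) = fadd (dir v F) (dir v G).
Proof.
  intros HF HG. apply fext; intros z w. apply is_dR_unique.
  apply (is_dR_plus _ _ _ _ _ (HF v z w) (HG v z w)).
Qed.

Lemma line_0 (z v : C) : z + RtoC 0 * v = z.
Proof. ring. Qed.

Lemma diffF_dir_mul F G v : diffF F -> diffF G ->
  dir v (fmul F G) = fadd (fmul (dir v F) G) (fmul F (dir v G)).
Proof.
  intros HF HG. apply fext; intros z w. apply is_dR_unique.
  pose proof (is_dR_mult _ _ _ _ _ (HF v z w) (HG v z w)) as H.
  cbv beta in H. rewrite !line_0 in H. exact H.
Qed.

Lemma diffF_add F G : diffF F -> diffF G -> diffF (fadd F G).
Proof.
  intros HF HG v z w. rewrite diffF_dir_add by assumption.
  apply (is_dR_plus _ _ _ _ _ (HF v z w) (HG v z w)).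
Qed.

Lemma diffF_mul F G : diffF F -> diffF G -> diffF (fmul F G).
Proof.
  intros HF HG v z w. rewrite diffF_dir_mul by assumption.
  pose proof (is_dR_mult _ _ _ _ _ (HF v z w) (HG v z w)) as H.
  cbv beta in H. rewrite !line_0 in H. exact H.
Qed.

(** By the product rule, stability under [dir] passes from the generators to all sums of products,
    so [smooth_coind] applies to the class [gen B]. *)
Lemma gen_smooth (B : fn -> Prop) :
  (forall F, B F -> diffF F /\ contF F /\ forall v, gen B (dir v F)) ->
  forall F, gen B F -> smooth F.
Proof.
  intros H. apply smooth_coind.
  intros F HF. induction HF as [F HF|F G _ (F1 & F2 & F3) _ (G1 & G2 & G3)
                              |F G HF (F1 & F2 & F3) HG (G1 & G2 & G3)].
  - apply H. exact HF.
  - split; [|split].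
    + now apply diffF_add.
    + intros z w. apply continuous_Cplus; [apply F2|apply G2].
    + intros v. rewrite diffF_dir_add by assumption. apply gen_add; auto.
  - split; [|split].
    + now apply diffF_mul.
    + intros z w. apply continuous_Cmult; [apply F2|apply G2].
    + intros v. rewrite diffF_dir_mul by assumption.
      apply gen_add; apply gen_mul; auto.
Qed.

Lemma gen_smooth_smooth F : gen smooth F -> smooth F.
Proof.
  apply gen_smooth. intros G HG. split; [|split].
  - now apply smooth_diffF.
  - now apply smooth_contF.
  - intros v. apply gen_base. now apply smooth_dir.
Qed.

Lemma smooth_add F G : smooth F -> smooth G -> smooth (fadd F G).
Proof. intros HF HG. apply gen_smooth_smooth. apply gen_add; now apply gen_base. Qed.

Lemma smooth_mul F G : smooth F -> smooth G -> smooth (fmul F G).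
Proof. intros HF HG. apply gen_smooth_smooth. apply gen_mul; now apply gen_base. Qed.

Lemma dir_fcst v c : dir v (fcst c) = fcst 0.
Proof. apply fext; intros z w. apply is_dR_unique. exact (is_dR_const c 0%R). Qed.

Lemma diffF_fcst c : diffF (fcst c).
Proof. intros v z w. rewrite dir_fcst. exact (is_dR_const c 0%R). Qed.

Lemma smooth_fcst c : smooth (fcst c).
Proof.
  apply smooth_coind with (P := fun F => exists c, F = fcst c).
  - intros F [a ->]. split; [|split].
    + apply diffF_fcst.
    + intros z w. apply continuous_const.
    + intros v. rewrite dir_fcst. now exists 0.
  - now exists c.
Qed.

Lemma is_dR_line (z v : C) t : is_dR (fun s => z + RtoC s * v) t v.
Proof.
  pose proof (is_dR_plus _ _ _ _ _ (is_dR_const z t)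
    (is_dR_mult _ _ _ _ _ (is_dR_RtoC (fun s => s) t 1%R (is_derive_id t)) (is_dR_const v t))) as H.
  apply (is_dR_eq _ _ _ _ H).
  cbv beta. ring.
Qed.

Lemma dir_fz v : dir v fz = fcst (fst v).
Proof. apply fext; intros z w. apply is_dR_unique. exact (is_dR_line z (fst v) 0%R). Qed.

Lemma dir_fw v : dir v fw = fcst (snd v).
Proof. apply fext; intros z w. apply is_dR_unique. exact (is_dR_line w (snd v) 0%R). Qed.

Lemma smooth_fz_fw : smooth fz /\ smooth fw.
Proof.
  set (P := fun F => F = fz \/ F = fw \/ exists c, F = fcst c).
  assert (K : forall F, P F -> smooth F).
  { apply smooth_coind. intros F [->|[->|[c ->]]]; (split; [|split]).
    - intros v z w. rewrite dir_fz. exact (is_dR_line z (fst v) 0%R).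
    - intros z w. apply continuous_fst.
    - intros v. right; right. exists (fst v). apply dir_fz.
    - intros v z w. rewrite dir_fw. exact (is_dR_line w (snd v) 0%R).
    - intros z w. apply continuous_snd.
    - intros v. right; right. exists (snd v). apply dir_fw.
    - apply diffF_fcst.
    - intros z w. apply continuous_const.
    - intros v. right; right. exists 0. apply dir_fcst. }
  split; apply K; unfold P; auto.
Qed.

Lemma smooth_fz : smooth fz. Proof. apply smooth_fz_fw. Qed.
Lemma smooth_fw : smooth fw. Proof. apply smooth_fz_fw. Qed.

Lemma diffF_dir_conj F v : diffF F -> dir v (conjf F) = conjf (dir v F).
Proof.
  intros HF. apply fext; intros z w. apply is_dR_unique.
  apply (is_dR_conj _ _ _ (HF v z w)).
Qed.

Lemma smooth_conj F : smooth F -> smooth (conjf F).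
Proof.
  intros HF. apply smooth_coind with (P := fun G => exists H, smooth H /\ G = conjf H).
  - intros G (H & HS & ->). pose proof (smooth_diffF _ HS) as HD. split; [|split].
    + intros v z w. rewrite diffF_dir_conj by assumption.
      apply (is_dR_conj _ _ _ (HD v z w)).
    + intros z w. apply continuous_Cconj. now apply smooth_contF.
    + intros v. exists (dir v H). split; [now apply smooth_dir|now apply diffF_dir_conj].
  - now exists F.
Qed.

(** The real part makes the real exponential sufficient; its derivative is [fexp g] times the real
    part of the derivative of [g], which [fre] expresses as a smooth function. *)
Definition fexp (g : fn) : fn := fun z w => RtoC (exp (Re (g z w))).
Definition fre (g : fn) : fn := fmul (fcst (/ 2)) (fadd g (conjf g)).

Lemma smooth_fre g : smooth g -> smooth (fre g).
Proof.
  intros H. apply smooth_mul; [apply smooth_fcst|].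
  apply smooth_add; [exact H|now apply smooth_conj].
Qed.

Lemma fre_val g z w : fre g z w = RtoC (Re (g z w)).
Proof.
  unfold fre, fmul, fadd, fcst, conjf. destruct (g z w) as [a b].
  apply C_ext; simpl; field.
Qed.

Lemma is_dR_exp (g : R -> C) t l : is_dR g t l ->
  is_dR (fun s => RtoC (exp (Re (g s)))) t (RtoC (exp (Re (g t))) * RtoC (Re l)).
Proof.
  intros [H1 _]. rewrite <- RtoC_mult. apply is_dR_RtoC.
  rewrite Rmult_comm.
  exact (is_derive_comp exp (fun s => Re (g s)) t _ _ (is_derive_exp _) H1).
Qed.

Lemma smooth_fexp g : smooth g -> smooth (fexp g).
Proof.
  intros Hg. apply gen_smooth with (B := fun F => smooth F \/ exists h, smooth h /\ F = fexp h).
  2: { apply gen_base. right. now exists g. }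
  intros F [HF|(h & Hh & ->)].
  - split; [now apply smooth_diffF|split; [now apply smooth_contF|]].
    intros v. apply gen_base. left. now apply smooth_dir.
  - assert (D : forall v z w, is_dR (fun t => fexp h (z + RtoC t * fst v) (w + RtoC t * snd v)) 0
        (fmul (fexp h) (fre (dir v h)) z w)).
    { intros v z w. unfold fmul. rewrite fre_val.
      pose proof (is_dR_exp _ _ _ (smooth_diffF _ Hh v z w)) as H.
      cbv beta in H. rewrite !line_0 in H. exact H. }
    assert (E : forall v, dir v (fexp h) = fmul (fexp h) (fre (dir v h))).
    { intros v. apply fext; intros z w. apply is_dR_unique. apply D. }
    split; [|split].
    + intros v z w. rewrite E. apply D.
    + intros z w. apply continuous_RtoC.
      apply (continuous_comp (fun p : C * C => Re (h (fst p) (snd p))) exp).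
      * apply continuous_Re. now apply smooth_contF.
      * apply (ex_derive_continuous (V := R_NormedModule) exp).
        eexists; apply is_derive_exp.
    + intros v. rewrite E. apply gen_mul; apply gen_base.
      * right. now exists h.
      * left. apply smooth_fre. now apply smooth_dir.
Qed.

(** * Chain rule and symmetry of second derivatives *)

Lemma is_dR_comp (g : R -> C) (x : R -> R) t l x' :
  is_dR g (x t) l -> is_derive x t x' -> is_dR (fun s => g (x s)) t (RtoC x' * l).
Proof.
  intros [H1 H2] Hx. split.
  - replace (Re (RtoC x' * l)) with (scal x' (Re l)).
    + exact (is_derive_comp _ x t _ _ H1 Hx).
    + unfold scal; simpl; unfold mult; destruct l; simpl. ring.
  - replace (Im (RtoC x' * l)) with (scal x' (Im l)).
    + exact (is_derive_comp _ x t _ _ H2 Hx).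
    + unfold scal; simpl; unfold mult; destruct l; simpl. ring.
Qed.

(** A continuous partial derivative in the first variable together with differentiability in the
    second at the point gives total differentiability there. This lets variables be split off one at
    a time. *)
Lemma is_derive_diag (f dfx : R -> R -> R) (t d : R) :
  (forall a b, is_derive (fun s => f s b) a (dfx a b)) ->
  continuous (fun p : R * R => dfx (fst p) (snd p)) (t, t) ->
  is_derive (fun s => f t s) t d ->
  is_derive (fun s => f s s) t (dfx t t + d)%R.
Proof.
  intros H1 H2 H3.
  assert (K : filterdiff (fun u : R * R => f (fst u) (snd u)) (locally (t, t))
            (fun u : R * R => plus (scal (fst u) (dfx t t)) (scal (snd u) d))).
  { apply is_derive_filterdiff with (dfx := dfx); auto.
    apply filter_forall. intros u. apply H1. }
  pose proof (filterdiff_comp'_2 (fun s : R => s) (fun s : R => s) f t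
     (fun s => s) (fun s => s) (fun a b => plus (scal a (dfx t t)) (scal b d))
     (filterdiff_id _) (filterdiff_id _) K) as H.
  apply filterdiff_ext_lin with (1 := H). intros y.
  unfold plus, scal; simpl; unfold mult; simpl. ring.
Qed.

Lemma is_dR_diag (f dfx : R -> R -> C) (t : R) (d : C) :
  (forall a b, is_dR (fun s => f s b) a (dfx a b)) ->
  continuous (fun p : R * R => dfx (fst p) (snd p)) (t, t) ->
  is_dR (fun s => f t s) t d ->
  is_dR (fun s => f s s) t (dfx t t + d).
Proof.
  intros H1 H2 [H3 H4]. split.
  - apply (is_derive_diag (fun a b => Re (f a b)) (fun a b => Re (dfx a b))); auto.
    + intros a b. apply H1.
    + exact (continuous_Re _ _ H2).
  - apply (is_derive_diag (fun a b => Im (f a b)) (fun a b => Im (dfx a b))); auto.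
    + intros a b. apply H1.
    + exact (continuous_Im _ _ H2).
Qed.

Lemma smooth_line F v z w t : smooth F ->
  is_dR (fun s => F (z + RtoC s * fst v) (w + RtoC s * snd v)) t
        (dir v F (z + RtoC t * fst v) (w + RtoC t * snd v)).
Proof.
  intros HF. apply is_dR_shift.
  eapply is_dR_ext; [|apply (smooth_diffF _ HF)].
  intros s. simpl. f_equal; rewrite RtoC_plus; ring.
Qed.

Lemma continuous_fst' {U V : UniformSpace} (p : U * V) : continuous fst p.
Proof. destruct p. apply continuous_fst. Qed.
Lemma continuous_snd' {U V : UniformSpace} (p : U * V) : continuous snd p.
Proof. destruct p. apply continuous_snd. Qed.

(** Each use of [is_dR_diag] splits off one of the four real coordinates, the remaining ones moving
    together as the second variable. *)
Lemma smooth_chain_real F (x y u v x' y' u' v' : R -> R) :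
  smooth F ->
  (forall t, is_derive x t (x' t)) -> (forall t, is_derive y t (y' t)) ->
  (forall t, is_derive u t (u' t)) -> (forall t, is_derive v t (v' t)) ->
  (forall t, continuous x' t) -> (forall t, continuous y' t) -> (forall t, continuous u' t) ->
  forall t, is_dR (fun s => F (x s, y s) (u s, v s)) t
    (RtoC (x' t) * dir (RtoC 1, RtoC 0) F (x t, y t) (u t, v t)
     + (RtoC (y' t) * dir (Ci, RtoC 0) F (x t, y t) (u t, v t)
     + (RtoC (u' t) * dir (RtoC 0, RtoC 1) F (x t, y t) (u t, v t)
     + RtoC (v' t) * dir (RtoC 0, Ci) F (x t, y t) (u t, v t)))).
Proof.
  intros HF Hx Hy Hu Hv Cx Cy Cu t.
  assert (L : forall v z w (g h : R -> C), (forall s, z + RtoC s * fst v = g s) ->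
     (forall s, w + RtoC s * snd v = h s) -> forall a, is_dR (fun s => F (g s) (h s)) a (dir v F (g a) (h a))).
  { intros e z w g h Hg Hh a. rewrite <- Hg, <- Hh. eapply is_dR_ext; [|exact (smooth_line F e z w a HF)].
    intros s. simpl. now rewrite Hg, Hh. }
  assert (A1 : forall a b w, is_dR (fun s => F (s, b) w) a (dir (RtoC 1, RtoC 0) F (a, b) w)).
  { intros a b w. apply (L (RtoC 1, RtoC 0) (0%R, b) w (fun s => (s, b)) (fun _ => w));
      intros s; apply C_ext; unfold Re, Im; simpl; ring. }
  assert (A2 : forall a b w, is_dR (fun s => F (a, s) w) b (dir (Ci, RtoC 0) F (a, b) w)).
  { intros a b w. apply (L (Ci, RtoC 0) (a, 0%R) w (fun s => (a, s)) (fun _ => w));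
      intros s; apply C_ext; unfold Re, Im; simpl; ring. }
  assert (A3 : forall a b w, is_dR (fun s => F w (s, b)) a (dir (RtoC 0, RtoC 1) F w (a, b))).
  { intros a b w. apply (L (RtoC 0, RtoC 1) w (0%R, b) (fun _ => w) (fun s => (s, b)));
      intros s; apply C_ext; unfold Re, Im; simpl; ring. }
  assert (A4 : forall a b w, is_dR (fun s => F w (a, s)) b (dir (RtoC 0, Ci) F w (a, b))).
  { intros a b w. apply (L (RtoC 0, Ci) w (a, 0%R) (fun _ => w) (fun s => (a, s)));
      intros s; apply C_ext; unfold Re, Im; simpl; ring. }
  assert (cont : forall f f' : R -> R, (forall t, is_derive f t (f' t)) -> forall t, continuous f t).
  { intros f f' Hf s. apply (ex_derive_continuous (V := R_NormedModule)). eexists; apply Hf. }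
  pose proof (cont _ _ Hx) as cx. pose proof (cont _ _ Hy) as cy.
  pose proof (cont _ _ Hu) as cu. pose proof (cont _ _ Hv) as cv.
  assert (C1 : forall (f : R -> R), (forall t, continuous f t) ->
     forall p : R * R, continuous (fun p => f (fst p)) p).
  { intros f Hf p. apply (continuous_comp fst f); [apply continuous_fst'|apply Hf]. }
  assert (C2 : forall (f : R -> R), (forall t, continuous f t) ->
     forall p : R * R, continuous (fun p => f (snd p)) p).
  { intros f Hf p. apply (continuous_comp snd f); [apply continuous_snd'|apply Hf]. }
  assert (CD : forall e (a b c d k : R * R -> R) p, continuous a p -> continuous b p ->
     continuous c p -> continuous d p -> continuous k p ->
     continuous (fun p => RtoC (k p) * dir e F (a p, b p) (c p, d p)) p).
  { intros e a b c d k p Ha Hb Hc Hd Hk. apply continuous_Cmult.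
    - now apply continuous_RtoC.
    - apply contF_comp; [apply smooth_contF; now apply smooth_dir| |]; now apply continuous_C. }
  apply (is_dR_diag (fun a s => F (x a, y s) (u s, v s))
    (fun a s => RtoC (x' a) * dir (RtoC 1, RtoC 0) F (x a, y s) (u s, v s))).
  { intros a b. exact (is_dR_comp (fun s => F (s, y b) (u b, v b)) x a _ _ (A1 _ _ _) (Hx a)). }
  { apply (CD _ (fun p => x (fst p)) (fun p => y (snd p)) (fun p => u (snd p)) (fun p => v (snd p)) (fun p => x' (fst p))); auto. }
  apply (is_dR_diag (fun a s => F (x t, y a) (u s, v s))
    (fun a s => RtoC (y' a) * dir (Ci, RtoC 0) F (x t, y a) (u s, v s))).
  { intros a b. exact (is_dR_comp (fun s => F (x t, s) (u b, v b)) y a _ _ (A2 _ _ _) (Hy a)). }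
  { apply (CD _ (fun p => x t) (fun p => y (fst p)) (fun p => u (snd p)) (fun p => v (snd p)) (fun p => y' (fst p))); auto. apply continuous_const. }
  apply (is_dR_diag (fun a s => F (x t, y t) (u a, v s))
    (fun a s => RtoC (u' a) * dir (RtoC 0, RtoC 1) F (x t, y t) (u a, v s))).
  { intros a b. exact (is_dR_comp (fun s => F (x t, y t) (s, v b)) u a _ _ (A3 _ _ _) (Hu a)). }
  { apply (CD _ (fun p => x t) (fun p => y t) (fun p => u (fst p)) (fun p => v (snd p)) (fun p => u' (fst p))); auto; apply continuous_const. }
  exact (is_dR_comp (fun s => F (x t, y t) (u t, s)) v t _ _ (A4 _ _ _) (Hv t)).
Qed.

Lemma smooth_chain F (a b a' b' : R -> C) :
  smooth F ->
  (forall t, is_dR a t (a' t)) -> (forall t, is_dR b t (b' t)) ->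
  (forall t, continuous a' t) -> (forall t, continuous b' t) ->
  forall t, is_dR (fun s => F (a s) (b s)) t
    (dz F (a t) (b t) * a' t + dzb F (a t) (b t) * Cconj (a' t)
     + dw F (a t) (b t) * b' t + dwb F (a t) (b t) * Cconj (b' t)).
Proof.
  intros HF Ha Hb Ca Cb t.
  pose proof (smooth_chain_real F (fun s => Re (a s)) (fun s => Im (a s)) (fun s => Re (b s))
     (fun s => Im (b s)) (fun s => Re (a' s)) (fun s => Im (a' s)) (fun s => Re (b' s))
     (fun s => Im (b' s)) HF (fun s => proj1 (Ha s)) (fun s => proj2 (Ha s))
     (fun s => proj1 (Hb s)) (fun s => proj2 (Hb s)) (fun s => continuous_Re _ _ (Ca s))
     (fun s => continuous_Im _ _ (Ca s)) (fun s => continuous_Re _ _ (Cb s)) t) as H.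
  assert (E : forall c : C, (Re c, Im c) = c) by (now intros []).
  cbv beta in H. rewrite !E in H.
  match type of H with is_dR _ _ ?l => match goal with |- is_dR _ _ ?m => replace m with l end end.
  - eapply is_dR_ext; [|exact H]. intros s. cbv beta. now rewrite !E.
  - unfold dz, dzb, dw, dwb. generalize (dir (RtoC 1, RtoC 0) F (a t) (b t)) (dir (Ci, RtoC 0) F (a t) (b t))
     (dir (RtoC 0, RtoC 1) F (a t) (b t)) (dir (RtoC 0, Ci) F (a t) (b t)).
    intros [p1 p2] [q1 q2] [r1 r2] [s1 s2]. destruct (a' t), (b' t). apply C_ext; simpl; field.
Qed.

(** Schwarz's theorem for the function $(s,t)\mapsto F(p+su+tv)$ of two real parameters, whose mixed
    partial derivatives are values of smooth functions and hence continuous. *)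
Lemma dir_comm F u v : smooth F -> dir u (dir v F) = dir v (dir u F).
Proof.
  intros HF. apply fext; intros z w.
  set (L := fun (s t : R) (G : fn) =>
     G (z + RtoC s * fst u + RtoC t * fst v) (w + RtoC s * snd u + RtoC t * snd v)).
  assert (Lt : forall G s t, smooth G -> is_dR (fun x => L s x G) t (L s t (dir v G))).
  { intros G s t HG. apply smooth_line, HG. }
  assert (Ls : forall G s t, smooth G -> is_dR (fun x => L x t G) s (L s t (dir u G))).
  { intros G s t HG. unfold L.
    pose proof (smooth_line G u (z + RtoC t * fst v) (w + RtoC t * snd v) s HG) as H.
    match type of H with is_dR _ _ (dir u G ?A ?B) =>
      replace (z + RtoC s * fst u + RtoC t * fst v) with A by ring;
      replace (w + RtoC s * snd u + RtoC t * snd v) with B by ring end.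
    eapply is_dR_ext; [|exact H]. intros x. cbv beta. f_equal; ring. }
  assert (E1 : L 0%R 0%R (dir u (dir v F)) = dir u (dir v F) z w).
  { unfold L. f_equal; ring. }
  assert (E2 : L 0%R 0%R (dir v (dir u F)) = dir v (dir u F) z w).
  { unfold L. f_equal; ring. }
  pose proof (smooth_dir u F HF) as HuF. pose proof (smooth_dir v F HF) as HvF.
  assert (CL : forall G p, smooth G -> continuous (fun p : R * R => L (fst p) (snd p) G) p).
  { intros G p HG. unfold L.
    assert (K : forall a b c : C, continuous (fun p : R * R => a + RtoC (fst p) * b + RtoC (snd p) * c) p).
    { intros a b c.
      exact (continuous_Cplus _ _ _ (continuous_Cplus _ _ _ (continuous_const a p)
        (continuous_Cmult _ _ _ (continuous_RtoC fst p (continuous_fst' p)) (continuous_const b p)))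
        (continuous_Cmult _ _ _ (continuous_RtoC snd p (continuous_snd' p)) (continuous_const c p))). }
    apply contF_comp; [now apply smooth_contF|apply K|apply K]. }
  rewrite <- E1, <- E2.
  (* The projection [pr] stands for [Re] and [Im], so that the real theorem is applied only once. *)
  assert (S : forall pr : C -> R,
     (forall (g : R -> C) t l, is_dR g t l -> is_derive (fun s => pr (g s)) t (pr l)) ->
     (forall (g : R * R -> C) p, continuous g p -> continuous (fun p => pr (g p)) p) ->
     pr (L 0%R 0%R (dir u (dir v F))) = pr (L 0%R 0%R (dir v (dir u F)))).
  { intros pr P1 P2.
    assert (D1 : forall s t, Derive (fun x => pr (L s x F)) t = pr (L s t (dir v F))).
    { intros s t. apply is_derive_unique, P1, Lt, HF. }
    assert (D2 : forall s t, Derive (fun x => pr (L x t F)) s = pr (L s t (dir u F))).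
    { intros s t. apply is_derive_unique. apply (P1 (fun x => L x t F)), Ls, HF. }
    assert (D3 : forall s t, is_derive (fun y => Derive (fun x => pr (L y x F)) t) s (pr (L s t (dir u (dir v F))))).
    { intros s t. eapply is_derive_ext. intros y; symmetry; apply D1.
      apply (P1 (fun y => L y t (dir v F))), Ls, HvF. }
    assert (D4 : forall s t, is_derive (fun y => Derive (fun x => pr (L x y F)) s) t (pr (L s t (dir v (dir u F))))).
    { intros s t. eapply is_derive_ext. intros y; symmetry; apply D2.
      apply (P1 (fun y => L s y (dir u F))), Lt, HuF. }
    rewrite <- (is_derive_unique _ _ _ (D3 0%R 0%R)), <- (is_derive_unique _ _ _ (D4 0%R 0%R)).
    apply (Schwarz (fun s t => pr (L s t F))).
    - apply locally_2d_forall. intros s t. repeat split.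
      + eexists. apply (P1 (fun x => L x t F)), Ls, HF.
      + eexists. apply (P1 (fun x => L s x F)), Lt, HF.
      + eexists. apply D3.
      + eexists. apply D4.
    - apply continuity_2d_pt_filterlim.
      apply continuous_ext with (f := fun p : R * R => pr (L (fst p) (snd p) (dir u (dir v F)))).
      + intros p. symmetry. apply is_derive_unique, D3.
      + apply P2, CL. now apply smooth_dir.
    - apply continuity_2d_pt_filterlim.
      apply continuous_ext with (f := fun p : R * R => pr (L (fst p) (snd p) (dir v (dir u F)))).
      + intros p. symmetry. apply is_derive_unique, D4.
      + apply P2, CL. now apply smooth_dir. }
  apply C_ext; apply S.
  - intros g t l [H _]. exact H.
  - intros g p. apply continuous_Re.
  - intros g t l [_ H]. exact H.
  - intros g p. apply continuous_Im.
Qed.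

(** * Derivations: Wirtinger derivatives and the vector fields *)

Record derivation (D : fn -> fn) : Prop := {
  der_smooth : forall F, smooth F -> smooth (D F);
  der_add : forall F G, smooth F -> smooth G -> D (fadd F G) = fadd (D F) (D G);
  der_mul : forall F G, smooth F -> smooth G ->
    D (fmul F G) = fadd (fmul (D F) G) (fmul F (D G));
  der_cst : forall c, D (fcst c) = fcst 0 }.

Ltac fcrush := apply fext; intros ? ?; unfold fadd, fmul, fcst, conjf, fz, fw; ring.

Lemma derivation_dir v : derivation (dir v).
Proof.
  split.
  - intros F. apply smooth_dir.
  - intros F G HF HG. apply diffF_dir_add; now apply smooth_diffF.
  - intros F G HF HG. apply diffF_dir_mul; now apply smooth_diffF.
  - apply dir_fcst.
Qed.

(** All the operators [dz], [dw], [Z1], [Zb1], [Ta], [Tb], [T] and their conjugates arise by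
    iterating this from directional derivatives, so [derivation_comb] supplies the product rule for
    each of them. *)
Definition comb (a : fn) (D : fn -> fn) (b : fn) (E : fn -> fn) : fn -> fn :=
  fun F => fadd (fmul a (D F)) (fmul b (E F)).

Lemma derivation_comb a b D E : smooth a -> smooth b -> derivation D -> derivation E ->
  derivation (comb a D b E).
Proof.
  intros Ha Hb HD HE. unfold comb. split.
  - intros F HF. apply smooth_add; apply smooth_mul; auto;
      [apply (der_smooth _ HD)|apply (der_smooth _ HE)]; exact HF.
  - intros F G HF HG. rewrite (der_add _ HD), (der_add _ HE) by assumption. fcrush.
  - intros F G HF HG. rewrite (der_mul _ HD), (der_mul _ HE) by assumption. fcrush.
  - intros c. rewrite (der_cst _ HD), (der_cst _ HE). fcrush.
Qed.

Lemma der_scal D c F : derivation D -> smooth F -> D (fmul (fcst c) F) = fmul (fcst c) (D F).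
Proof.
  intros HD HF. rewrite (der_mul _ HD), (der_cst _ HD); [fcrush|apply smooth_fcst|exact HF].
Qed.

Ltac feq := apply functional_extensionality; intros ?F; apply fext; intros ?z ?w;
  unfold Z1, Zb1, T, comb, dz, dzb, dw, dwb, fadd, fmul, fcst, fz, fw, conjf; try field; try ring.

Lemma dz_comb : dz = comb (fcst (/ 2)) (dir (RtoC 1, RtoC 0)) (fcst (- Ci / 2)) (dir (Ci, RtoC 0)).
Proof. feq. Qed.
Lemma dzb_comb : dzb = comb (fcst (/ 2)) (dir (RtoC 1, RtoC 0)) (fcst (Ci / 2)) (dir (Ci, RtoC 0)).
Proof. feq. Qed.
Lemma dw_comb : dw = comb (fcst (/ 2)) (dir (RtoC 0, RtoC 1)) (fcst (- Ci / 2)) (dir (RtoC 0, Ci)).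
Proof. feq. Qed.
Lemma dwb_comb : dwb = comb (fcst (/ 2)) (dir (RtoC 0, RtoC 1)) (fcst (Ci / 2)) (dir (RtoC 0, Ci)).
Proof. feq. Qed.

Create HintDb sm discriminated.
#[local] Hint Resolve smooth_fcst smooth_fz smooth_fw smooth_add smooth_mul smooth_conj smooth_dir
  derivation_dir : sm.

Lemma derivation_dz : derivation dz.
Proof. rewrite dz_comb. apply derivation_comb; auto with sm. Qed.
Lemma derivation_dzb : derivation dzb.
Proof. rewrite dzb_comb. apply derivation_comb; auto with sm. Qed.
Lemma derivation_dw : derivation dw.
Proof. rewrite dw_comb. apply derivation_comb; auto with sm. Qed.
Lemma derivation_dwb : derivation dwb.
Proof. rewrite dwb_comb. apply derivation_comb; auto with sm. Qed.
#[local] Hint Resolve derivation_dz derivation_dzb derivation_dw derivation_dwb : sm.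

Lemma Z1_comb : Z1 = comb (conjf fw) dz (fmul (fcst (-(1))) (conjf fz)) dw.
Proof. feq. Qed.
Lemma Zb1_comb : Zb1 = comb fw dzb (fmul (fcst (-(1))) fz) dwb.
Proof. feq. Qed.

(* The generators of the rotations [z -> exp(it) z] and [w -> exp(it) w]. *)
Definition Ta (F : fn) : fn := fun z w => Ci * (z * dz F z w) - Ci * (Cconj z * dzb F z w).
Definition Tb (F : fn) : fn := fun z w => Ci * (w * dw F z w) - Ci * (Cconj w * dwb F z w).

Lemma Ta_comb : Ta = comb (fmul (fcst Ci) fz) dz (fmul (fcst (- Ci)) (conjf fz)) dzb.
Proof. unfold Ta; feq. Qed.
Lemma Tb_comb : Tb = comb (fmul (fcst Ci) fw) dw (fmul (fcst (- Ci)) (conjf fw)) dwb.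
Proof. unfold Tb; feq. Qed.
Lemma T_comb : T = comb (fcst 1) Ta (fcst 1) Tb.
Proof. unfold Ta, Tb; feq. Qed.

Lemma derivation_Z1 : derivation Z1.
Proof. rewrite Z1_comb. apply derivation_comb; auto with sm. Qed.
Lemma derivation_Zb1 : derivation Zb1.
Proof. rewrite Zb1_comb. apply derivation_comb; auto with sm. Qed.
Lemma derivation_Ta : derivation Ta.
Proof. rewrite Ta_comb. apply derivation_comb; auto with sm. Qed.
Lemma derivation_Tb : derivation Tb.
Proof. rewrite Tb_comb. apply derivation_comb; auto with sm. Qed.
#[local] Hint Resolve derivation_Z1 derivation_Zb1 derivation_Ta derivation_Tb : sm.
Lemma derivation_T : derivation T.
Proof. rewrite T_comb. apply derivation_comb; auto with sm. Qed.
#[local] Hint Resolve derivation_T : sm.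

Lemma smooth_dz F : smooth F -> smooth (dz F). Proof. apply der_smooth; auto with sm. Qed.
Lemma smooth_dzb F : smooth F -> smooth (dzb F). Proof. apply der_smooth; auto with sm. Qed.
Lemma smooth_dw F : smooth F -> smooth (dw F). Proof. apply der_smooth; auto with sm. Qed.
Lemma smooth_dwb F : smooth F -> smooth (dwb F). Proof. apply der_smooth; auto with sm. Qed.
Lemma smooth_Z1 F : smooth F -> smooth (Z1 F). Proof. apply der_smooth; auto with sm. Qed.
Lemma smooth_Zb1 F : smooth F -> smooth (Zb1 F). Proof. apply der_smooth; auto with sm. Qed.
Lemma smooth_T F : smooth F -> smooth (T F). Proof. apply der_smooth; auto with sm. Qed.
#[local] Hint Resolve smooth_dz smooth_dzb smooth_dw smooth_dwb smooth_Z1 smooth_Zb1 smooth_T : sm.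

Lemma T4_eq F : T4 F = fadd (T F) (fmul (fcst (4 * Ci)) F).
Proof. apply fext; intros; unfold T4, fadd, fmul, fcst; ring. Qed.
Lemma smooth_T4 F : smooth F -> smooth (T4 F).
Proof. intros. rewrite T4_eq. auto with sm. Qed.
#[local] Hint Resolve smooth_T4 : sm.

Lemma cdir_comm a u b v c u' d v' F : smooth F ->
  comb (fcst a) (dir u) (fcst b) (dir v) (comb (fcst c) (dir u') (fcst d) (dir v') F)
  = comb (fcst c) (dir u') (fcst d) (dir v') (comb (fcst a) (dir u) (fcst b) (dir v) F).
Proof.
  intros HF. unfold comb.
  repeat (rewrite (der_add _ (derivation_dir _)) by auto with sm).
  repeat (rewrite (der_scal _ _ _ (derivation_dir _)) by auto with sm).
  rewrite (dir_comm F u u'), (dir_comm F u v'), (dir_comm F v u'), (dir_comm F v v') by assumption.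
  fcrush.
Qed.

Lemma dz_dzb F : smooth F -> dz (dzb F) = dzb (dz F).
Proof. rewrite dz_comb, dzb_comb. apply cdir_comm. Qed.
Lemma dz_dw F : smooth F -> dz (dw F) = dw (dz F).
Proof. rewrite dz_comb, dw_comb. apply cdir_comm. Qed.
Lemma dz_dwb F : smooth F -> dz (dwb F) = dwb (dz F).
Proof. rewrite dz_comb, dwb_comb. apply cdir_comm. Qed.
Lemma dzb_dw F : smooth F -> dzb (dw F) = dw (dzb F).
Proof. rewrite dzb_comb, dw_comb. apply cdir_comm. Qed.
Lemma dzb_dwb F : smooth F -> dzb (dwb F) = dwb (dzb F).
Proof. rewrite dzb_comb, dwb_comb. apply cdir_comm. Qed.
Lemma dw_dwb F : smooth F -> dw (dwb F) = dwb (dw F).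
Proof. rewrite dw_comb, dwb_comb. apply cdir_comm. Qed.

Lemma dir_conj F v : smooth F -> dir v (conjf F) = conjf (dir v F).
Proof. intros HF. apply diffF_dir_conj, smooth_diffF, HF. Qed.

Ltac cconj := apply fext; intros ? ?; unfold Z1, Zb1, T, Ta, Tb, dz, dzb, dw, dwb, conjf;
  apply C_ext; simpl; field.

Lemma conj_conj F : conjf (conjf F) = F.
Proof. apply fext; intros. apply Cconj_conj. Qed.
Lemma conj_add F G : conjf (fadd F G) = fadd (conjf F) (conjf G).
Proof. apply fext; intros. apply Cplus_conj. Qed.
Lemma conj_mul F G : conjf (fmul F G) = fmul (conjf F) (conjf G).
Proof. apply fext; intros. apply Cmult_conj. Qed.
Lemma conj_cst c : conjf (fcst c) = fcst (Cconj c).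
Proof. reflexivity. Qed.

Lemma dz_conj F : smooth F -> dz (conjf F) = conjf (dzb F).
Proof. intros HF. unfold dz. rewrite !dir_conj by assumption. cconj. Qed.
Lemma dzb_conj F : smooth F -> dzb (conjf F) = conjf (dz F).
Proof. intros HF. unfold dzb. rewrite !dir_conj by assumption. cconj. Qed.
Lemma dw_conj F : smooth F -> dw (conjf F) = conjf (dwb F).
Proof. intros HF. unfold dw. rewrite !dir_conj by assumption. cconj. Qed.
Lemma dwb_conj F : smooth F -> dwb (conjf F) = conjf (dw F).
Proof. intros HF. unfold dwb. rewrite !dir_conj by assumption. cconj. Qed.

Ltac cconj2 := apply fext; intros ? ?; unfold Z1, Zb1, T, Ta, Tb, conjf;
  rewrite ?Cminus_conj, ?Cplus_conj, ?Cmult_conj, ?Cminus_conj, ?Cplus_conj, ?Cmult_conj, ?Cconj_conj;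
  try (apply C_ext; simpl; ring).

Lemma Z1_conj F : smooth F -> Z1 (conjf F) = conjf (Zb1 F).
Proof. intros HF. unfold Z1. rewrite dz_conj, dw_conj by assumption. cconj2. Qed.
Lemma Zb1_conj F : smooth F -> Zb1 (conjf F) = conjf (Z1 F).
Proof. intros HF. unfold Zb1. rewrite dzb_conj, dwb_conj by assumption. cconj2. Qed.
Lemma Ta_conj F : smooth F -> Ta (conjf F) = conjf (Ta F).
Proof. intros HF. unfold Ta. rewrite dzb_conj, dz_conj by assumption. cconj2. Qed.
Lemma Tb_conj F : smooth F -> Tb (conjf F) = conjf (Tb F).
Proof. intros HF. unfold Tb. rewrite dwb_conj, dw_conj by assumption. cconj2. Qed.
Lemma T_conj F : smooth F -> T (conjf F) = conjf (T F).
Proof. intros HF. unfold T. rewrite dwb_conj, dw_conj, dzb_conj, dz_conj by assumption. cconj2. Qed.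

Ltac coord := apply fext; intros ? ?; unfold dz, dzb, dw, dwb;
  rewrite ?dir_fz, ?dir_fw; unfold fcst; simpl fst; simpl snd;
  apply C_ext; simpl; field.
Lemma dz_fz : dz fz = fcst 1. Proof. coord. Qed.
Lemma dzb_fz : dzb fz = fcst 0. Proof. coord. Qed.
Lemma dw_fz : dw fz = fcst 0. Proof. coord. Qed.
Lemma dwb_fz : dwb fz = fcst 0. Proof. coord. Qed.
Lemma dz_fw : dz fw = fcst 0. Proof. coord. Qed.
Lemma dzb_fw : dzb fw = fcst 0. Proof. coord. Qed.
Lemma dw_fw : dw fw = fcst 1. Proof. coord. Qed.
Lemma dwb_fw : dwb fw = fcst 0. Proof. coord. Qed.
Definition fzb := conjf fz.
Definition fwb := conjf fw.
Lemma smooth_fzb : smooth fzb. Proof. unfold fzb; auto with sm. Qed.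
Lemma smooth_fwb : smooth fwb. Proof. unfold fwb; auto with sm. Qed.
#[local] Hint Resolve smooth_fzb smooth_fwb : sm.
Ltac coordb := unfold fzb, fwb; rewrite ?dz_conj, ?dzb_conj, ?dw_conj, ?dwb_conj by auto with sm;
  rewrite ?dz_fz, ?dzb_fz, ?dw_fz, ?dwb_fz, ?dz_fw, ?dzb_fw, ?dw_fw, ?dwb_fw, conj_cst;
  f_equal; apply C_ext; simpl; ring.
Lemma dz_fzb : dz fzb = fcst 0. Proof. coordb. Qed.
Lemma dzb_fzb : dzb fzb = fcst 1. Proof. coordb. Qed.
Lemma dw_fzb : dw fzb = fcst 0. Proof. coordb. Qed.
Lemma dwb_fzb : dwb fzb = fcst 0. Proof. coordb. Qed.
Lemma dz_fwb : dz fwb = fcst 0. Proof. coordb. Qed.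
Lemma dzb_fwb : dzb fwb = fcst 0. Proof. coordb. Qed.
Lemma dw_fwb : dw fwb = fcst 0. Proof. coordb. Qed.
Lemma dwb_fwb : dwb fwb = fcst 1. Proof. coordb. Qed.

(** * Integration over the sphere in Hopf coordinates *)

(** Joint continuity and compactness of $[a,b]$ make $f(y,\cdot)$ uniformly close to $f(x,\cdot)$ on
    the interval when $y$ is near $x$. The parameter space is general so that the result can be
    iterated through the triple integral. *)
Lemma continuous_RInt_param {U : UniformSpace} (f : U -> R -> R) (a b : R) : (a <= b)%R ->
  (forall p, continuous (fun p : U * R => f (fst p) (snd p)) p) ->
  forall x, continuous (fun x => RInt (f x) a b) x.
Proof.
  intros Hab Hf x.
  assert (Hc : forall y t, continuous (f y) t).
  { intros y t. apply (continuous_comp (fun t => (y, t)) (fun p : U * R => f (fst p) (snd p))).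
    - intros P [eps HP]. exists eps. intros s Hs. apply HP. split; [apply ball_center|exact Hs].
    - apply Hf. }
  assert (Hi : forall y, ex_RInt (f y) a b).
  { intros y. apply (ex_RInt_continuous (V := R_CompleteNormedModule)). intros; apply Hc. }
  intros P [eps HP].
  (* The summand 1 covers the case $a=b$ and makes $e(b-a)$ strictly smaller than [eps]. *)
  set (e := (eps / (2 * (b - a + 1)))%R).
  assert (He : (0 < e)%R).
  { apply Rdiv_lt_0_compat; [apply eps|lra]. }
  assert (K : forall t : R, exists d : posreal, forall y s, ball x d y -> (Rabs (s - t) < d)%R ->
     (Rabs (f y s - f x t) < e / 2)%R).
  { intros t.
    assert (L : locally (f x t) (fun v => (Rabs (v - f x t) < e / 2)%R)).
    { exists (mkposreal (e / 2) ltac:(lra)). intros v Hv. exact Hv. }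
    destruct (Hf (x, t) _ L) as [d Hd]. exists d. intros y s Hy Hs.
    apply (Hd (y, s)). split; [exact Hy|exact Hs]. }
  (* The compactness lemma takes a gauge given as a function, hence a radius is chosen for every
     [t]. *)
  set (delta := fun t => proj1_sig (constructive_indefinite_description _ (K t))).
  assert (Hdelta : forall t y s, ball x (delta t) y -> (Rabs (s - t) < delta t)%R ->
     (Rabs (f y s - f x t) < e / 2)%R).
  { intros t. exact (proj2_sig (constructive_indefinite_description _ (K t))). }
  destruct (compactness_value_1d a b delta) as [d Hd].
  exists d. intros y Hy. apply HP.
  assert (B : forall s, (a <= s <= b)%R -> (Rabs (f y s - f x s) <= e)%R).
  { intros s Hs. apply NNPP. intros N. apply (Hd s Hs). intros (t & _ & H1 & H2).
    apply N.
    pose proof (Hdelta t y s (ball_le _ _ _ H2 _ Hy) H1) as G1.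
    pose proof (Hdelta t x s (ball_center _ _) H1) as G2.
    replace (f y s - f x s)%R with ((f y s - f x t) - (f x s - f x t))%R by ring.
    eapply Rle_trans; [apply Rabs_triang|]. rewrite Rabs_Ropp. lra. }
  assert (M : RInt (fun s => f y s - f x s)%R a b = (RInt (f y) a b - RInt (f x) a b)%R).
  { exact (RInt_minus (f y) (f x) a b (Hi y) (Hi x)). }
  change (Rabs (RInt (f y) a b - RInt (f x) a b) < eps)%R. rewrite <- M.
  eapply Rle_lt_trans.
  - apply (abs_RInt_le_const _ a b e Hab).
    + exact (ex_RInt_minus (f y) (f x) a b (Hi y) (Hi x)).
    + exact B.
  - unfold e. apply Rmult_lt_reg_r with (2 * (b - a + 1))%R; [lra|].
    field_simplify; [|lra]. pose proof (cond_pos eps). nra.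
Qed.

Lemma continuous_pair {U V W : UniformSpace} (f : U -> V) (g : U -> W) x :
  continuous f x -> continuous g x -> continuous (fun u => (f u, g u)) x.
Proof.
  intros H1 H2. unfold continuous.
  apply filterlim_filter_le_2 with (2 := filterlim_pair _ _ H1 H2).
  intros P [eps HP]. exists (ball (f x) eps) (ball (g x) eps).
  - now exists eps.
  - now exists eps.
  - intros a b Ha Hb. apply HP. now split.
Qed.

Definition cont2 (f : R -> R -> R) : Prop :=
  forall p : R * R, continuous (fun p : R * R => f (fst p) (snd p)) p.

Definition cont3 (f : R -> R -> R -> R) : Prop :=
  forall p : R * R * R, continuous (fun p : R * R * R => f (fst (fst p)) (snd (fst p)) (snd p)) p.

Lemma cont2_at f x t : cont2 f -> continuous (f x) t.
Proof.
  intros Hf. apply (continuous_comp (fun t => (x, t)) (fun p : R * R => f (fst p) (snd p))).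
  - apply continuous_pair; [apply continuous_const|apply continuous_id].
  - apply Hf.
Qed.

Lemma cont3_at f x : cont3 f -> cont2 (f x).
Proof.
  intros Hf p. apply (continuous_comp (fun p : R * R => ((x, fst p), snd p))
    (fun p : R * R * R => f (fst (fst p)) (snd (fst p)) (snd p))).
  - apply continuous_pair; [apply continuous_pair|apply continuous_snd'];
      [apply continuous_const|apply continuous_fst'].
  - apply Hf.
Qed.

Lemma cont3_RInt f a b : (a <= b)%R -> cont3 f -> cont2 (fun x y => RInt (f x y) a b).
Proof.
  intros Hab Hf p.
  apply (continuous_RInt_param (fun p : R * R => f (fst p) (snd p))); auto.
Qed.

Lemma cont2_RInt f a b : (a <= b)%R -> cont2 f -> forall x, continuous (fun x => RInt (f x) a b) x.
Proof. intros Hab Hf. apply continuous_RInt_param; auto. Qed.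

Lemma continuous_ex_RInt (f : R -> R) a b : (forall t, continuous f t) -> ex_RInt f a b.
Proof.
  intros H. apply (ex_RInt_continuous (V := R_CompleteNormedModule)). intros; apply H.
Qed.

Definition hopf_int (f : R -> R -> R -> R) : R :=
  RInt (fun e => RInt (fun a => RInt (fun b => f e a b) 0 (2 * PI)) 0 (2 * PI)) 0 (PI / 2).

Lemma PI2_nonneg : (0 <= 2 * PI)%R.
Proof. pose proof PI_RGT_0; lra. Qed.
Lemma PIhalf_nonneg : (0 <= PI / 2)%R.
Proof. pose proof PI_RGT_0; lra. Qed.

Lemma hopf_int_ex3 f : cont3 f -> forall e a, ex_RInt (f e a) 0 (2 * PI).
Proof.
  intros Hf e a. apply continuous_ex_RInt. intros t. apply cont2_at. now apply cont3_at.
Qed.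

Lemma hopf_int_ex2 f : cont3 f -> forall e, ex_RInt (fun a => RInt (f e a) 0 (2 * PI)) 0 (2 * PI).
Proof.
  intros Hf e. apply continuous_ex_RInt. apply cont2_RInt; [apply PI2_nonneg|].
  now apply cont3_at.
Qed.

Lemma hopf_int_ex1 f : cont3 f ->
  ex_RInt (fun e => RInt (fun a => RInt (f e a) 0 (2 * PI)) 0 (2 * PI)) 0 (PI / 2).
Proof.
  intros Hf. apply continuous_ex_RInt.
  apply (cont2_RInt (fun e a => RInt (f e a) 0 (2 * PI))); [apply PI2_nonneg|].
  apply cont3_RInt; [apply PI2_nonneg|exact Hf].
Qed.

Lemma hopf_int_plus f g : cont3 f -> cont3 g -> hopf_int (fun e a b => f e a b + g e a b)%R = (hopf_int f + hopf_int g)%R.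
Proof.
  intros Hf Hg. unfold hopf_int.
  etransitivity; [|exact (RInt_plus _ _ _ _ (hopf_int_ex1 f Hf) (hopf_int_ex1 g Hg))].
  apply RInt_ext. intros e _.
  etransitivity; [|exact (RInt_plus _ _ _ _ (hopf_int_ex2 f Hf e) (hopf_int_ex2 g Hg e))].
  apply RInt_ext. intros a _.
  exact (RInt_plus _ _ _ _ (hopf_int_ex3 f Hf e a) (hopf_int_ex3 g Hg e a)).
Qed.

Lemma hopf_int_scal k f : cont3 f -> hopf_int (fun e a b => k * f e a b)%R = (k * hopf_int f)%R.
Proof.
  intros Hf. unfold hopf_int.
  etransitivity; [|exact (RInt_scal _ _ _ k (hopf_int_ex1 f Hf))].
  apply RInt_ext. intros e _.
  etransitivity; [|exact (RInt_scal _ _ _ k (hopf_int_ex2 f Hf e))].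
  apply RInt_ext. intros a _.
  exact (RInt_scal _ _ _ k (hopf_int_ex3 f Hf e a)).
Qed.

Lemma hopf_int_le f g : cont3 f -> cont3 g -> (forall e a b, (f e a b <= g e a b)%R) -> (hopf_int f <= hopf_int g)%R.
Proof.
  intros Hf Hg H. unfold hopf_int.
  apply RInt_le; [apply PIhalf_nonneg|now apply hopf_int_ex1|now apply hopf_int_ex1|intros e _].
  apply RInt_le; [apply PI2_nonneg|now apply hopf_int_ex2|now apply hopf_int_ex2|intros a _].
  apply RInt_le; [apply PI2_nonneg|now apply hopf_int_ex3|now apply hopf_int_ex3|intros b _]. apply H.
Qed.

Lemma hopf_int_abs_le f g : cont3 f -> cont3 g -> (forall e a b, (Rabs (f e a b) <= g e a b)%R) ->
  (Rabs (hopf_int f) <= hopf_int g)%R.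
Proof.
  intros Hf Hg H. apply Rabs_le. split.
  - replace (- hopf_int g)%R with (-1 * hopf_int g)%R by ring. rewrite <- hopf_int_scal by assumption.
    apply hopf_int_le; auto.
    + intros p. apply continuous_Rmult; [apply continuous_const|apply Hg].
    + intros e a b. specialize (H e a b). apply Rabs_le_between in H. lra.
  - apply hopf_int_le; auto. intros e a b. specialize (H e a b). apply Rabs_le_between in H. lra.
Qed.

Lemma is_derive_RInt_cont (f f' : R -> R -> R) a b x : (a <= b)%R ->
  (forall x t, is_derive (fun x => f x t) x (f' x t)) -> cont2 f -> cont2 f' ->
  is_derive (fun x => RInt (f x) a b) x (RInt (f' x) a b).
Proof.
  intros Hab Hd Hf Hf'.
  assert (E : forall u v, Derive (fun z => f z v) u = f' u v).
  { intros u v. apply is_derive_unique, Hd. }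
  rewrite (RInt_ext (f' x) (fun t => Derive (fun u => f u t) x)).
  2: { intros t _. symmetry. apply E. }
  apply (is_derive_RInt_param f a b x).
  - apply filter_forall. intros y t _. eexists; apply Hd.
  - intros t _. apply continuity_2d_pt_filterlim.
    apply continuous_ext with (2 := Hf' (x, t)). intros p. symmetry. apply E.
  - apply filter_forall. intros y. apply continuous_ex_RInt. intros t. now apply cont2_at.
Qed.

Lemma RInt_is_derive (f f' : R -> R) a b : (forall t, is_derive f t (f' t)) ->
  (forall t, continuous f' t) -> RInt f' a b = (f b - f a)%R.
Proof.
  intros H1 H2. apply is_RInt_unique. apply (is_RInt_derive f f'); auto.
Qed.

Lemma RInt_zero (f : R -> R) a b : (forall t, f t = 0%R) -> RInt f a b = 0%R.
Proof.
  intros H. rewrite (RInt_ext f (fun _ => 0%R)) by (intros; apply H).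
  rewrite RInt_const. apply Rmult_0_r.
Qed.

Lemma hopf_int_db (f f' : R -> R -> R -> R) :
  (forall e a b, is_derive (fun b => f e a b) b (f' e a b)) -> cont3 f' ->
  (forall e a, f e a (2 * PI)%R = f e a 0%R) -> hopf_int f' = 0%R.
Proof.
  intros Hd Hc Hp. unfold hopf_int.
  apply RInt_zero; intros e.
  apply RInt_zero; intros a.
  rewrite (RInt_is_derive (f e a) (f' e a)).
  - rewrite Hp. ring.
  - apply Hd.
  - intros t. apply cont2_at. now apply cont3_at.
Qed.

Lemma cont2_swap f : cont2 f -> cont2 (fun x y => f y x).
Proof.
  intros Hf p. apply (continuous_comp (fun p : R * R => (snd p, fst p))
    (fun p : R * R => f (fst p) (snd p))).
  - apply continuous_pair; [apply continuous_snd'|apply continuous_fst'].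
  - apply Hf.
Qed.

(** Periodicity kills the boundary term, but only after the derivative in the middle variable has
    been pulled out of the innermost integral. *)
Lemma hopf_int_da (f f' : R -> R -> R -> R) :
  (forall e a b, is_derive (fun a => f e a b) a (f' e a b)) -> cont3 f -> cont3 f' ->
  (forall e b, f e (2 * PI)%R b = f e 0%R b) -> hopf_int f' = 0%R.
Proof.
  intros Hd Hc Hc' Hp. unfold hopf_int.
  apply RInt_zero; intros e.
  rewrite (RInt_is_derive (fun a => RInt (f e a) 0 (2 * PI)) (fun a => RInt (f' e a) 0 (2 * PI))).
  - cbv beta. rewrite (RInt_ext (f e (2 * PI)%R) (f e 0%R)); [ring|].
    intros b _. apply Hp.
  - intros a. apply is_derive_RInt_cont; [apply PI2_nonneg| | |]; try now apply cont3_at.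
    intros x t. apply Hd.
  - apply cont2_RInt; [apply PI2_nonneg|now apply cont3_at].
Qed.

Lemma cont3_fix1 f a : cont3 f -> cont2 (fun e b => f e a b).
Proof.
  intros Hf p. apply (continuous_comp (fun p : R * R => ((fst p, a), snd p))
    (fun p : R * R * R => f (fst (fst p)) (snd (fst p)) (snd p))).
  - apply continuous_pair; [apply continuous_pair|apply continuous_snd'];
      [apply continuous_fst'|apply continuous_const].
  - apply Hf.
Qed.

(** The variable $e$ is not periodic. At its ends $0$ and $\pi/2$ one of the two circles of the Hopf
    torus collapses, so here the boundary terms are required to vanish pointwise. *)
Lemma hopf_int_de (f f' : R -> R -> R -> R) :
  (forall e a b, is_derive (fun e => f e a b) e (f' e a b)) -> cont3 f -> cont3 f' ->
  (forall a b, f 0%R a b = 0%R) -> (forall a b, f (PI / 2)%R a b = 0%R) -> hopf_int f' = 0%R.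
Proof.
  intros Hd Hc Hc' H0 H1. unfold hopf_int.
  rewrite (RInt_is_derive (fun e => RInt (fun a => RInt (f e a) 0 (2 * PI)) 0 (2 * PI))
    (fun e => RInt (fun a => RInt (f' e a) 0 (2 * PI)) 0 (2 * PI))).
  - cbv beta.
    assert (Z : forall e, (forall a b, f e a b = 0%R) ->
      RInt (fun a => RInt (f e a) 0 (2 * PI)) 0 (2 * PI) = 0%R).
    { intros e He.
      apply RInt_zero; intros a.
      apply RInt_zero; intros b.
      apply He. }
    rewrite !Z by assumption. ring.
  - intros e. apply (is_derive_RInt_cont (fun e a => RInt (f e a) 0 (2 * PI))
      (fun e a => RInt (f' e a) 0 (2 * PI))); [apply PI2_nonneg| | |].
    + intros x a. apply (is_derive_RInt_cont (fun e b => f e a b) (fun e b => f' e a b));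
        [apply PI2_nonneg| | |]; try now apply cont3_fix1. intros y t. apply Hd.
    + apply cont3_RInt; [apply PI2_nonneg|assumption].
    + apply cont3_RInt; [apply PI2_nonneg|assumption].
  - apply (cont2_RInt (fun e a => RInt (f' e a) 0 (2 * PI))); [apply PI2_nonneg|].
    apply cont3_RInt; [apply PI2_nonneg|assumption].
Qed.

Definition cont3C (f : R -> R -> R -> C) : Prop :=
  forall p : R * R * R, continuous (fun p : R * R * R => f (fst (fst p)) (snd (fst p)) (snd p)) p.

Lemma cont3C_Re f : cont3C f -> cont3 (fun e a b => Re (f e a b)).
Proof. intros Hf p. apply continuous_Re. apply Hf. Qed.
Lemma cont3C_Im f : cont3C f -> cont3 (fun e a b => Im (f e a b)).
Proof. intros Hf p. apply continuous_Im. apply Hf. Qed.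

Definition hopf_intC (f : R -> R -> R -> C) : C :=
  (hopf_int (fun e a b => Re (f e a b)), hopf_int (fun e a b => Im (f e a b))).

Lemma hopf_intC_ext f g : (forall e a b, f e a b = g e a b) -> hopf_intC f = hopf_intC g.
Proof.
  intros H. replace g with f; [reflexivity|].
  repeat (apply functional_extensionality; intros ?). apply H.
Qed.

Lemma hopf_intC_plus f g : cont3C f -> cont3C g -> hopf_intC (fun e a b => f e a b + g e a b) = hopf_intC f + hopf_intC g.
Proof.
  intros Hf Hg. apply C_ext.
  - exact (hopf_int_plus _ _ (cont3C_Re _ Hf) (cont3C_Re _ Hg)).
  - exact (hopf_int_plus _ _ (cont3C_Im _ Hf) (cont3C_Im _ Hg)).
Qed.

Lemma hopf_intC_scal c f : cont3C f -> hopf_intC (fun e a b => c * f e a b) = c * hopf_intC f.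
Proof.
  intros Hf. pose proof (cont3C_Re _ Hf) as H1. pose proof (cont3C_Im _ Hf) as H2.
  assert (S : forall k g, cont3 g -> cont3 (fun e a b => k * g e a b)%R).
  { intros k g Hg p. apply continuous_Rmult; [apply continuous_const|apply Hg]. }
  apply C_ext; simpl; unfold Rminus.
  - rewrite <- (hopf_int_scal (fst c)), <- Ropp_mult_distr_l_reverse, <- (hopf_int_scal (- snd c)), <- hopf_int_plus by auto.
    f_equal. repeat (apply functional_extensionality; intros ?). unfold Re, Im. ring.
  - rewrite <- (hopf_int_scal (fst c)), <- (hopf_int_scal (snd c)), <- hopf_int_plus by auto.
    reflexivity.
Qed.

Lemma hopf_intC_db f f' : (forall e a b, is_dR (fun b => f e a b) b (f' e a b)) -> cont3C f' ->
  (forall e a, f e a (2 * PI)%R = f e a 0%R) -> hopf_intC f' = 0.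
Proof.
  intros Hd Hc Hp. apply C_ext; [apply hopf_int_db with (fun e a b => Re (f e a b))
    |apply hopf_int_db with (fun e a b => Im (f e a b))];
    try (intros; apply Hd); auto using cont3C_Re, cont3C_Im; intros; now rewrite Hp.
Qed.

Lemma hopf_intC_da f f' : (forall e a b, is_dR (fun a => f e a b) a (f' e a b)) -> cont3C f -> cont3C f' ->
  (forall e b, f e (2 * PI)%R b = f e 0%R b) -> hopf_intC f' = 0.
Proof.
  intros Hd Hc Hc' Hp. apply C_ext; [apply hopf_int_da with (fun e a b => Re (f e a b))
    |apply hopf_int_da with (fun e a b => Im (f e a b))];
    try (intros; apply Hd); auto using cont3C_Re, cont3C_Im; intros; now rewrite Hp.
Qed.

Lemma hopf_intC_de f f' : (forall e a b, is_dR (fun e => f e a b) e (f' e a b)) -> cont3C f -> cont3C f' ->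
  (forall a b, f 0%R a b = 0) -> (forall a b, f (PI / 2)%R a b = 0) -> hopf_intC f' = 0.
Proof.
  intros Hd Hc Hc' Hp Hq. apply C_ext; [apply hopf_int_de with (fun e a b => Re (f e a b))
    |apply hopf_int_de with (fun e a b => Im (f e a b))];
    try (intros; apply Hd); auto using cont3C_Re, cont3C_Im; intros; now rewrite ?Hp, ?Hq.
Qed.

Definition hz (e a : R) : C := RtoC (cos e) * expi a.
Definition hw (e b : R) : C := RtoC (sin e) * expi b.
Definition wt (e : R) : C := RtoC (sin e * cos e)%R.

(** Arranged so that [ip F G] unfolds to the integral of [fmul F (conjf G)] by computation alone. *)
Definition sphere_int (F : fn) : C := hopf_intC (fun e a b => F (hz e a) (hw e b) * wt e).

Lemma ip_sphere_int F G : ip F G = sphere_int (fmul F (conjf G)).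
Proof. reflexivity. Qed.

Lemma Cmod_expi a : Cmod (expi a) = 1%R.
Proof.
  unfold Cmod, expi; simpl fst; simpl snd.
  replace (cos a ^ 2 + sin a ^ 2)%R with 1%R; [apply sqrt_1|].
  pose proof (sin2_cos2 a). unfold Rsqr in *. nra.
Qed.

Lemma onS3_hopf e a b : onS3 (hz e a) (hw e b).
Proof.
  unfold onS3, hz, hw. rewrite !Cmod_mult, !Cmod_expi, !Cmod_R, !Rmult_1_r, !RPow_abs.
  pose proof (sin2_cos2 e). unfold Rsqr in *.
  rewrite !Rabs_pos_eq by (apply pow2_ge_0). nra.
Qed.

Lemma continuous_cosf {U : UniformSpace} (f : U -> R) x : continuous f x -> continuous (fun u => cos (f u)) x.
Proof.
  intros H. apply (continuous_comp f cos); [exact H|]. apply continuous_cos.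
Qed.
Lemma continuous_sinf {U : UniformSpace} (f : U -> R) x : continuous f x -> continuous (fun u => sin (f u)) x.
Proof.
  intros H. apply (continuous_comp f sin); [exact H|]. apply continuous_sin.
Qed.

Lemma continuous_expi {U : UniformSpace} (f : U -> R) x : continuous f x -> continuous (fun u => expi (f u)) x.
Proof.
  intros H. apply continuous_C; simpl; [now apply continuous_cosf|now apply continuous_sinf].
Qed.

Definition p1 (p : R * R * R) : R := fst (fst p).
Definition p2 (p : R * R * R) : R := snd (fst p).
Definition p3 (p : R * R * R) : R := snd p.
Lemma continuous_p1 p : continuous p1 p.
Proof. apply (continuous_comp fst fst); apply continuous_fst'. Qed.
Lemma continuous_p2 p : continuous p2 p.
Proof. apply (continuous_comp fst snd); [apply continuous_fst'|apply continuous_snd']. Qed.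
Lemma continuous_p3 p : continuous p3 p.
Proof. apply continuous_snd'. Qed.

Lemma continuous_hz p : continuous (fun p => hz (p1 p) (p2 p)) p.
Proof.
  exact (continuous_Cmult _ _ _ (continuous_RtoC _ _ (continuous_cosf _ _ (continuous_p1 p)))
    (continuous_expi _ _ (continuous_p2 p))).
Qed.
Lemma continuous_hw p : continuous (fun p => hw (p1 p) (p3 p)) p.
Proof.
  exact (continuous_Cmult _ _ _ (continuous_RtoC _ _ (continuous_sinf _ _ (continuous_p1 p)))
    (continuous_expi _ _ (continuous_p3 p))).
Qed.

Lemma cont3C_hopf F : contF F -> cont3C (fun e a b => F (hz e a) (hw e b)).
Proof. intros HF p. exact (contF_comp F _ _ p HF (continuous_hz p) (continuous_hw p)). Qed.

Lemma cont3C_mult f g : cont3C f -> cont3C g -> cont3C (fun e a b => f e a b * g e a b).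
Proof. intros Hf Hg p. exact (continuous_Cmult _ _ _ (Hf p) (Hg p)). Qed.
Lemma cont3C_plus f g : cont3C f -> cont3C g -> cont3C (fun e a b => f e a b + g e a b).
Proof. intros Hf Hg p. exact (continuous_Cplus _ _ _ (Hf p) (Hg p)). Qed.
Lemma cont3C_cos : cont3C (fun e a b => RtoC (cos e)).
Proof. intros p. exact (continuous_RtoC _ _ (continuous_cosf _ _ (continuous_p1 p))). Qed.
Lemma cont3C_sin : cont3C (fun e a b => RtoC (sin e)).
Proof. intros p. exact (continuous_RtoC _ _ (continuous_sinf _ _ (continuous_p1 p))). Qed.
Lemma cont3C_ea : cont3C (fun e a b => expi a).
Proof. intros p. exact (continuous_expi _ _ (continuous_p2 p)). Qed.
Lemma cont3C_eb : cont3C (fun e a b => expi b).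
Proof. intros p. exact (continuous_expi _ _ (continuous_p3 p)). Qed.
Lemma cont3C_conj f : cont3C f -> cont3C (fun e a b => Cconj (f e a b)).
Proof. intros Hf p. exact (continuous_Cconj _ _ (Hf p)). Qed.
Lemma cont3C_const c : cont3C (fun e a b => c).
Proof. intros p. apply continuous_const. Qed.
Lemma cont3C_wt : cont3C (fun e a b => wt e).
Proof.
  intros p. exact (continuous_RtoC _ _ (continuous_Rmult _ _ _
    (continuous_sinf _ _ (continuous_p1 p)) (continuous_cosf _ _ (continuous_p1 p)))).
Qed.
Lemma cont3C_sphere F : contF F -> cont3C (fun e a b => F (hz e a) (hw e b) * wt e).
Proof. intros HF. apply cont3C_mult; [now apply cont3C_hopf|apply cont3C_wt]. Qed.

Lemma cont3C_opp f : cont3C f -> cont3C (fun e a b => - f e a b).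
Proof. intros Hf p. apply continuous_C; apply continuous_Ropp; [apply (cont3C_Re _ Hf)|apply (cont3C_Im _ Hf)]. Qed.

Ltac cont3C_tac := unfold Cminus; repeat match goal with
  | |- cont3C (fun _ _ _ => ?c) => apply cont3C_const
  | |- cont3C (fun e a b => @?f e a b + @?g e a b) => apply (cont3C_plus f g)
  | |- cont3C (fun e a b => @?f e a b * @?g e a b) => apply (cont3C_mult f g)
  | |- cont3C (fun e a b => - @?f e a b) => apply (cont3C_opp f)
  | |- cont3C (fun e a b => Cconj (@?f e a b)) => apply (cont3C_conj f)
  | |- cont3C (fun e a b => RtoC (cos e)) => exact cont3C_cos
  | |- cont3C (fun e a b => RtoC (sin e)) => exact cont3C_sin
  | |- cont3C (fun e a b => expi a) => exact cont3C_ea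
  | |- cont3C (fun e a b => expi b) => exact cont3C_eb
  | |- cont3C (fun e a b => ?F (hz e a) (hw e b)) => apply (cont3C_hopf F); assumption
  end.

Lemma contF_mul F G : contF F -> contF G -> contF (fmul F G).
Proof. intros HF HG z w. exact (continuous_Cmult _ _ _ (HF z w) (HG z w)). Qed.
Lemma contF_add F G : contF F -> contF G -> contF (fadd F G).
Proof. intros HF HG z w. exact (continuous_Cplus _ _ _ (HF z w) (HG z w)). Qed.
Lemma contF_conj F : contF F -> contF (conjf F).
Proof. intros HF z w. exact (continuous_Cconj _ _ (HF z w)). Qed.
Lemma contF_cst c : contF (fcst c).
Proof. intros z w. apply continuous_const. Qed.
#[local] Hint Resolve smooth_contF contF_mul contF_add contF_conj contF_cst : sm.

Lemma sphere_int_add F G : contF F -> contF G -> sphere_int (fadd F G) = sphere_int F + sphere_int G.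
Proof.
  intros HF HG. unfold sphere_int. rewrite <- hopf_intC_plus by now apply cont3C_sphere.
  apply hopf_intC_ext. intros. unfold fadd. ring.
Qed.

Lemma sphere_int_scal c F : contF F -> sphere_int (fmul (fcst c) F) = c * sphere_int F.
Proof.
  intros HF. unfold sphere_int. rewrite <- hopf_intC_scal by now apply cont3C_sphere.
  apply hopf_intC_ext. intros. unfold fmul, fcst. ring.
Qed.

Lemma sphere_int_ext F G : (forall z w, onS3 z w -> F z w = G z w) -> sphere_int F = sphere_int G.
Proof. intros H. apply hopf_intC_ext. intros. now rewrite H by apply onS3_hopf. Qed.

Lemma hopf_int_opp f : cont3 f -> hopf_int (fun e a b => - f e a b)%R = (- hopf_int f)%R.
Proof.
  intros Hf. replace (- hopf_int f)%R with (-1 * hopf_int f)%R by ring. rewrite <- hopf_int_scal by assumption.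
  f_equal. repeat (apply functional_extensionality; intros ?). ring.
Qed.

Lemma sphere_int_conj F : contF F -> sphere_int (conjf F) = Cconj (sphere_int F).
Proof.
  intros HF. pose proof (cont3C_Im _ (cont3C_sphere _ HF)) as HI. apply C_ext; simpl.
  - f_equal. repeat (apply functional_extensionality; intros ?). unfold conjf, wt; simpl. ring.
  - etransitivity; [|exact (hopf_int_opp _ HI)].
    apply (f_equal hopf_int). repeat (apply functional_extensionality; intros ?). unfold conjf, wt; simpl. ring.
Qed.

(** The $L^1$ norm on the sphere, which serves as the constant in every later estimate of an
    integral. *)
Definition nu (F : fn) : R := hopf_int (fun e a b => Cmod (F (hz e a) (hw e b) * wt e)).

Lemma continuous_Cmod {U : UniformSpace} (f : U -> C) x : continuous f x -> continuous (fun u => Cmod (f u)) x.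
Proof.
  intros H. unfold Cmod. apply (continuous_comp _ sqrt).
  - pose proof (continuous_Re _ _ H) as H1. pose proof (continuous_Im _ _ H) as H2.
    apply continuous_ext with (f := fun u => (Re (f u) * Re (f u) + Im (f u) * Im (f u))%R).
    + intros u. unfold Re, Im. simpl. ring.
    + apply continuous_Rplus; now apply continuous_Rmult.
  - apply continuous_sqrt.
Qed.

Lemma cont3_nu F : contF F -> cont3 (fun e a b => Cmod (F (hz e a) (hw e b) * wt e)).
Proof. intros HF p. exact (continuous_Cmod _ _ (cont3C_sphere F HF p)). Qed.

Lemma nu_nonneg F : contF F -> (0 <= nu F)%R.
Proof.
  intros HF. replace 0%R with (hopf_int (fun _ _ _ => 0%R)).
  - apply hopf_int_le; [intros p; apply continuous_const|now apply cont3_nu|]. intros. apply Cmod_ge_0.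
  - unfold hopf_int. do 3 (apply RInt_zero; intros ?). reflexivity.
Qed.

Lemma im_le_Cmod c : (Rabs (Im c) <= Cmod c)%R.
Proof.
  pose proof (Rmax_Cmod c). pose proof (Rmax_r (Rabs (fst c)) (Rabs (snd c))). unfold Im. lra.
Qed.

Lemma Cmod_le_parts c m : (Rabs (Re c) <= m)%R -> (Rabs (Im c) <= m)%R -> (Cmod c <= 2 * m)%R.
Proof.
  intros H1 H2. replace c with (RtoC (Re c) + Ci * RtoC (Im c)) by (apply C_ext; simpl; ring).
  eapply Rle_trans; [apply Cmod_triangle|]. rewrite Cmod_mult, Cmod_Ci, !Cmod_R. lra.
Qed.

(** The factor 2 is the price for estimating real and imaginary parts separately. *)
Lemma sphere_int_bound F M m : contF F -> contF M -> (forall z w, onS3 z w -> (Cmod (M z w) <= m)%R) ->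
  (Cmod (sphere_int (fmul F M)) <= 2 * (m * nu F))%R.
Proof.
  intros HF HM Hm. unfold nu. rewrite <- hopf_int_scal by now apply cont3_nu.
  assert (B : forall e a b, (Cmod (fmul F M (hz e a) (hw e b) * wt e)
      <= m * Cmod (F (hz e a) (hw e b) * wt e))%R).
  { intros e a b. unfold fmul. rewrite !Cmod_mult.
    pose proof (Hm _ _ (onS3_hopf e a b)).
    pose proof (Cmod_ge_0 (F (hz e a) (hw e b))). pose proof (Cmod_ge_0 (wt e)).
    assert (0 <= Cmod (F (hz e a) (hw e b)) * Cmod (wt e))%R by (apply Rmult_le_pos; auto).
    nra. }
  assert (CB : cont3 (fun e a b => m * Cmod (F (hz e a) (hw e b) * wt e))%R).
  { intros p. apply continuous_Rmult; [apply continuous_const|]. now apply cont3_nu. }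
  assert (CA : cont3C (fun e a b => fmul F M (hz e a) (hw e b) * wt e)).
  { apply cont3C_sphere; auto with sm. }
  apply Cmod_le_parts; apply hopf_int_abs_le; auto.
  - now apply cont3C_Re.
  - intros e a b. eapply Rle_trans; [apply re_le_Cmod|apply B].
  - now apply cont3C_Im.
  - intros e a b. eapply Rle_trans; [apply im_le_Cmod|apply B].
Qed.

(** * Integration by parts *)

Lemma is_dR_expi t : is_dR expi t (Ci * expi t).
Proof. split; simpl; auto_derive; auto; ring. Qed.

Lemma is_dR_hz_a e a : is_dR (fun a => hz e a) a (Ci * hz e a).
Proof.
  eapply is_dR_eq; [exact (is_dR_mult _ _ _ _ _ (is_dR_const (RtoC (cos e)) a) (is_dR_expi a))|].
  unfold hz. cbv beta; ring.
Qed.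
Lemma is_dR_hw_b e b : is_dR (fun b => hw e b) b (Ci * hw e b).
Proof.
  eapply is_dR_eq; [exact (is_dR_mult _ _ _ _ _ (is_dR_const (RtoC (sin e)) b) (is_dR_expi b))|].
  unfold hw. cbv beta; ring.
Qed.
Lemma is_dR_cos e : is_dR (fun e => RtoC (cos e)) e (- RtoC (sin e)).
Proof. rewrite <- RtoC_opp. apply is_dR_RtoC. auto_derive; auto; ring. Qed.
Lemma is_dR_sin e : is_dR (fun e => RtoC (sin e)) e (RtoC (cos e)).
Proof. apply is_dR_RtoC. auto_derive; auto; ring. Qed.
Lemma is_dR_hz_e e a : is_dR (fun e => hz e a) e (- RtoC (sin e) * expi a).
Proof.
  eapply is_dR_eq; [exact (is_dR_mult _ _ _ _ _ (is_dR_cos e) (is_dR_const (expi a) e))|]. cbv beta; ring.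
Qed.
Lemma is_dR_hw_e e b : is_dR (fun e => hw e b) e (RtoC (cos e) * expi b).
Proof.
  eapply is_dR_eq; [exact (is_dR_mult _ _ _ _ _ (is_dR_sin e) (is_dR_const (expi b) e))|]. cbv beta; ring.
Qed.

Lemma continuous_expi1 t : continuous expi t.
Proof. apply (continuous_expi (fun t => t)). apply continuous_id. Qed.

Lemma hopf_da F e a b : smooth F -> is_dR (fun a => F (hz e a) (hw e b)) a (Ta F (hz e a) (hw e b)).
Proof.
  intros HF. eapply is_dR_eq.
  - apply (smooth_chain F (fun a => hz e a) (fun _ => hw e b) (fun a => Ci * hz e a) (fun _ => 0)); auto.
    + intros t; apply is_dR_hz_a.
    + intros t; apply is_dR_const.
    + intros t. exact (continuous_Cmult _ _ t (continuous_const Ci t) (continuous_Cmult _ _ t (continuous_const (RtoC (cos e)) t) (continuous_expi1 t))).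
    + intros t; apply continuous_const.
  - cbv beta. unfold Ta. rewrite Cmult_conj. replace (Cconj Ci) with (- Ci) by (apply C_ext; simpl; ring).
    replace (Cconj 0) with (RtoC 0) by (apply C_ext; simpl; ring). ring.
Qed.

Lemma hopf_db F e a b : smooth F -> is_dR (fun b => F (hz e a) (hw e b)) b (Tb F (hz e a) (hw e b)).
Proof.
  intros HF. eapply is_dR_eq.
  - apply (smooth_chain F (fun _ => hz e a) (fun b => hw e b) (fun _ => 0) (fun b => Ci * hw e b)); auto.
    + intros t; apply is_dR_const.
    + intros t; apply is_dR_hw_b.
    + intros t; apply continuous_const.
    + intros t. exact (continuous_Cmult _ _ t (continuous_const Ci t) (continuous_Cmult _ _ t (continuous_const (RtoC (sin e)) t) (continuous_expi1 t))).
  - cbv beta. unfold Tb. rewrite Cmult_conj. replace (Cconj Ci) with (- Ci) by (apply C_ext; simpl; ring).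
    replace (Cconj 0) with (RtoC 0) by (apply C_ext; simpl; ring). ring.
Qed.

Definition De (F : fn) (e a b : R) : C :=
  dz F (hz e a) (hw e b) * (- RtoC (sin e) * expi a)
  + dzb F (hz e a) (hw e b) * (- RtoC (sin e) * Cconj (expi a))
  + dw F (hz e a) (hw e b) * (RtoC (cos e) * expi b)
  + dwb F (hz e a) (hw e b) * (RtoC (cos e) * Cconj (expi b)).

Lemma conj_RtoC r : Cconj (RtoC r) = RtoC r.
Proof. apply C_ext; simpl; ring. Qed.

Lemma hopf_de F e a b : smooth F -> is_dR (fun e => F (hz e a) (hw e b)) e (De F e a b).
Proof.
  intros HF. eapply is_dR_eq.
  - apply (smooth_chain F (fun e => hz e a) (fun e => hw e b) (fun e => - RtoC (sin e) * expi a)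
      (fun e => RtoC (cos e) * expi b)); auto.
    + intros t; apply is_dR_hz_e.
    + intros t; apply is_dR_hw_e.
    + intros t. apply continuous_Cmult; [|apply continuous_const].
      apply continuous_ext with (f := fun e => RtoC (- sin e)%R).
      { intros; apply RtoC_opp. }
      apply continuous_RtoC, continuous_Ropp, continuous_sin.
    + intros t. apply continuous_Cmult; [|apply continuous_const].
      apply continuous_RtoC, continuous_cos.
  - cbv beta. unfold De. rewrite !Cmult_conj, Copp_conj, !conj_RtoC. reflexivity.
Qed.

Lemma expi_2PI : expi (2 * PI) = expi 0.
Proof. unfold expi. now rewrite cos_2PI, sin_2PI, cos_0, sin_0. Qed.

Lemma sphere_int_Ta H : smooth H -> sphere_int (Ta H) = 0.
Proof.
  intros HH. apply hopf_intC_da with (fun e a b => H (hz e a) (hw e b) * wt e).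
  - intros e a b. eapply is_dR_eq;
      [exact (is_dR_mult _ _ _ _ _ (hopf_da H e a b HH) (is_dR_const (wt e) a))|]. cbv beta; ring.
  - apply cont3C_sphere; auto with sm.
  - apply cont3C_sphere. apply smooth_contF. apply der_smooth; auto with sm.
  - intros e b. unfold hz. now rewrite expi_2PI.
Qed.

Lemma sphere_int_Tb H : smooth H -> sphere_int (Tb H) = 0.
Proof.
  intros HH. apply hopf_intC_db with (fun e a b => H (hz e a) (hw e b) * wt e).
  - intros e a b. eapply is_dR_eq;
      [exact (is_dR_mult _ _ _ _ _ (hopf_db H e a b HH) (is_dR_const (wt e) b))|]. cbv beta; ring.
  - apply cont3C_sphere. apply smooth_contF. apply der_smooth; auto with sm.
  - intros e b. unfold hw. now rewrite expi_2PI.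
Qed.

Lemma sphere_int_T H : smooth H -> sphere_int (T H) = 0.
Proof.
  intros HH. rewrite T_comb. unfold comb.
  assert (S1 : smooth (Ta H)) by (apply der_smooth; auto with sm).
  assert (S2 : smooth (Tb H)) by (apply der_smooth; auto with sm).
  rewrite sphere_int_add, !sphere_int_scal, sphere_int_Ta, sphere_int_Tb by auto with sm. ring.
Qed.

Lemma expi_conj a : expi a * Cconj (expi a) = 1.
Proof. apply C_ext; simpl; pose proof (sin2_cos2 a); unfold Rsqr in *; nra. Qed.

(* In Hopf coordinates [sin e cos e * Z1 H] is the divergence of
   [E H / 2 * (- sin e cos e, - i sin^2 e, i cos^2 e)] with [E = exp (- i (a + b))]. *)
Lemma sphere_int_Z1 H : smooth H -> sphere_int (Z1 H) = 0.
Proof.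
  intros HH.
  set (E := fun a b : R => Cconj (expi a) * Cconj (expi b)).
  set (fe := fun e a b : R => (- / 2) * (RtoC (sin e) * RtoC (cos e)) * E a b * H (hz e a) (hw e b)).
  set (fe' := fun e a b : R => (- / 2) * E a b * ((RtoC (cos e) * RtoC (cos e) - RtoC (sin e) * RtoC (sin e)) * H (hz e a) (hw e b)
     + RtoC (sin e) * RtoC (cos e) * De H e a b)).
  set (fa := fun e a b : R => (- Ci / 2) * (RtoC (sin e) * RtoC (sin e)) * E a b * H (hz e a) (hw e b)).
  set (fa' := fun e a b : R => (- Ci / 2) * (RtoC (sin e) * RtoC (sin e)) * E a b * (- Ci * H (hz e a) (hw e b) + Ta H (hz e a) (hw e b))).
  set (fb := fun e a b : R => (Ci / 2) * (RtoC (cos e) * RtoC (cos e)) * E a b * H (hz e a) (hw e b)).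
  set (fb' := fun e a b : R => (Ci / 2) * (RtoC (cos e) * RtoC (cos e)) * E a b * (- Ci * H (hz e a) (hw e b) + Tb H (hz e a) (hw e b))).
  assert (Ec : forall t, is_dR (fun t => Cconj (expi t)) t (- Ci * Cconj (expi t))).
  { intros t. eapply is_dR_eq; [exact (is_dR_conj _ _ _ (is_dR_expi t))|]. apply C_ext; simpl; ring. }
  assert (Ea : forall a b, is_dR (fun a => E a b) a (- Ci * E a b)).
  { intros a b. eapply is_dR_eq; [exact (is_dR_mult _ _ _ _ _ (Ec a) (is_dR_const (Cconj (expi b)) a))|].
    unfold E. cbv beta; ring. }
  assert (Eb : forall a b, is_dR (fun b => E a b) b (- Ci * E a b)).
  { intros a b. eapply is_dR_eq; [exact (is_dR_mult _ _ _ _ _ (is_dR_const (Cconj (expi a)) b) (Ec b))|].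
    unfold E. cbv beta; ring. }
  assert (STa : contF (Ta H)) by (apply smooth_contF, der_smooth; auto with sm).
  assert (STb : contF (Tb H)) by (apply smooth_contF, der_smooth; auto with sm).
  assert (SH : contF H) by auto with sm.
  assert (S1 : contF (dz H)) by auto with sm. assert (S2 : contF (dzb H)) by auto with sm.
  assert (S3 : contF (dw H)) by auto with sm. assert (S4 : contF (dwb H)) by auto with sm.
  assert (Cfe : cont3C fe) by (unfold fe, E; cont3C_tac).
  assert (Cfe' : cont3C fe') by (unfold fe', E, De; cont3C_tac).
  assert (Cfa : cont3C fa) by (unfold fa, E; cont3C_tac).
  assert (Cfa' : cont3C fa') by (unfold fa', E; cont3C_tac).
  assert (Cfb' : cont3C fb') by (unfold fb', E; cont3C_tac).
  assert (Ie : hopf_intC fe' = 0).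
  { apply hopf_intC_de with fe; auto.
    - intros e a b.
      eapply is_dR_eq; [exact (is_dR_mult _ _ _ _ _ (is_dR_mult _ _ _ _ _ (is_dR_mult _ _ _ _ _
        (is_dR_const (- / 2) e) (is_dR_mult _ _ _ _ _ (is_dR_sin e) (is_dR_cos e))) (is_dR_const (E a b) e)) (hopf_de H e a b HH))|].
      unfold fe'. cbv beta; ring.
    - intros a b. unfold fe. rewrite sin_0. ring.
    - intros a b. unfold fe. rewrite cos_PI2. ring. }
  assert (Ia : hopf_intC fa' = 0).
  { apply hopf_intC_da with fa; auto.
    - intros e a b.
      eapply is_dR_eq; [exact (is_dR_mult _ _ _ _ _ (is_dR_mult _ _ _ _ _
        (is_dR_const ((- Ci / 2) * (RtoC (sin e) * RtoC (sin e))) a) (Ea a b)) (hopf_da H e a b HH))|].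
      unfold fa'. cbv beta; ring.
    - intros e b. unfold fa, E, hz. now rewrite expi_2PI. }
  assert (Ib : hopf_intC fb' = 0).
  { apply hopf_intC_db with fb; auto.
    - intros e a b.
      eapply is_dR_eq; [exact (is_dR_mult _ _ _ _ _ (is_dR_mult _ _ _ _ _
        (is_dR_const ((Ci / 2) * (RtoC (cos e) * RtoC (cos e))) b) (Eb a b)) (hopf_db H e a b HH))|].
      unfold fb'. cbv beta; ring.
    - intros e a. unfold fb, E, hw. now rewrite expi_2PI. }
  assert (K : sphere_int (Z1 H) = hopf_intC (fun e a b => fe' e a b + (fa' e a b + fb' e a b))).
  { apply hopf_intC_ext. intros e a b. unfold fe', fa', fb', Z1, wt, De, Ta, Tb, E, hz, hw.
    rewrite RtoC_mult, !Cmult_conj, !conj_RtoC.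
    fold (hz e a) (hw e b).
    generalize (dz H (hz e a) (hw e b)) (dzb H (hz e a) (hw e b))
      (dw H (hz e a) (hw e b)) (dwb H (hz e a) (hw e b)) (H (hz e a) (hw e b)).
    unfold hz, hw.
    pose proof (expi_conj a) as H1. pose proof (expi_conj b) as H2.
    assert (H3 : Ci * Ci = - (1)) by (apply C_ext; simpl; ring).
    revert H1 H2. generalize (expi a) (Cconj (expi a)) (expi b) (Cconj (expi b)) (RtoC (sin e)) (RtoC (cos e)).
    intros x x' y y' s c H1 H2 d1 d2 d3 d4 h.
    unfold Cdiv.
    (* The products [x * x'], [y * y'] and [Ci * Ci] are kept together, so that
       $e^{ia}\overline{e^{ia}}=1$, $e^{ib}\overline{e^{ib}}=1$ and $i^2=-1$ can be substituted
       before [field] compares the two sides. *)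
    transitivity (
      (- / 2) * (x' * y') * ((c * c - s * s) * h) + - / 2 * s * c * (- s * (x * x') * y' * d1
        - s * x' * x' * y' * d2 + c * (y * y') * x' * d3 + c * x' * y' * y' * d4)
      + (- (Ci * Ci) * / 2 * (s * s) * (- (x' * y') * h + c * (x * x') * y' * d1 - c * x' * x' * y' * d2)
      + ((Ci * Ci) * / 2) * (c * c) * (- x' * y' * h + (s * (y * y') * x' * d3) - (s * x' * y' * y' * d4))));
      [rewrite H1, H2, H3; field|ring]. }
  rewrite K, hopf_intC_plus, hopf_intC_plus, Ie, Ia, Ib; auto.
  - ring.
  - now apply cont3C_plus.
Qed.

(** * Polynomials separate continuous functions on the sphere *)

Inductive poly : fn -> Prop :=
| poly_cst c : poly (fcst c)
| poly_z : poly fz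
| poly_zb : poly fzb
| poly_w : poly fw
| poly_wb : poly fwb
| poly_add F G : poly F -> poly G -> poly (fadd F G)
| poly_mul F G : poly F -> poly G -> poly (fmul F G).

Lemma smooth_poly P : poly P -> smooth P.
Proof. induction 1; auto with sm. Qed.

Fixpoint fpow (P : fn) (n : nat) : fn :=
  match n with O => fcst 1 | S k => fmul P (fpow P k) end.

Lemma poly_pow P n : poly P -> poly (fpow P n).
Proof. intros H; induction n; simpl; constructor; auto. Qed.

Lemma RInt_pos (f : R -> R) a b t0 : (forall t, continuous f t) ->
  (forall t, (a < t < b)%R -> (0 <= f t)%R) -> (a < t0 < b)%R -> (0 < f t0)%R -> (0 < RInt f a b)%R.
Proof.
  intros Hc Hp Ht H0.
  assert (L : locally (f t0) (fun v => (0 < v)%R)).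
  { exists (mkposreal _ H0). intros v Hv.
    change (Rabs (v - f t0) < f t0)%R in Hv. apply Rabs_lt_between in Hv. lra. }
  destruct (Hc t0 _ L) as [d Hd].
  set (k := (Rmin d (Rmin (t0 - a) (b - t0)) / 2)%R).
  assert (Hk : (0 < k /\ k < d /\ k < t0 - a /\ k < b - t0)%R).
  { pose proof (cond_pos d). unfold k.
    pose proof (Rmin_l d (Rmin (t0 - a) (b - t0))). pose proof (Rmin_r d (Rmin (t0 - a) (b - t0))).
    pose proof (Rmin_l (t0 - a) (b - t0)). pose proof (Rmin_r (t0 - a) (b - t0)).
    assert (0 < Rmin d (Rmin (t0 - a) (b - t0)))%R by (apply Rmin_pos; [lra|apply Rmin_pos; lra]).
    lra. }
  assert (E : forall x y, ex_RInt f x y) by (intros; now apply continuous_ex_RInt).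
  rewrite <- (RInt_Chasles f a (t0 - k) b), <- (RInt_Chasles f (t0 - k) (t0 + k) b) by apply E.
  unfold plus; simpl.
  assert (0 <= RInt f a (t0 - k))%R by (apply RInt_ge_0; [lra|apply E|intros; apply Hp; lra]).
  assert (0 <= RInt f (t0 + k) b)%R by (apply RInt_ge_0; [lra|apply E|intros; apply Hp; lra]).
  assert (0 < RInt f (t0 - k) (t0 + k))%R; [|lra].
  apply RInt_gt_0; [lra| |auto]. intros x Hx. apply Hd.
  change (Rabs (x - t0) < d)%R. apply Rabs_lt_between. lra.
Qed.

(** The sign is assumed only for $0<e<\pi/2$, because the weight $\sin e\cos e$ does not keep its
    sign outside this interval; the same restriction appears in [hopf_int_le_box]. *)
Lemma hopf_int_pos (f : R -> R -> R -> R) e0 a0 b0 : cont3 f ->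
  (forall e a b, (0 < e < PI / 2)%R -> (0 <= f e a b)%R) ->
  (0 < e0 < PI / 2)%R -> (0 < a0 < 2 * PI)%R -> (0 < b0 < 2 * PI)%R ->
  (0 < f e0 a0 b0)%R -> (0 < hopf_int f)%R.
Proof.
  intros Hf Hp He Ha Hb H0.
  assert (N3 : forall e a, (0 < e < PI / 2)%R -> (0 <= RInt (f e a) 0 (2 * PI))%R).
  { intros e a Hi. apply RInt_ge_0; [apply PI2_nonneg|now apply hopf_int_ex3|]. auto. }
  assert (N2 : forall e, (0 < e < PI / 2)%R -> (0 <= RInt (fun a => RInt (f e a) 0 (2 * PI)) 0 (2 * PI))%R).
  { intros e Hi. apply RInt_ge_0; [apply PI2_nonneg|now apply hopf_int_ex2|]. auto. }
  apply RInt_pos with e0; auto.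
  - apply (cont2_RInt (fun e a => RInt (f e a) 0 (2 * PI))); [apply PI2_nonneg|].
    apply cont3_RInt; [apply PI2_nonneg|exact Hf].
  - apply RInt_pos with a0; auto.
    + apply cont2_RInt; [apply PI2_nonneg|now apply cont3_at].
    + apply RInt_pos with b0; auto. intros t. apply cont2_at. now apply cont3_at.
Qed.

Lemma hopf_int_le_box f g : cont3 f -> cont3 g ->
  (forall e a b, (0 < e < PI / 2)%R -> (f e a b <= g e a b)%R) -> (hopf_int f <= hopf_int g)%R.
Proof.
  intros Hf Hg H. unfold hopf_int.
  apply RInt_le; [apply PIhalf_nonneg|now apply hopf_int_ex1|now apply hopf_int_ex1|intros e He].
  apply RInt_le; [apply PI2_nonneg|now apply hopf_int_ex2|now apply hopf_int_ex2|intros a _].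
  apply RInt_le; [apply PI2_nonneg|now apply hopf_int_ex3|now apply hopf_int_ex3|intros b _]. auto.
Qed.

Lemma pow_ratio_contra (q r a b : R) : (0 < q)%R -> (q < r)%R -> (0 < a)%R ->
  (forall n, (r ^ n * a <= q ^ n * b)%R) -> False.
Proof.
  intros Hq Hr Ha H.
  assert (Hx : (Rabs (q / r) < 1)%R).
  { rewrite Rabs_pos_eq.
    - apply Rmult_lt_reg_r with r; [lra|]. field_simplify; lra.
    - apply Rlt_le, Rdiv_lt_0_compat; lra. }
  destruct (pow_lt_1_zero (q / r) Hx (a / (Rabs b + 1))) as [N HN].
  { apply Rdiv_lt_0_compat; [lra|]. pose proof (Rabs_pos b). lra. }
  specialize (HN N (le_n N)). specialize (H N).
  assert (E : (q ^ N = (q / r) ^ N * r ^ N)%R).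
  { rewrite <- Rpow_mult_distr. f_equal. field. lra. }
  rewrite E in H. pose proof (pow_lt r N ltac:(lra)) as Hp.
  assert (H' : (a <= (q / r) ^ N * b)%R).
  { apply Rmult_le_reg_l with (r ^ N)%R; [exact Hp|]. lra. }
  pose proof (Rabs_pos b).
  assert ((q / r) ^ N * b <= Rabs ((q / r) ^ N) * Rabs b)%R by (rewrite <- Rabs_mult; apply Rle_abs).
  assert (Rabs ((q / r) ^ N) * (Rabs b + 1) < a)%R.
  { apply Rmult_lt_compat_r with (r := (Rabs b + 1)%R) in HN; [|lra].
    replace (a / (Rabs b + 1) * (Rabs b + 1))%R with a in HN by (field; lra). exact HN. }
  pose proof (Rabs_pos ((q / r) ^ N)). nra.
Qed.

(** The real Euclidean inner product of two unit vectors, rescaled from $[-1,1]$ to $[0,1]$; on the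
    sphere it equals 1 only at the base point, by [peak_dist]. *)
Definition peak (z0 w0 z w : C) : R := ((1 + Re (z * Cconj z0 + w * Cconj w0)) / 2)%R.

Definition peak_poly (z0 w0 : C) : fn :=
  fmul (fcst (/ 2)) (fadd (fcst 1) (fmul (fcst (/ 2))
    (fadd (fadd (fmul fz (fcst (Cconj z0))) (fmul fzb (fcst z0)))
          (fadd (fmul fw (fcst (Cconj w0))) (fmul fwb (fcst w0)))))).

Lemma peak_poly_val z0 w0 z w : peak_poly z0 w0 z w = RtoC (peak z0 w0 z w).
Proof.
  unfold peak_poly, peak, fmul, fadd, fcst, fz, fw, fzb, fwb, conjf. destruct z0, w0, z, w.
  apply C_ext; simpl; field.
Qed.

Lemma fpow_peak_poly_val z0 w0 n z w : fpow (peak_poly z0 w0) n z w = RtoC (peak z0 w0 z w ^ n)%R.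
Proof.
  induction n; simpl; [reflexivity|]. unfold fmul. rewrite peak_poly_val, IHn, <- RtoC_mult. reflexivity.
Qed.

Lemma onS3_coord z w : onS3 z w -> (Re z ^ 2 + Im z ^ 2 + Re w ^ 2 + Im w ^ 2 = 1)%R.
Proof. unfold onS3. rewrite !Cmod2_alt. intros H. lra. Qed.

Lemma peak_dist z0 w0 z w : onS3 z0 w0 -> onS3 z w ->
  (4 * (1 - peak z0 w0 z w) = (Re z - Re z0) ^ 2 + (Im z - Im z0) ^ 2
     + (Re w - Re w0) ^ 2 + (Im w - Im w0) ^ 2)%R.
Proof.
  intros H0 H. apply onS3_coord in H0. apply onS3_coord in H. unfold peak.
  destruct z0, w0, z, w. simpl in *. nra.
Qed.

Lemma peak_nonneg z0 w0 z w : onS3 z0 w0 -> onS3 z w -> (0 <= peak z0 w0 z w)%R.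
Proof.
  intros H0 H. apply onS3_coord in H0. apply onS3_coord in H. unfold peak.
  destruct z0 as [a b], w0 as [c d], z as [x y], w as [u v]. simpl in *.
  pose proof (pow2_ge_0 (x + a)). pose proof (pow2_ge_0 (y + b)).
  pose proof (pow2_ge_0 (u + c)). pose proof (pow2_ge_0 (v + d)). nra.
Qed.

Lemma poly_peak_poly z0 w0 : poly (peak_poly z0 w0).
Proof. unfold peak_poly. repeat constructor. Qed.

(** Testing against the $n$-th power of [peak_poly] gives 0, yet a nonzero value of $F$ would make
    the part near the point of order at least $r^n$ and the rest at most of order $q^n$ with $q<r$.
    Inside the open coordinate box the weight is positive, so the part near the point does count. *)
Lemma poly_dense_interior F : contF F -> (forall P, poly P -> sphere_int (fmul F P) = 0) ->
  forall e a b, (0 < e < PI / 2)%R -> (0 < a < 2 * PI)%R -> (0 < b < 2 * PI)%R ->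
  F (hz e a) (hw e b) = 0.
Proof.
  intros HF0 HA0 e0 a0 b0 He Ha Hb. apply NNPP. intros Hne.
  set (z0 := hz e0 a0) in *. set (w0 := hw e0 b0) in *.
  (* Multiplication by the conjugate value makes $G(z_0,w_0)=|F(z_0,w_0)|^2$ positive, so only the
     real part of $G$ has to be watched. *)
  set (k := Cconj (F z0 w0)).
  set (G := fmul (fcst k) F).
  assert (HG : contF G) by (apply contF_mul; auto with sm).
  assert (HA : forall P, poly P -> sphere_int (fmul G P) = 0).
  { intros P HP. unfold G.
    replace (fmul (fmul (fcst k) F) P) with (fmul (fcst k) (fmul F P)) by fcrush.
    rewrite sphere_int_scal, HA0; auto; [ring|]. apply contF_mul; auto. apply smooth_contF, smooth_poly, HP. }
  set (h := Re (G z0 w0)).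
  assert (Hh : (0 < h)%R).
  { unfold h, G, fmul, fcst, k. rewrite Cmult_comm, <- Cmod2_conj.
    rewrite re_RtoC. apply pow_lt. now apply Cmod_gt_0. }
  assert (S0 : onS3 z0 w0) by apply onS3_hopf.
  assert (L : locally (Re (G z0 w0)) (fun v => (h / 2 < v)%R)).
  { exists (mkposreal (h / 2) ltac:(lra)). intros v Hv.
    change (Rabs (v - h) < h / 2)%R in Hv. apply Rabs_lt_between in Hv. lra. }
  destruct (continuous_Re _ _ (HG z0 w0) _ L) as [d' Hd'].
  set (d := Rmin d' 1).
  assert (Hd : (0 < d <= 1)%R).
  { unfold d. split; [apply Rmin_pos; [apply d'|lra]|apply Rmin_r]. }
  (* By [peak_dist], a value of [ph] above $q$ means distance less than $d$ from the base point. The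
     number $r$ lies strictly between $q$ and $1$, and $d\le1$ keeps $q$ positive. *)
  set (q := (1 - d ^ 2 / 4)%R). set (r := (1 - d ^ 2 / 8)%R).
  assert (Hq : (0 < q /\ q < r /\ r < 1)%R).
  { assert (0 < d ^ 2 <= 1)%R by nra. unfold q, r. lra. }
  set (ph := peak z0 w0).
  assert (Near : forall z w, onS3 z w -> (q < ph z w)%R -> (h / 2 < Re (G z w))%R).
  { intros z w Hs Hp. pose proof (peak_dist _ _ _ _ S0 Hs) as D.
    apply (Hd' (z, w)).
    assert (B : forall x y, ((x - y) ^ 2 < d ^ 2)%R -> ball y d' x).
    { intros x y Hxy. change (Rabs (x - y) < d')%R.
      apply Rlt_le_trans with d; [|apply Rmin_l].
      apply Rabs_lt_between. split; nra. }
    assert (D' : (4 * (1 - ph z w) < d ^ 2)%R) by (unfold q in Hp; lra).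
    unfold ph in D'. rewrite D in D'.
    pose proof (pow2_ge_0 (Re z - Re z0)). pose proof (pow2_ge_0 (Im z - Im z0)).
    pose proof (pow2_ge_0 (Re w - Re w0)). pose proof (pow2_ge_0 (Im w - Im w0)).
    repeat split; apply B; unfold Re, Im in *; simpl in *; lra. }
  (* A continuous bump that vanishes where [ph] is at most $r$. Up to the error $q^n|G|$, the
     function $r^ng$ bounds the integrand from below, and the integral of $g$ is positive. *)
  set (g := fun e a b => (h / 2 * Rmax 0 (ph (hz e a) (hw e b) - r) * (sin e * cos e))%R).
  assert (Cph : cont3 (fun e a b => ph (hz e a) (hw e b))).
  { intros p. apply continuous_ext with (f := fun p => Re (peak_poly z0 w0 (hz (p1 p) (p2 p)) (hw (p1 p) (p3 p)))).
    - intros p'. rewrite peak_poly_val. reflexivity.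
    - apply (cont3C_Re (fun e a b => peak_poly z0 w0 (hz e a) (hw e b))). apply cont3C_hopf.
      apply smooth_contF, smooth_poly, poly_peak_poly. }
  assert (Cw : cont3 (fun e a b => (sin e * cos e)%R)) by exact (cont3C_Re _ cont3C_wt).
  assert (Cg : cont3 g).
  { intros p. apply continuous_Rmult; [apply continuous_Rmult; [apply continuous_const|]|exact (Cw p)].
    apply continuous_ext with (f := fun p => (((ph (hz (p1 p) (p2 p)) (hw (p1 p) (p3 p)) - r)
       + Rabs (ph (hz (p1 p) (p2 p)) (hw (p1 p) (p3 p)) - r)) / 2)%R).
    { intros p'. unfold p1, p2, p3. apply Rmax_case_strong; intros Hm.
      - rewrite Rabs_left1 by lra. lra.
      - rewrite Rabs_pos_eq by lra. lra. }
    assert (Cd : continuous (fun p => (ph (hz (p1 p) (p2 p)) (hw (p1 p) (p3 p)) - r)%R) p).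
    { apply continuous_Rplus; [exact (Cph p)|apply continuous_const]. }
    apply continuous_Rmult; [|apply continuous_const].
    apply continuous_Rplus; [exact Cd|].
    apply (continuous_comp _ Rabs); [exact Cd|]. apply continuous_Rabs. }
  assert (W : forall e, (0 < e < PI / 2)%R -> (0 < sin e * cos e)%R).
  { intros e Hi. apply Rmult_lt_0_compat; [apply sin_gt_0|apply cos_gt_0]; lra. }
  assert (ph0 : ph z0 w0 = 1%R).
  { pose proof (peak_dist _ _ _ _ S0 S0) as D. unfold ph. nra. }
  assert (Jg : (0 < hopf_int g)%R).
  { apply hopf_int_pos with e0 a0 b0; auto.
    - intros e a b Hi. unfold g. pose proof (W e Hi). pose proof (Rmax_l 0 (ph (hz e a) (hw e b) - r)).
      apply Rmult_le_pos; [|lra]. apply Rmult_le_pos; lra.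
    - unfold g. fold z0 w0. rewrite ph0, Rmax_right by lra. pose proof (W e0 He).
      apply Rmult_lt_0_compat; [|lra]. apply Rmult_lt_0_compat; lra. }
  apply (pow_ratio_contra q r (hopf_int g) (nu G)); try tauto.
  intros n.
  pose proof (HA _ (poly_pow _ n (poly_peak_poly z0 w0))) as HAn.
  apply (f_equal Re) in HAn. unfold sphere_int in HAn. simpl Re in HAn.
  assert (CG : contF (fmul G (fpow (peak_poly z0 w0) n))).
  { apply contF_mul; auto. apply smooth_contF, smooth_poly, poly_pow, poly_peak_poly. }
  assert (X : (r ^ n * hopf_int g <= hopf_int (fun e a b => Re (fmul G (fpow (peak_poly z0 w0) n) (hz e a) (hw e b) * wt e)) + q ^ n * nu G)%R).
  { unfold nu. rewrite <- !hopf_int_scal, <- hopf_int_plus; auto.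
    2: exact (cont3C_Re _ (cont3C_sphere _ CG)).
    2: { intros p. apply continuous_Rmult; [apply continuous_const|now apply cont3_nu]. }
    2: now apply cont3_nu.
    apply hopf_int_le_box.
    - intros p. apply continuous_Rmult; [apply continuous_const|apply Cg].
    - intros p. apply continuous_Rplus; [apply (cont3C_Re _ (cont3C_sphere _ CG))|].
      apply continuous_Rmult; [apply continuous_const|now apply cont3_nu].
    - intros e a b Hi. unfold fmul. rewrite fpow_peak_poly_val. unfold g.
      pose proof (onS3_hopf e a b) as Hs. set (z := hz e a) in *. set (w := hw e b) in *.
      fold ph. pose proof (W e Hi) as HW. unfold wt. set (V := (sin e * cos e)%R) in *.
      rewrite Cmod_mult, Cmod_R, (Rabs_pos_eq V) by lra.
      pose proof (re_le_Cmod (G z w)) as HR. apply Rabs_le_between in HR.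
      replace (Re (G z w * RtoC (ph z w ^ n) * RtoC V)) with (Re (G z w) * ph z w ^ n * V)%R
        by (unfold Re; destruct (G z w); simpl; ring).
      pose proof (peak_nonneg _ _ _ _ S0 Hs) as P0. fold ph in P0.
      assert (P1 : (ph z w <= 1)%R).
      { pose proof (peak_dist _ _ _ _ S0 Hs) as D. fold ph in D.
        pose proof (pow2_ge_0 (Re z - Re z0)). pose proof (pow2_ge_0 (Im z - Im z0)).
        pose proof (pow2_ge_0 (Re w - Re w0)). pose proof (pow2_ge_0 (Im w - Im w0)). lra. }
      pose proof (pow_le (ph z w) n P0) as Pn. pose proof (pow_le q n ltac:(lra)) as Qn.
      pose proof (pow_le r n ltac:(lra)) as Rn. pose proof (Cmod_ge_0 (G z w)) as HC.
      assert (QC : (0 <= q ^ n * Cmod (G z w))%R) by (apply Rmult_le_pos; auto).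
      assert (Y : (r ^ n * (h / 2 * Rmax 0 (ph z w - r)) <= Re (G z w) * ph z w ^ n + q ^ n * Cmod (G z w))%R).
      { destruct (Rlt_le_dec q (ph z w)) as [Hn|Hn].
        - pose proof (Near z w Hs Hn) as HN.
          assert (HL : (h / 2 * ph z w ^ n <= Re (G z w) * ph z w ^ n)%R) by (apply Rmult_le_compat_r; lra).
          destruct (Rle_lt_dec r (ph z w)) as [Hr|Hr].
          + rewrite Rmax_right by lra.
            pose proof (pow_incr r (ph z w) n ltac:(lra)) as Hi'.
            assert (r ^ n * (h / 2 * (ph z w - r)) <= r ^ n * (h / 2 * 1))%R.
            { apply Rmult_le_compat_l; auto. apply Rmult_le_compat_l; lra. }
            nra.
          + rewrite Rmax_left by lra. assert (0 <= h / 2 * ph z w ^ n)%R by (apply Rmult_le_pos; lra). lra.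
        - rewrite Rmax_left by lra. pose proof (pow_incr (ph z w) q n ltac:(lra)) as Hi'.
          assert (- (Cmod (G z w)) * ph z w ^ n <= Re (G z w) * ph z w ^ n)%R by (apply Rmult_le_compat_r; lra).
          assert (Cmod (G z w) * ph z w ^ n <= Cmod (G z w) * q ^ n)%R by (apply Rmult_le_compat_l; lra).
          lra. }
      apply Rmult_le_compat_r with (r := V) in Y; lra. }
  change (hopf_int (fun e a b => Re (fmul G (fpow (peak_poly z0 w0) n) (hz e a) (hw e b) * wt e)) = 0%R) in HAn.
  rewrite HAn in X. lra.
Qed.

Lemma continuous_zero_closure (f : R -> R) a b : (a < b)%R -> (forall t, continuous f t) ->
  (forall t, (a < t < b)%R -> f t = 0%R) -> forall t, (a <= t <= b)%R -> f t = 0%R.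
Proof.
  intros Hab Hc Hz t Ht. apply NNPP. intros Hn.
  assert (L : locally (f t) (fun v => v <> 0%R)).
  { exists (mkposreal (Rabs (f t)) (Rabs_pos_lt _ Hn)). intros v Hv E.
    change (Rabs (v - f t) < Rabs (f t))%R in Hv. unfold Rminus in Hv. rewrite E, Rplus_0_l, Rabs_Ropp in Hv. lra. }
  destruct (Hc t _ L) as [d Hd]. pose proof (cond_pos d) as Hp.
  set (k := Rmin (d / 2) ((b - a) / 4)).
  assert (K : (0 < k /\ k <= d / 2 /\ k <= (b - a) / 4)%R).
  { unfold k. split; [apply Rmin_pos; lra|split; [apply Rmin_l|apply Rmin_r]]. }
  assert (B : forall s, (Rabs (s - t) < d)%R -> f s <> 0%R).
  { intros s Hs. apply Hd. exact Hs. }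
  destruct (Rle_lt_dec t ((a + b) / 2)).
  - apply (B (t + k)%R); [apply Rabs_lt_between; lra|]. apply Hz. lra.
  - apply (B (t - k)%R); [apply Rabs_lt_between; lra|]. apply Hz. lra.
Qed.

Lemma circle_param x y : (x ^ 2 + y ^ 2 = 1)%R ->
  exists a, (0 <= a <= 2 * PI)%R /\ cos a = x /\ sin a = y.
Proof.
  intros H. pose proof PI_RGT_0 as Hpi.
  assert (Hx : (-1 <= x <= 1)%R) by nra.
  pose proof (acos_bound x) as Hb. pose proof (cos_acos x Hx) as Hc. pose proof (sin_acos x Hx) as Hs.
  assert (E : sqrt (1 - x²) = Rabs y).
  { rewrite <- sqrt_Rsqr_abs. f_equal. unfold Rsqr. nra. }
  rewrite E in Hs. destruct (Rle_lt_dec 0 y).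
  - exists (acos x). rewrite Rabs_pos_eq in Hs by assumption. repeat split; auto; lra.
  - exists (2 * PI - acos x)%R. rewrite Rabs_left in Hs by assumption. repeat split; try lra.
    + rewrite cos_minus, cos_2PI, sin_2PI. lra.
    + rewrite sin_minus, cos_2PI, sin_2PI. lra.
Qed.

Lemma C_polar z : exists a, (0 <= a <= 2 * PI)%R /\ z = RtoC (Cmod z) * expi a.
Proof.
  destruct (Req_dec (Cmod z) 0) as [E|E].
  - exists 0%R. pose proof PI_RGT_0. split; [lra|]. rewrite E. rewrite (Cmod_eq_0 z E). ring.
  - destruct (circle_param (Re z / Cmod z) (Im z / Cmod z)) as (a & Ha & H1 & H2).
    + pose proof (Cmod2_alt z) as M. apply Rmult_eq_reg_r with (Cmod z ^ 2)%R.
      * field_simplify; [|exact E]. rewrite M. ring.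
      * now apply pow_nonzero.
    + exists a. split; [exact Ha|]. unfold expi. rewrite H1, H2. apply C_ext; simpl; field; exact E.
Qed.

Lemma hopf_surj z w : onS3 z w -> exists e a b, (0 <= e <= PI / 2)%R /\ (0 <= a <= 2 * PI)%R /\
  (0 <= b <= 2 * PI)%R /\ z = hz e a /\ w = hw e b.
Proof.
  intros H. destruct (C_polar z) as (a & Ha & Ez). destruct (C_polar w) as (b & Hb & Ew).
  pose proof (Cmod_ge_0 z). pose proof (Cmod_ge_0 w). unfold onS3 in H.
  assert (Hz : (-1 <= Cmod z <= 1)%R) by nra.
  exists (acos (Cmod z)), a, b. pose proof (acos_bound (Cmod z)) as B.
  assert (Hc : cos (acos (Cmod z)) = Cmod z) by now apply cos_acos.
  assert (Hs : sin (acos (Cmod z)) = Cmod w).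
  { rewrite sin_acos by assumption. rewrite <- (sqrt_Rsqr (Cmod w)) by assumption.
    f_equal. unfold Rsqr. nra. }
  repeat split; try lra.
  - destruct (Rle_lt_dec (acos (Cmod z)) (PI / 2)); [assumption|].
    assert (cos (acos (Cmod z)) < 0)%R by (apply cos_lt_0; lra). lra.
  - unfold hz. rewrite Hc. exact Ez.
  - unfold hw. rewrite Hs. exact Ew.
Qed.

Lemma poly_dense F : contF F -> (forall P, poly P -> sphere_int (fmul F P) = 0) ->
  forall z w, onS3 z w -> F z w = 0.
Proof.
  intros HF HA z w Hs. destruct (hopf_surj z w Hs) as (e & a & b & He & Ha & Hb & -> & ->).
  pose proof (cont3C_hopf F HF) as HC. pose proof PI_RGT_0 as Hpi.
  (* The vanishing is extended from the open box to the closed one in one coordinate after another,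
     each time by continuity in that coordinate alone. *)
  assert (K : forall pr : C -> R, pr 0 = 0%R ->
    cont3 (fun e a b => pr (F (hz e a) (hw e b))) -> pr (F (hz e a) (hw e b)) = 0%R).
  { intros pr P0 CP.
    apply (continuous_zero_closure (fun e => pr (F (hz e a) (hw e b))) 0 (PI / 2)); [lra| | |exact He].
    { intros t. apply (cont2_at (fun b e => pr (F (hz e a) (hw e b)))). apply cont2_swap.
      now apply (cont3_fix1 (fun e a b => pr (F (hz e a) (hw e b)))). }
    clear e He Hs. intros e He.
    apply (continuous_zero_closure (fun a => pr (F (hz e a) (hw e b))) 0 (2 * PI)); [lra| | |exact Ha].
    { intros t. apply (cont2_at (fun b a => pr (F (hz e a) (hw e b)))). apply cont2_swap.
      now apply (cont3_at (fun e a b => pr (F (hz e a) (hw e b)))). }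
    clear a Ha. intros a Ha.
    apply (continuous_zero_closure (fun b => pr (F (hz e a) (hw e b))) 0 (2 * PI)); [lra| | |exact Hb].
    { intros t. apply (cont2_at (fun a b => pr (F (hz e a) (hw e b)))).
      now apply (cont3_at (fun e a b => pr (F (hz e a) (hw e b)))). }
    clear b Hb. intros b Hb.
    now rewrite poly_dense_interior. }
  apply C_ext; apply K; try reflexivity; [apply (cont3C_Re _ HC)|apply (cont3C_Im _ HC)].
Qed.

(** * Bihomogeneous and harmonic polynomials *)

(** The same spaces as those given by [hpoly], but built by one coordinate factor at a time so that
    derivatives and Euler identities follow by induction; [hom_hpoly] and [hpoly_hom] translate.
    Zero is put into every bidegree since a derivative may vanish. *)
Inductive hom : nat -> nat -> fn -> Prop :=
| hom_cst c : hom 0 0 (fcst c)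
| hom_0 p q : hom p q (fcst 0)
| hom_z p q P : hom p q P -> hom (S p) q (fmul fz P)
| hom_w p q P : hom p q P -> hom (S p) q (fmul fw P)
| hom_zb p q P : hom p q P -> hom p (S q) (fmul fzb P)
| hom_wb p q P : hom p q P -> hom p (S q) (fmul fwb P)
| hom_add p q P Q : hom p q P -> hom p q Q -> hom p q (fadd P Q).

Lemma smooth_hom p q P : hom p q P -> smooth P.
Proof. induction 1; auto with sm. Qed.

Lemma hom_scal c p q P : hom p q P -> hom p q (fmul (fcst c) P).
Proof.
  induction 1 as [a|p q|p q P H IH|p q P H IH|p q P H IH|p q P H IH|p q P Q H1 IH1 H2 IH2].
  - replace (fmul (fcst c) (fcst a)) with (fcst (c * a)) by fcrush. constructor.
  - replace (fmul (fcst c) (fcst 0)) with (fcst 0) by fcrush. constructor.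
  - replace (fmul (fcst c) (fmul fz P)) with (fmul fz (fmul (fcst c) P)) by fcrush. now constructor.
  - replace (fmul (fcst c) (fmul fw P)) with (fmul fw (fmul (fcst c) P)) by fcrush. now constructor.
  - replace (fmul (fcst c) (fmul fzb P)) with (fmul fzb (fmul (fcst c) P)) by fcrush. now constructor.
  - replace (fmul (fcst c) (fmul fwb P)) with (fmul fwb (fmul (fcst c) P)) by fcrush. now constructor.
  - replace (fmul (fcst c) (fadd P Q)) with (fadd (fmul (fcst c) P) (fmul (fcst c) Q)) by fcrush.
    now constructor.
Qed.

Lemma hom_conj p q P : hom p q P -> hom q p (conjf P).
Proof.
  induction 1; rewrite ?conj_add, ?conj_mul, ?conj_cst.
  - constructor.
  - replace (Cconj 0) with (RtoC 0) by (apply C_ext; simpl; ring). constructor.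
  - now apply hom_zb.
  - now apply hom_wb.
  - unfold fzb. rewrite conj_conj. now apply hom_z.
  - unfold fwb. rewrite conj_conj. now apply hom_w.
  - now apply hom_add.
Qed.

Lemma Csum_ext l f g : (forall a, In a l -> f a = g a) -> Csum l f = Csum l g.
Proof.
  induction l as [|x l IH]; intros H; simpl; [reflexivity|].
  rewrite H by now left. rewrite IH; [reflexivity|]. intros; apply H; now right.
Qed.

Lemma Csum_app l m f : Csum (l ++ m) f = Csum l f + Csum m f.
Proof. induction l as [|x l IH]; simpl; [ring|]. rewrite IH. ring. Qed.

Lemma Csum_plus l f g : Csum l (fun a => f a + g a) = Csum l f + Csum l g.
Proof. induction l as [|x l IH]; simpl; [ring|]. rewrite IH. ring. Qed.

Lemma Csum_scal l c f : Csum l (fun a => c * f a) = c * Csum l f.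
Proof. induction l as [|x l IH]; simpl; [ring|]. rewrite IH. ring. Qed.

Lemma Csum_zero l (f : nat -> C) : (forall a, In a l -> f a = 0) -> Csum l f = 0.
Proof.
  induction l as [|x l IH]; intros H; simpl; [reflexivity|].
  rewrite H by now left. rewrite IH; [ring|]. intros; apply H; now right.
Qed.

Lemma Csum_single n i (f : nat -> C) : (i < n)%nat -> (forall k, k <> i -> f k = 0) ->
  Csum (seq 0 n) f = f i.
Proof.
  intros Hi H. replace n with (i + S (n - S i))%nat by lia. rewrite seq_app, Csum_app.
  rewrite (Csum_zero (seq 0 i)) by (intros k Hk; apply in_seq in Hk; apply H; lia).
  change (0 + (f i + Csum (seq (S (0 + i)) (n - S i)) f) = f i).
  rewrite Csum_zero by (intros k Hk; apply in_seq in Hk; apply H; lia). ring.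
Qed.

Lemma Csum_map l (g : nat -> nat) f : Csum (map g l) f = Csum l (fun a => f (g a)).
Proof. induction l as [|x l IH]; simpl; [reflexivity|]. now rewrite IH. Qed.

(** An [hpoly] is two nested such sums, one in $(z,w)$ and one in the conjugates, so the effect of a
    coordinate factor on coefficients is computed for a single pair of variables. *)
Definition hom_sum (n : nat) (c : nat -> C) (X Y : C) : C :=
  Csum (seq 0 (S n)) (fun a => c a * Cpow X a * Cpow Y (n - a)).

Lemma hom_sum_ext n c d X Y : (forall a, (a <= n)%nat -> c a = d a) -> hom_sum n c X Y = hom_sum n d X Y.
Proof.
  intros H. apply Csum_ext. intros a Ha. apply in_seq in Ha. rewrite H by lia. reflexivity.
Qed.

Lemma hom_sum_X n c X Y : X * hom_sum n c X Y = hom_sum (S n) (fun a => match a with O => RtoC 0 | S b => c b end) X Y.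
Proof.
  unfold hom_sum. change (seq 0 (S (S n))) with (0%nat :: seq 1 (S n)).
  rewrite <- seq_shift. change (Csum (0%nat :: ?l) ?f) with (f 0%nat + Csum l f).
  rewrite Csum_map, <- Csum_scal.
  match goal with |- _ = ?x + ?y => replace x with (RtoC 0) by (simpl; ring) end.
  rewrite Cplus_0_l. apply Csum_ext. intros a _.
  simpl. ring.
Qed.

Lemma hom_sum_Y n c X Y : Y * hom_sum n c X Y = hom_sum (S n) (fun a => if Nat.leb a n then c a else 0) X Y.
Proof.
  unfold hom_sum. rewrite (seq_S (S n)), Csum_app.
  match goal with |- _ = ?x + ?y => replace y with (RtoC 0) end.
  2: { unfold Csum. cbn [fold_right Nat.add]. replace (Nat.leb (S n) n) with false by (symmetry; apply Nat.leb_gt; lia). ring. }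
  rewrite <- Csum_scal, Cplus_0_r. apply Csum_ext. intros a Ha.
  apply in_seq in Ha. replace (Nat.leb a n) with true by (symmetry; apply Nat.leb_le; lia).
  replace (S n - a)%nat with (S (n - a)) by lia. simpl. ring.
Qed.

Lemma hom_sum_add n c d X Y : hom_sum n c X Y + hom_sum n d X Y = hom_sum n (fun a => c a + d a) X Y.
Proof. unfold hom_sum. rewrite <- Csum_plus. apply Csum_ext. intros; ring. Qed.

Lemma hom_sum_scal n c k X Y : k * hom_sum n c X Y = hom_sum n (fun a => k * c a) X Y.
Proof. unfold hom_sum. rewrite <- Csum_scal. apply Csum_ext. intros; ring. Qed.

Lemma hom_sum_zero n (c : nat -> C) X Y : (forall a, (a <= n)%nat -> c a = 0) -> hom_sum n c X Y = 0.
Proof.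
  intros H. apply Csum_zero. intros a Ha. apply in_seq in Ha. rewrite H by lia. ring.
Qed.

Lemma hpoly_hom_sum p q c z w :
  hpoly p q c z w = hom_sum p (fun a => hom_sum q (c a) (Cconj z) (Cconj w)) z w.
Proof.
  apply Csum_ext. intros a _.
  transitivity ((Cpow z a * Cpow w (p - a)) * hom_sum q (c a) (Cconj z) (Cconj w)); [|ring].
  unfold hom_sum. rewrite <- Csum_scal. apply Csum_ext. intros b _. ring.
Qed.

Lemma hom_hpoly p q P : hom p q P -> exists c, P = hpoly p q c.
Proof.
  induction 1 as [a|p q|p q P H [c ->]|p q P H [c ->]|p q P H [c ->]|p q P H [c ->]
    |p q P Q H1 [c ->] H2 [d ->]].
  - exists (fun _ _ => a). apply fext; intros. unfold hpoly, fcst. simpl. ring.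
  - exists (fun _ _ => RtoC 0). apply fext; intros. rewrite hpoly_hom_sum. symmetry.
    apply hom_sum_zero. intros; apply hom_sum_zero; auto.
  - exists (fun a b => match a with O => RtoC 0 | S a' => c a' b end). apply fext; intros z w.
    unfold fmul, fz. rewrite !hpoly_hom_sum, hom_sum_X. apply hom_sum_ext. intros [|a] _; [|reflexivity].
    symmetry; apply hom_sum_zero; auto.
  - exists (fun a b => if Nat.leb a p then c a b else 0). apply fext; intros z w.
    unfold fmul, fw. rewrite !hpoly_hom_sum, hom_sum_Y. apply hom_sum_ext. intros a _.
    destruct (Nat.leb a p); [reflexivity|]. symmetry; apply hom_sum_zero; auto.
  - exists (fun a b => match b with O => RtoC 0 | S b' => c a b' end). apply fext; intros z w.
    unfold fmul, fzb, conjf, fz. rewrite !hpoly_hom_sum, hom_sum_scal. apply hom_sum_ext. intros a _. apply hom_sum_X.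
  - exists (fun a b => if Nat.leb b q then c a b else 0). apply fext; intros z w.
    unfold fmul, fwb, conjf, fw. rewrite !hpoly_hom_sum, hom_sum_scal. apply hom_sum_ext. intros a _. apply hom_sum_Y.
  - exists (fun a b => c a b + d a b). apply fext; intros z w.
    unfold fadd. rewrite !hpoly_hom_sum, hom_sum_add. apply hom_sum_ext. intros a _. apply hom_sum_add.
Qed.

Lemma hom_Csum p q l (F : nat -> fn) : (forall a, In a l -> hom p q (F a)) ->
  hom p q (fun z w => Csum l (fun a => F a z w)).
Proof.
  induction l as [|x l IH]; intros H.
  - exact (hom_0 p q).
  - apply (hom_add p q (F x)); [apply H; now left|]. apply IH. intros; apply H; now right.
Qed.

Lemma hom_mono a b c d : hom (a + b) (c + d)
  (fun z w => Cpow z a * Cpow w b * Cpow (Cconj z) c * Cpow (Cconj w) d).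
Proof.
  induction a as [|a IH].
  - induction b as [|b IH].
    + induction c as [|c IH].
      * induction d as [|d IH].
        -- replace (fun z w : C => _) with (fcst 1); [constructor|]. apply fext; intros; unfold fcst; simpl; ring.
        -- eapply eq_ind; [exact (hom_wb _ _ _ IH)|]. apply fext; intros; unfold fmul, fwb, conjf, fw; simpl; ring.
      * eapply eq_ind; [exact (hom_zb _ _ _ IH)|]. apply fext; intros; unfold fmul, fzb, conjf, fz; simpl; ring.
    + eapply eq_ind; [exact (hom_w _ _ _ IH)|]. apply fext; intros; unfold fmul, fw; simpl; ring.
  - eapply eq_ind; [exact (hom_z _ _ _ IH)|]. apply fext; intros; unfold fmul, fz; simpl; ring.
Qed.

Lemma hpoly_hom p q c : hom p q (hpoly p q c).
Proof.
  apply (hom_Csum p q _ (fun a z w => Csum (seq 0 (S q)) (fun b => c a b * Cpow z a * Cpow w (p - a) * Cpow (Cconj z) b * Cpow (Cconj w) (q - b)))).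
  intros a Ha. apply in_seq in Ha.
  apply (hom_Csum p q _ (fun b z w => c a b * Cpow z a * Cpow w (p - a) * Cpow (Cconj z) b * Cpow (Cconj w) (q - b))).
  intros b Hb. apply in_seq in Hb.
  pose proof (hom_scal (c a b) _ _ _ (hom_mono a (p - a) b (q - b))) as H.
  replace (a + (p - a))%nat with p in H by lia. replace (b + (q - b))%nat with q in H by lia.
  eapply eq_ind; [exact H|]. apply fext; intros; unfold fmul, fcst; ring.
Qed.

Ltac dsimp := repeat (first
  [ rewrite (der_add _ derivation_dz) by auto 20 with sm
  | rewrite (der_add _ derivation_dzb) by auto 20 with sm
  | rewrite (der_add _ derivation_dw) by auto 20 with sm
  | rewrite (der_add _ derivation_dwb) by auto 20 with sm
  | rewrite (der_mul _ derivation_dz) by auto 20 with sm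
  | rewrite (der_mul _ derivation_dzb) by auto 20 with sm
  | rewrite (der_mul _ derivation_dw) by auto 20 with sm
  | rewrite (der_mul _ derivation_dwb) by auto 20 with sm
  | rewrite (der_cst _ derivation_dz) | rewrite (der_cst _ derivation_dzb)
  | rewrite (der_cst _ derivation_dw) | rewrite (der_cst _ derivation_dwb)
  | rewrite dz_fz | rewrite dzb_fz | rewrite dw_fz | rewrite dwb_fz
  | rewrite dz_fw | rewrite dzb_fw | rewrite dw_fw | rewrite dwb_fw
  | rewrite dz_fzb | rewrite dzb_fzb | rewrite dw_fzb | rewrite dwb_fzb
  | rewrite dz_fwb | rewrite dzb_fwb | rewrite dw_fwb | rewrite dwb_fwb ]).

(** The case distinction replaces a truncated $p-1$: in degree 0 the derivative is zero instead of
    being again of degree 0. *)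
Definition homd (p q : nat) (D : fn -> fn) (P : fn) : Prop :=
  match p with O => D P = fcst 0 | S p' => hom p' q (D P) end.
Definition homdb (p q : nat) (D : fn -> fn) (P : fn) : Prop :=
  match q with O => D P = fcst 0 | S q' => hom p q' (D P) end.

Lemma hom_deriv p q P : hom p q P ->
  (homd p q dz P /\ homd p q dw P) /\ (homdb p q dzb P /\ homdb p q dwb P).
Proof.
  assert (Z : forall F, fmul F (fcst 0) = fcst 0) by (intros; fcrush).
  assert (Z' : forall F, fmul (fcst 0) F = fcst 0) by (intros; fcrush).
  assert (P0 : forall F, fadd (fcst 0) F = F) by (intros; fcrush).
  assert (P0' : forall F, fadd F (fcst 0) = F) by (intros; fcrush).
  assert (P1 : forall F, fmul (fcst 1) F = F) by (intros; fcrush).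
  induction 1 as [a|p q|p q P H IH|p q P H IH|p q P H IH|p q P H IH|p q P Q H1 IH1 H2 IH2].
  3-6: pose proof (smooth_hom _ _ _ H) as SP; destruct IH as [[A1 A2] [A3 A4]];
    unfold homd, homdb in *; dsimp; rewrite !Z', !P1, !P0;
    destruct p, q; rewrite ?A1, ?A2, ?A3, ?A4, ?Z, ?P0'; repeat split; repeat (assumption || constructor).
  - unfold homd, homdb; dsimp; auto.
  - unfold homd, homdb; dsimp; destruct p, q; repeat split; constructor.
  - pose proof (smooth_hom _ _ _ H1) as SP. pose proof (smooth_hom _ _ _ H2) as SQ.
    destruct IH1 as [[A1 A2] [A3 A4]]. destruct IH2 as [[B1 B2] [B3 B4]].
    unfold homd, homdb in *; dsimp.
    destruct p, q; rewrite ?A1, ?A2, ?A3, ?A4, ?B1, ?B2, ?B3, ?B4, ?P0; repeat split; auto using hom_add.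
Qed.

Lemma hom_euler p q P : hom p q P ->
  fadd (fmul fz (dz P)) (fmul fw (dw P)) = fmul (fcst (RtoC (INR p))) P /\
  fadd (fmul fzb (dzb P)) (fmul fwb (dwb P)) = fmul (fcst (RtoC (INR q))) P.
Proof.
  assert (E : forall F G : fn, F = G -> forall z w, F z w = G z w) by (now intros ? ? ->).
  induction 1 as [a|p q|p q P H [I1 I2]|p q P H [I1 I2]|p q P H [I1 I2]|p q P H [I1 I2]|p q P Q H1 [I1 I2] H2 [J1 J2]].
  3-6: pose proof (smooth_hom _ _ _ H) as SP; rewrite ?S_INR, ?RtoC_plus;
    split; dsimp; apply fext; intros z w; pose proof (E _ _ I1 z w) as K1; pose proof (E _ _ I2 z w) as K2;
    unfold fadd, fmul, fcst in *; rewrite ?Cmult_plus_distr_r, ?Cmult_1_l;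
    match goal with |- _ = ?r * (?x * ?y) + _ => replace (r * (x * y)) with (x * (r * y)) by ring
                  | |- _ = ?r * (?x * ?y) => replace (r * (x * y)) with (x * (r * y)) by ring end;
    (rewrite <- K1 || rewrite <- K2); ring.
  - split; dsimp; simpl; fcrush.
  - split; dsimp; fcrush.
  - pose proof (smooth_hom _ _ _ H1) as SP. pose proof (smooth_hom _ _ _ H2) as SQ.
    split; dsimp; apply fext; intros z w; pose proof (E _ _ I1 z w) as K1; pose proof (E _ _ I2 z w) as K2;
    pose proof (E _ _ J1 z w) as L1; pose proof (E _ _ J2 z w) as L2; unfold fadd, fmul, fcst in *.
    + transitivity ((fz z w * dz P z w + fw z w * dw P z w) + (fz z w * dz Q z w + fw z w * dw Q z w)); [ring|rewrite K1, L1; ring].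
    + transitivity ((fzb z w * dzb P z w + fwb z w * dwb P z w) + (fzb z w * dzb Q z w + fwb z w * dwb Q z w)); [ring|rewrite K2, L2; ring].
Qed.

(** * The inner product and adjoints of the vector fields *)

Lemma ip_ext_l F F' G : (forall z w, onS3 z w -> F z w = F' z w) -> ip F G = ip F' G.
Proof. intros H. rewrite !ip_sphere_int. apply sphere_int_ext. intros z w Hs. unfold fmul. now rewrite H. Qed.

Lemma ip_add_l F G P : contF F -> contF G -> contF P -> ip (fadd F G) P = ip F P + ip G P.
Proof.
  intros HF HG HP. rewrite !ip_sphere_int, <- sphere_int_add by auto with sm. f_equal. fcrush.
Qed.

Lemma ip_scal_l c F P : contF F -> contF P -> ip (fmul (fcst c) F) P = c * ip F P.
Proof.
  intros HF HP. rewrite !ip_sphere_int, <- sphere_int_scal by auto with sm. f_equal. fcrush.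
Qed.

Lemma ip_sym F G : contF F -> contF G -> ip G F = Cconj (ip F G).
Proof.
  intros HF HG. rewrite !ip_sphere_int, <- sphere_int_conj by auto with sm. f_equal.
  rewrite conj_mul, conj_conj. fcrush.
Qed.

Lemma ip_scal_r c F P : contF F -> contF P -> ip F (fmul (fcst c) P) = Cconj c * ip F P.
Proof.
  intros HF HP. rewrite !ip_sphere_int, <- sphere_int_scal, conj_mul, conj_cst by auto with sm. f_equal. fcrush.
Qed.

Lemma ip_add_r F P Q : contF F -> contF P -> contF Q -> ip F (fadd P Q) = ip F P + ip F Q.
Proof.
  intros HF HP HQ. rewrite !ip_sphere_int, conj_add, <- sphere_int_add by auto with sm. f_equal. fcrush.
Qed.

Lemma ip_0_l G : contF G -> ip (fcst 0) G = 0.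
Proof.
  intros HG. replace (fcst 0) with (fmul (fcst 0) (fcst 0)) by fcrush.
  rewrite ip_scal_l by auto with sm. ring.
Qed.

Lemma ip_0_r G : contF G -> ip G (fcst 0) = 0.
Proof.
  intros HG. rewrite (ip_sym (fcst 0) G), ip_0_l by auto with sm. apply C_ext; simpl; ring.
Qed.

Lemma ip_zero_l (F G : fn) : contF G -> (forall z w, onS3 z w -> F z w = 0) -> ip F G = 0.
Proof.
  intros HG H. rewrite (ip_ext_l F (fcst 0)); [now apply ip_0_l|exact H].
Qed.

Lemma ip_conj_l F P : contF F -> contF P -> ip (conjf F) P = Cconj (ip F (conjf P)).
Proof. intros HF HP. rewrite !ip_sphere_int, <- sphere_int_conj, conj_mul, !conj_conj by auto with sm. reflexivity. Qed.

(** Integrate the product rule for $D(F\overline G)$. The field $D'$ is the complex conjugate of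
    $D$: [Zb1] for [Z1], while the real fields [T], [Ta], [Tb] are their own conjugates. *)
Lemma ip_adjoint D D' F G : derivation D -> (forall H, smooth H -> sphere_int (D H) = 0) ->
  (forall H, smooth H -> D (conjf H) = conjf (D' H)) -> (smooth G -> smooth (D' G)) ->
  smooth F -> smooth G -> ip (D F) G = - ip F (D' G).
Proof.
  intros HD HA HC HS HF HG. specialize (HS HG).
  pose proof (HA (fmul F (conjf G)) ltac:(auto with sm)) as H.
  rewrite (der_mul _ HD), HC in H by auto with sm.
  pose proof (der_smooth _ HD F HF) as HDF.
  rewrite sphere_int_add in H by auto with sm.
  change (ip (D F) G + ip F (D' G) = 0) in H.
  rewrite <- (Cplus_0_r (ip (D F) G)).
  transitivity (ip (D F) G + ip F (D' G) - ip F (D' G)); [ring|]. rewrite H. ring.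
Qed.

Lemma sphere_int_Zb1 H : smooth H -> sphere_int (Zb1 H) = 0.
Proof.
  intros HH. rewrite <- (conj_conj H), Zb1_conj, sphere_int_conj, sphere_int_Z1 by auto with sm.
  apply C_ext; simpl; ring.
Qed.

Lemma ip_Z1 F G : smooth F -> smooth G -> ip (Z1 F) G = - ip F (Zb1 G).
Proof.
  apply (ip_adjoint Z1 Zb1); auto with sm; [apply sphere_int_Z1|apply Z1_conj].
Qed.
Lemma ip_Zb1 F G : smooth F -> smooth G -> ip (Zb1 F) G = - ip F (Z1 G).
Proof.
  apply (ip_adjoint Zb1 Z1); auto with sm; [apply sphere_int_Zb1|apply Zb1_conj].
Qed.
Lemma ip_T F G : smooth F -> smooth G -> ip (T F) G = - ip F (T G).
Proof.
  apply (ip_adjoint T T); auto with sm; [apply sphere_int_T|apply T_conj].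
Qed.

(** * Spherical harmonics and the action of the vector fields on them *)

Definition Lap (F : fn) : fn := fadd (dz (dzb F)) (dw (dwb F)).

Definition sph (p q : nat) (P : fn) : Prop := hom p q P /\ Lap P = fcst 0.

Lemma smooth_sph p q P : sph p q P -> smooth P.
Proof. intros [H _]. exact (smooth_hom _ _ _ H). Qed.

Lemma harmonic_Lap P : harmonic P <-> Lap P = fcst 0.
Proof.
  split.
  - intros H. apply fext; intros z w. exact (H z w).
  - intros H z w. change (Lap P z w = 0). now rewrite H.
Qed.

Lemma comp_zero_sph F p q : comp_zero F p q <-> forall P, sph p q P -> ip F P = 0.
Proof.
  split.
  - intros H P [H1 H2]. destruct (hom_hpoly _ _ _ H1) as [c ->]. apply H. now apply harmonic_Lap.
  - intros H c Hc. apply H. split; [apply hpoly_hom|now apply harmonic_Lap].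
Qed.

Ltac dcomm := repeat (first
  [ rewrite dz_dzb by auto 20 with sm | rewrite dz_dw by auto 20 with sm
  | rewrite dz_dwb by auto 20 with sm | rewrite dzb_dw by auto 20 with sm
  | rewrite dzb_dwb by auto 20 with sm | rewrite dw_dwb by auto 20 with sm ]).

Lemma Z1_eq F : Z1 F = fadd (fmul fwb (dz F)) (fmul (fcst (-(1))) (fmul fzb (dw F))).
Proof. apply fext; intros; unfold Z1, fadd, fmul, fcst, fzb, fwb, conjf, fz, fw. ring. Qed.
Lemma Zb1_eq F : Zb1 F = fadd (fmul fw (dzb F)) (fmul (fcst (-(1))) (fmul fz (dwb F))).
Proof. apply fext; intros; unfold Zb1, fadd, fmul, fcst, fz, fw. ring. Qed.

(** Differentiating the coefficients $\bar w$ and $-\bar z$ produces the terms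
    $\partial_w\partial_zF$ and $-\partial_z\partial_wF$, which cancel. *)
Lemma Lap_Z1 F : smooth F -> Lap (Z1 F) = Z1 (Lap F).
Proof. intros HF. rewrite !Z1_eq. unfold Lap. dsimp. dcomm. fcrush. Qed.
Lemma Lap_Zb1 F : smooth F -> Lap (Zb1 F) = Zb1 (Lap F).
Proof. intros HF. rewrite !Zb1_eq. unfold Lap. dsimp. dcomm. fcrush. Qed.
Lemma Lap_conj F : smooth F -> Lap (conjf F) = conjf (Lap F).
Proof.
  intros HF. unfold Lap. rewrite dzb_conj, dwb_conj, dz_conj, dw_conj, conj_add by auto with sm.
  dcomm. reflexivity.
Qed.

Lemma sph_conj p q P : sph p q P -> sph q p (conjf P).
Proof.
  intros H. split; [apply hom_conj, H|].
  rewrite Lap_conj by exact (smooth_sph _ _ _ H). destruct H as [_ ->].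
  rewrite conj_cst. f_equal. apply C_ext; simpl; ring.
Qed.

Lemma sph_Z1 p q P : sph (S p) q P -> sph p (S q) (Z1 P).
Proof.
  intros H. pose proof (smooth_sph _ _ _ H) as HS. destruct H as [H1 H2].
  destruct (hom_deriv _ _ _ H1) as [[D1 D2] _]. simpl in D1, D2. split.
  - rewrite Z1_eq. apply hom_add; [now apply hom_wb|]. apply hom_scal. now apply hom_zb.
  - rewrite Lap_Z1, H2 by assumption. apply der_cst. auto with sm.
Qed.

Lemma sph_Zb1 p q P : sph p (S q) P -> sph (S p) q (Zb1 P).
Proof.
  intros H. pose proof (smooth_sph _ _ _ H) as HS. destruct H as [H1 H2].
  destruct (hom_deriv _ _ _ H1) as [_ [D1 D2]]. simpl in D1, D2. split.
  - rewrite Zb1_eq. apply hom_add; [now apply hom_w|]. apply hom_scal. now apply hom_z.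
  - rewrite Lap_Zb1, H2 by assumption. apply der_cst. auto with sm.
Qed.

Lemma hom_Zb1_0 p P : hom p 0 P -> Zb1 P = fcst 0.
Proof.
  intros H1. destruct (hom_deriv _ _ _ H1) as [_ [D1 D2]]. simpl in D1, D2.
  rewrite Zb1_eq, D1, D2. fcrush.
Qed.

Lemma hom_Z1_0 q P : hom 0 q P -> Z1 P = fcst 0.
Proof.
  intros H1. destruct (hom_deriv _ _ _ H1) as [[D1 D2] _]. simpl in D1, D2.
  rewrite Z1_eq, D1, D2. fcrush.
Qed.

Lemma sph_scal c p q P : sph p q P -> sph p q (fmul (fcst c) P).
Proof.
  intros H. pose proof (smooth_sph _ _ _ H) as HS. destruct H as [H1 H2].
  split; [now apply hom_scal|].
  replace (Lap (fmul (fcst c) P)) with (fmul (fcst c) (Lap P)).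
  - rewrite H2. fcrush.
  - unfold Lap. dsimp. fcrush.
Qed.

Lemma hom_T p q P : hom p q P -> T P = fmul (fcst (Ci * (RtoC (INR p) - RtoC (INR q)))) P.
Proof.
  intros H1. destruct (hom_euler _ _ _ H1) as [E1 E2].
  transitivity (fadd (fmul (fcst Ci) (fadd (fmul fz (dz P)) (fmul fw (dw P))))
    (fmul (fcst (- Ci)) (fadd (fmul fzb (dzb P)) (fmul fwb (dwb P))))).
  - apply fext; intros; unfold T, fadd, fmul, fcst, fzb, fwb, conjf, fz, fw. ring.
  - rewrite E1, E2. fcrush.
Qed.

Lemma feq_at (F G : fn) z w : F = G -> F z w = G z w.
Proof. now intros ->. Qed.

Lemma sph_eigen p q P : sph p q P ->
  Z1 (Zb1 P) = fmul (fcst (- RtoC (INR q) * (RtoC (INR p) + 1))) P.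
Proof.
  intros H. pose proof (smooth_sph _ _ _ H) as HS. destruct H as [H1 H2].
  assert (E3 : forall D, derivation D -> homdb p q D P ->
     fadd (fmul fz (dz (D P))) (fmul fw (dw (D P))) = fmul (fcst (RtoC (INR p))) (D P)).
  { intros D HD HP. destruct q as [|q]; simpl in HP.
    - rewrite HP. dsimp. fcrush.
    - apply (hom_euler _ _ _ HP). }
  destruct (hom_deriv _ _ _ H1) as [_ [D1 D2]].
  pose proof (E3 _ derivation_dzb D1) as E1. pose proof (E3 _ derivation_dwb D2) as E2.
  destruct (hom_euler _ _ _ H1) as [_ E0].
  rewrite Z1_eq, Zb1_eq. dsimp. unfold Lap in H2.
  apply fext; intros z w.
  apply (fun e => feq_at _ _ z w e) in E0, E1, E2, H2.
  unfold fadd, fmul, fcst in *.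
  (* The composition is $|x|^2$ times [Lap P] minus $\bar z(1+E)\partial_{\bar z}P+\bar
     w(1+E)\partial_{\bar w}P$ with $E$ the holomorphic Euler operator. As $E=p$ on both
     derivatives, the antiholomorphic Euler identity leaves $-(p+1)q\,P$. *)
  transitivity ((fw z w * fwb z w + fz z w * fzb z w) * (dz (dzb P) z w + dw (dwb P) z w)
    - fwb z w * (dwb P z w + (fz z w * dz (dwb P) z w + fw z w * dw (dwb P) z w))
    - fzb z w * (dzb P z w + (fz z w * dz (dzb P) z w + fw z w * dw (dzb P) z w))); [ring|].
  rewrite E1, E2, H2.
  transitivity (- (RtoC (INR p) + 1) * (fzb z w * dzb P z w + fwb z w * dwb P z w)); [ring|].
  rewrite E0. ring.
Qed.

Lemma RtoC_INR_S_neq n : RtoC (INR n) + 1 <> 0.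
Proof.
  rewrite <- RtoC_plus. intros E. apply RtoC_inj in E. pose proof (pos_INR n). lra.
Qed.

(** The eigenvalue of [sph_eigen] is nonzero as soon as the second degree is positive, so such a
    harmonic lies in the image of [Z1]. *)
Lemma sph_Z1_surj p q P : sph p (S q) P ->
  exists c, P = fmul (fcst c) (Z1 (Zb1 P)).
Proof.
  intros H. pose proof (sph_eigen _ _ _ H) as E. rewrite E.
  exists (/ (- RtoC (INR (S q)) * (RtoC (INR p) + 1))).
  apply fext; intros z w. unfold fmul, fcst.
  pose proof (RtoC_INR_S_neq p). pose proof (RtoC_INR_S_neq q).
  rewrite S_INR, RtoC_plus. field. auto.
Qed.

(** Write $P$ as a multiple of $Z_1Z_{\bar1}P$ and move [Z1] to the other side, where it becomes
    [Zb1] acting on $F$. This replaces a separate proof that harmonics of different bidegrees are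
    orthogonal. *)
Lemma Zb1_kernel_perp F p q P : smooth F -> (forall z w, onS3 z w -> Zb1 F z w = 0) ->
  sph p (S q) P -> ip F P = 0.
Proof.
  intros HF H0 HP. pose proof (smooth_sph _ _ _ HP) as SP.
  destruct (sph_Z1_surj _ _ _ HP) as [c E]. rewrite E, ip_scal_r by auto with sm.
  replace (ip F (Z1 (Zb1 P))) with (- ip (Zb1 F) (Zb1 P)) by (rewrite ip_Zb1 by auto with sm; ring).
  rewrite ip_zero_l by auto with sm. ring.
Qed.

Lemma Zb1_sq_kernel_perp F p q P : smooth F -> (forall z w, onS3 z w -> Zb1 (Zb1 F) z w = 0) ->
  sph p (S (S q)) P -> ip F P = 0.
Proof.
  intros HF H0 HP. pose proof (smooth_sph _ _ _ HP) as SP.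
  destruct (sph_Z1_surj _ _ _ HP) as [c E]. rewrite E, ip_scal_r by auto with sm.
  replace (ip F (Z1 (Zb1 P))) with (- ip (Zb1 F) (Zb1 P)) by (rewrite ip_Zb1 by auto with sm; ring).
  rewrite (Zb1_kernel_perp (Zb1 F) _ _ _ ltac:(auto with sm) H0 (sph_Zb1 _ _ _ HP)). ring.
Qed.

(** * Completeness of the spherical harmonics *)

(** The constructor [hs_ext] identifies functions that agree on the sphere: a coordinate times a
    harmonic splits into harmonics only after $|x|^2$ is replaced by 1. *)
Inductive harm_span : fn -> Prop :=
| hs_sph p q P : sph p q P -> harm_span P
| hs_add P Q : harm_span P -> harm_span Q -> harm_span (fadd P Q)
| hs_ext P Q : harm_span P -> (forall z w, onS3 z w -> P z w = Q z w) -> harm_span Q.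

Definition r2 : fn := fadd (fmul fz fzb) (fmul fw fwb).
Lemma smooth_r2 : smooth r2. Proof. unfold r2; auto with sm. Qed.
#[local] Hint Resolve smooth_r2 : sm.

Lemma r2_onS3 z w : onS3 z w -> r2 z w = 1.
Proof.
  intros H. unfold r2, fadd, fmul, fzb, fwb, conjf, fz, fw.
  rewrite <- !Cmod2_conj, <- RtoC_plus. f_equal. exact H.
Qed.

Lemma hom_r2 p q P : hom p q P -> hom (S p) (S q) (fmul r2 P).
Proof.
  intros H. replace (fmul r2 P) with (fadd (fmul fz (fmul fzb P)) (fmul fw (fmul fwb P)))
    by (unfold r2; fcrush).
  apply hom_add; [apply hom_z; now apply hom_zb|apply hom_w; now apply hom_wb].
Qed.

Lemma Lap_r2 p q P : sph p q P ->
  Lap (fmul r2 P) = fmul (fcst (RtoC (INR p) + RtoC (INR q) + 2)) P.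
Proof.
  intros H. pose proof (smooth_sph _ _ _ H) as HS. destruct H as [H1 H2].
  destruct (hom_euler _ _ _ H1) as [E1 E2].
  unfold Lap, r2 in *. dsimp. apply fext; intros z w.
  apply (fun e => feq_at _ _ z w e) in E1, E2, H2. unfold fadd, fmul, fcst in *.
  transitivity ((fz z w * fzb z w + fw z w * fwb z w) * (dz (dzb P) z w + dw (dwb P) z w) + 2 * P z w
   + (fz z w * dz P z w + fw z w * dw P z w) + (fzb z w * dzb P z w + fwb z w * dwb P z w)); [ring|].
  rewrite E1, E2, H2. ring.
Qed.

Lemma Lap_add P Q : smooth P -> smooth Q -> Lap (fadd P Q) = fadd (Lap P) (Lap Q).
Proof. intros. unfold Lap. dsimp. fcrush. Qed.
Lemma Lap_scal c P : smooth P -> Lap (fmul (fcst c) P) = fmul (fcst c) (Lap P).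
Proof. intros. unfold Lap. dsimp. fcrush. Qed.

(* On the sphere [x P = (x P - c |.|^2 D P) + c D P] with both summands harmonic. *)
Lemma harm_span_mul_coord (x : fn) (D : fn -> fn) p q P :
  smooth x -> derivation D -> (forall P, hom p q P -> hom (S p) q (fmul x P)) ->
  homdb p q D P -> Lap (D P) = fcst 0 -> Lap (fmul x P) = D P ->
  sph p q P -> harm_span (fmul x P).
Proof.
  intros Sx HD Hx HDP L0 L1 H. pose proof (smooth_sph _ _ _ H) as HS. destruct q as [|q]; simpl in HDP.
  - apply hs_sph with (S p) 0%nat. split; [apply Hx, H|]. now rewrite L1.
  - assert (SD : sph p q (D P)) by (split; assumption).
    assert (S1 : smooth (D P)) by (apply der_smooth; assumption).
    pose proof (Lap_r2 _ _ _ SD) as L2.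
    set (k := RtoC (INR p) + RtoC (INR q) + 2) in *.
    assert (Hk : k <> 0).
    { unfold k. rewrite <- !RtoC_plus. intros E. apply RtoC_inj in E.
      pose proof (pos_INR p). pose proof (pos_INR q). lra. }
    apply hs_ext with (fadd (fadd (fmul x P) (fmul (fcst (- / k)) (fmul r2 (D P)))) (fmul (fcst (/ k)) (D P))).
    + apply hs_add.
      * apply hs_sph with (S p) (S q). split.
        -- apply hom_add; [apply Hx, H|]. apply hom_scal. now apply hom_r2.
        -- rewrite Lap_add, Lap_scal, L1, L2 by auto with sm.
           apply fext; intros; unfold fadd, fmul, fcst. field. exact Hk.
      * apply hs_sph with p q. now apply sph_scal.
    + intros z w Hz. unfold fadd, fmul, fcst. rewrite r2_onS3 by assumption. field. exact Hk.
Qed.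

Lemma sph_mul_z p q P : sph p q P -> harm_span (fmul fz P).
Proof.
  intros H. pose proof (smooth_sph _ _ _ H) as HS.
  apply harm_span_mul_coord with dzb p q; auto with sm.
  - intros; now apply hom_z.
  - exact (proj1 (proj2 (hom_deriv _ _ _ (proj1 H)))).
  - transitivity (dzb (Lap P)); [unfold Lap; dsimp; dcomm; reflexivity|].
    destruct H as [_ ->]. dsimp. reflexivity.
  - transitivity (fadd (dzb P) (fmul fz (Lap P))); [unfold Lap; dsimp; fcrush|].
    destruct H as [_ ->]. fcrush.
Qed.

Lemma sph_mul_w p q P : sph p q P -> harm_span (fmul fw P).
Proof.
  intros H. pose proof (smooth_sph _ _ _ H) as HS.
  apply harm_span_mul_coord with dwb p q; auto with sm.
  - intros; now apply hom_w.
  - exact (proj2 (proj2 (hom_deriv _ _ _ (proj1 H)))).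
  - transitivity (dwb (Lap P)); [unfold Lap; dsimp; dcomm; reflexivity|].
    destruct H as [_ ->]. dsimp. reflexivity.
  - transitivity (fadd (dwb P) (fmul fw (Lap P))); [unfold Lap; dsimp; fcrush|].
    destruct H as [_ ->]. fcrush.
Qed.

Lemma harm_span_conj P : harm_span P -> harm_span (conjf P).
Proof.
  induction 1 as [p q P H|P Q _ IH1 _ IH2|P Q _ IH E].
  - apply hs_sph with q p. now apply sph_conj.
  - rewrite conj_add. now apply hs_add.
  - apply hs_ext with (1 := IH). intros z w Hz. unfold conjf. now rewrite E.
Qed.

Lemma harm_span_mul_ind (x : fn) : (forall p q P, sph p q P -> harm_span (fmul x P)) ->
  forall P, harm_span P -> harm_span (fmul x P).
Proof.
  intros Hx P. induction 1 as [p q P H|P Q _ IH1 _ IH2|P Q _ IH E].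
  - now apply (Hx p q).
  - replace (fmul x (fadd P Q)) with (fadd (fmul x P) (fmul x Q)) by fcrush. now apply hs_add.
  - apply hs_ext with (1 := IH). intros z w Hz. unfold fmul. now rewrite E.
Qed.

Lemma harm_span_poly_mul R : poly R -> forall P, harm_span P -> harm_span (fmul R P).
Proof.
  assert (Hz : forall P, harm_span P -> harm_span (fmul fz P)) by (apply harm_span_mul_ind, sph_mul_z).
  assert (Hw : forall P, harm_span P -> harm_span (fmul fw P)) by (apply harm_span_mul_ind, sph_mul_w).
  induction 1 as [c| | | | |F G _ IH1 _ IH2|F G _ IH1 _ IH2]; intros P HP; auto.
  - apply (harm_span_mul_ind (fcst c)); [|assumption]. intros p q Q HQ. apply hs_sph with p q.
    now apply sph_scal.
  - replace (fmul fzb P) with (conjf (fmul fz (conjf P))) by (rewrite conj_mul, conj_conj; reflexivity).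
    now apply harm_span_conj, Hz, harm_span_conj.
  - replace (fmul fwb P) with (conjf (fmul fw (conjf P))) by (rewrite conj_mul, conj_conj; reflexivity).
    now apply harm_span_conj, Hw, harm_span_conj.
  - replace (fmul (fadd F G) P) with (fadd (fmul F P) (fmul G P)) by fcrush. apply hs_add; auto.
  - replace (fmul (fmul F G) P) with (fmul F (fmul G P)) by fcrush. auto.
Qed.

Lemma harm_span_poly P : poly P -> harm_span P.
Proof.
  intros H. replace P with (fmul P (fcst 1)) by fcrush. apply harm_span_poly_mul; [exact H|].
  apply hs_sph with 0%nat 0%nat. split; [constructor|]. unfold Lap. dsimp. fcrush.
Qed.

Lemma ip_harm_span F : contF F -> (forall p q P, sph p q P -> ip F P = 0) ->
  forall P, harm_span P -> sphere_int (fmul F (conjf P)) = 0.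
Proof.
  intros HF H P HP.
  (* Through [hs_ext] a member of the span may be discontinuous off the sphere, whereas additivity
     of the integral is stated for continuous functions; so a continuous representative is carried
     along. *)
  assert (K : exists Q, contF Q /\ (forall z w, onS3 z w -> P z w = Q z w) /\ sphere_int (fmul F (conjf Q)) = 0).
  { induction HP as [p q P HP|P Q _ (P' & C1 & E1 & Z1') _ (Q' & C2 & E2 & Z2')|P Q _ (P' & C1 & E1 & Z1') E].
    - exists P. split; [exact (smooth_contF _ (smooth_sph _ _ _ HP))|]. split; [auto|].
      rewrite <- (ip_sphere_int F P). exact (H p q P HP).
    - exists (fadd P' Q'). split; [auto with sm|]. split.
      + intros z w Hz. unfold fadd. now rewrite E1, E2.
      + rewrite conj_add. replace (fmul F (fadd (conjf P') (conjf Q'))) with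
          (fadd (fmul F (conjf P')) (fmul F (conjf Q'))) by fcrush.
        rewrite sphere_int_add, Z1', Z2' by auto with sm. ring.
    - exists P'. split; [exact C1|]. split; [|exact Z1']. intros z w Hz. rewrite <- E by exact Hz. auto. }
  destruct K as (Q & _ & E & Z). rewrite <- Z. apply sphere_int_ext. intros z w Hz.
  unfold fmul, conjf. now rewrite E.
Qed.

Lemma sph_complete F : contF F -> (forall p q P, sph p q P -> ip F P = 0) ->
  forall z w, onS3 z w -> F z w = 0.
Proof.
  intros HF H. apply poly_dense; [exact HF|]. intros P HP.
  rewrite <- (conj_conj P). apply ip_harm_span; auto.
  now apply harm_span_conj, harm_span_poly.
Qed.

(** * Trivial deformations and the linearized obstruction *)

Lemma inD0_sph F : inD0 F <-> (forall p P, sph p 0 P -> ip F P = 0) /\ (forall p P, sph p 1 P -> ip F P = 0).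
Proof.
  split.
  - intros H. split; intros p; apply comp_zero_sph; apply H; [left|right]; reflexivity.
  - intros [H0 H1] p q [->| ->]; apply comp_zero_sph; [exact (H0 p)|exact (H1 p)].
Qed.

Lemma inD0perp_sph F : inD0perp F <-> forall p q P, sph p (S (S q)) P -> ip F P = 0.
Proof.
  split.
  - intros H p q. apply comp_zero_sph, H. lia.
  - intros H p [|[|q]] Hq; try lia. apply comp_zero_sph. exact (H p q).
Qed.

Lemma D0_inter F : smooth F -> inD0 F -> inD0perp F -> forall z w, onS3 z w -> F z w = 0.
Proof.
  intros HF H0 H1. apply sph_complete; [auto with sm|].
  apply inD0_sph in H0. destruct H0 as [Ha Hb]. pose proof (proj1 (inD0perp_sph F) H1) as Hc.
  intros p [|[|q]] P HP; eauto.
Qed.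

Lemma D0perp_trivial F : smooth F -> inD0perp F -> trivial_deformation F ->
  forall z w, onS3 z w -> F z w = 0.
Proof.
  intros HF HP (f & Hf & _ & E). apply D0_inter; auto. apply inD0_sph.
  assert (K : forall p q P, sph p q P -> Zb1 (Zb1 P) = fcst 0 -> ip F P = 0).
  { intros p q P HsP Z0. pose proof (smooth_sph _ _ _ HsP) as SP.
    rewrite (ip_ext_l F (fmul (fcst Ci) (Z1 (Z1 f)))) by exact E.
    rewrite ip_scal_l, ip_Z1, ip_Z1, Z0, ip_0_r by auto with sm. ring. }
  split; intros p P HsP; apply (K _ _ _ HsP).
  - rewrite (hom_Zb1_0 p P) by apply HsP. apply der_cst. auto with sm.
  - apply (hom_Zb1_0 (S p)). apply (sph_Zb1 _ _ _ HsP).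
Qed.

Lemma DQ_eq F : DQ F = fadd (fmul (fcst (/ 6)) (Z1 (Z1 (Zb1 (Zb1 F)))))
  (fadd (fmul (fcst (/ 6)) (Z1 (Z1 (Z1 (Z1 (conjf F))))))
  (fadd (fmul (fcst (-(1))) (T4 (T4 F)))
  (fadd (fmul (fcst (- (2 * Ci / 3))) (Z1 (Zb1 (T4 F)))) (fmul (fcst Ci) (T4 F))))).
Proof. apply fext; intros; unfold DQ, fadd, fmul, fcst. ring. Qed.

(** [T] acts on $H_{p,q}$ by a scalar. Its value is left open, since only the vanishing of the
    pairing has to be passed on. *)
Lemma ip_T4 F P p q : smooth F -> sph p q P -> exists c, ip (T4 F) P = c * ip F P.
Proof.
  intros HF HP. pose proof (smooth_sph _ _ _ HP) as SP.
  rewrite T4_eq, ip_add_l, ip_scal_l, ip_T, (hom_T p q P) by (auto with sm; apply HP).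
  rewrite ip_scal_r by auto with sm.
  eexists (- Cconj (Ci * (RtoC (INR p) - RtoC (INR q))) + 4 * Ci). ring.
Qed.

Lemma ip_Z1Zb1 F P : smooth F -> smooth P -> ip (Z1 (Zb1 F)) P = ip F (Z1 (Zb1 P)).
Proof. intros HF HP. rewrite ip_Z1, ip_Zb1 by auto with sm. ring. Qed.

Lemma DQ_perp F p q P : smooth F -> inD0perp F -> sph p (S (S q)) P -> ip (DQ F) P = 0.
Proof.
  intros HF H HP. pose proof (proj1 (inD0perp_sph F) H) as Hc.
  pose proof (smooth_sph _ _ _ HP) as SP.
  assert (SC : smooth (conjf F)) by auto with sm.
  assert (I1 : ip (Z1 (Z1 (Zb1 (Zb1 F)))) P = 0).
  { rewrite ip_Z1, ip_Z1, ip_Zb1, ip_Zb1 by auto 10 with sm.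
    rewrite (Hc p q); [ring|]. now apply sph_Z1, sph_Z1, sph_Zb1, sph_Zb1. }
  assert (I2 : ip (Z1 (Z1 (Z1 (Z1 (conjf F))))) P = 0).
  { do 4 rewrite ip_Z1 by auto 10 with sm.
    set (Q := Zb1 (Zb1 (Zb1 (Zb1 P)))).
    assert (SQ : smooth Q) by (unfold Q; auto 10 with sm).
    rewrite ip_conj_l by auto with sm.
    assert (IQ : ip F (conjf Q) = 0); [|rewrite IQ; apply C_ext; simpl; ring].
    (* This is the conjugate-linear term. Four applications of [Zb1] annihilate a harmonic whose
       second degree is 2 or 3. Otherwise they lead to first degree $p+4$, which after conjugation
       is the second degree, so that the hypothesis on $F$ applies. *)
    destruct q as [|[|q]].
    - unfold Q. pose proof (sph_Zb1 _ _ _ (sph_Zb1 _ _ _ HP)) as H2.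
      rewrite (hom_Zb1_0 _ _ (proj1 H2)). rewrite (der_cst _ derivation_Zb1), conj_cst.
      replace (Cconj 0) with (RtoC 0) by (apply C_ext; simpl; ring). apply ip_0_r; auto with sm.
    - unfold Q. pose proof (sph_Zb1 _ _ _ (sph_Zb1 _ _ _ (sph_Zb1 _ _ _ HP))) as H2.
      rewrite (hom_Zb1_0 _ _ (proj1 H2)). rewrite conj_cst.
      replace (Cconj 0) with (RtoC 0) by (apply C_ext; simpl; ring). apply ip_0_r; auto with sm.
    - apply (Hc q (S (S p))). apply sph_conj. now apply sph_Zb1, sph_Zb1, sph_Zb1, sph_Zb1. }
  assert (I3 : ip (T4 F) P = 0).
  { destruct (ip_T4 F P _ _ HF HP) as [c ->]. rewrite (Hc _ _ _ HP). ring. }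
  assert (I4 : ip (T4 (T4 F)) P = 0).
  { destruct (ip_T4 (T4 F) P _ _ ltac:(auto with sm) HP) as [c ->]. rewrite I3. ring. }
  assert (I5 : ip (Z1 (Zb1 (T4 F))) P = 0).
  { rewrite ip_Z1Zb1, (sph_eigen _ _ _ HP), ip_scal_r, I3 by auto with sm. ring. }
  rewrite DQ_eq. rewrite !ip_add_l, !ip_scal_l, I1, I2, I3, I4, I5 by auto 20 with sm. ring.
Qed.

Lemma smooth_DQ F : smooth F -> smooth (DQ F).
Proof. intros HF. rewrite DQ_eq. auto 20 with sm. Qed.

Lemma DO_zero F : smooth F -> inD0perp F -> forall z w, onS3 z w -> DO F z w = 0.
Proof.
  intros HF H. pose proof (smooth_DQ _ HF) as SQ. unfold DO.
  apply sph_complete; [auto with sm|]. intros p q P HP.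
  pose proof (smooth_sph _ _ _ HP) as SP.
  (* For first degree below 2 the function $Z_1^2P$ is zero; otherwise its second degree has risen
     by 2, which brings it into the range of [DQ_perp]. *)
  rewrite !ip_Zb1 by auto with sm. destruct p as [|[|p]].
  - rewrite (hom_Z1_0 _ _ (proj1 HP)), (der_cst _ derivation_Z1), ip_0_r by auto with sm. ring.
  - rewrite (hom_Z1_0 _ _ (proj1 (sph_Z1 _ _ _ HP))), ip_0_r by auto with sm. ring.
  - rewrite (DQ_perp F _ _ _ HF H (sph_Z1 _ _ _ (sph_Z1 _ _ _ HP))). ring.
Qed.

(** * Monomials and the reproducing kernel *)

Lemma ip_Ta F G : smooth F -> smooth G -> ip (Ta F) G = - ip F (Ta G).
Proof.
  apply (ip_adjoint Ta Ta); auto with sm; [apply sphere_int_Ta|apply Ta_conj|apply der_smooth; auto with sm].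
Qed.
Lemma ip_Tb F G : smooth F -> smooth G -> ip (Tb F) G = - ip F (Tb G).
Proof.
  apply (ip_adjoint Tb Tb); auto with sm; [apply sphere_int_Tb|apply Tb_conj|apply der_smooth; auto with sm].
Qed.

Definition mono (a b : nat) : fn := fmul (fpow fz a) (fpow fw b).

Lemma smooth_fpow f n : smooth f -> smooth (fpow f n).
Proof. intros H; induction n; simpl; auto with sm. Qed.
#[local] Hint Resolve smooth_fpow : sm.

Lemma smooth_mono a b : smooth (mono a b).
Proof. unfold mono; auto with sm. Qed.
#[local] Hint Resolve smooth_mono : sm.

Lemma fpow_val f n z w : fpow f n z w = Cpow (f z w) n.
Proof. induction n; simpl; [reflexivity|]. unfold fmul. now rewrite IHn. Qed.

Lemma mono_val a b z w : mono a b z w = Cpow z a * Cpow w b.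
Proof. unfold mono, fmul. now rewrite !fpow_val. Qed.

Lemma mono_Sa a b : mono (S a) b = fmul fz (mono a b).
Proof. apply fext; intros z w. unfold fmul. rewrite !mono_val. unfold fz; simpl. ring. Qed.
Lemma mono_Sb a b : mono a (S b) = fmul fw (mono a b).
Proof. apply fext; intros z w. unfold fmul. rewrite !mono_val. unfold fw; simpl. ring. Qed.

Lemma hom_monomial a b : hom (a + b) 0 (mono a b).
Proof.
  induction a as [|a IH]; simpl.
  - induction b as [|b IH].
    + replace (mono 0 0) with (fcst 1); [constructor|]. unfold mono; simpl. fcrush.
    + rewrite mono_Sb. now apply hom_w.
  - rewrite mono_Sa. now apply hom_z.
Qed.

Lemma hom_sph p P : hom p 0 P -> sph p 0 P.
Proof.
  intros H. split; [exact H|]. destruct (hom_deriv _ _ _ H) as [_ [D1 D2]]. simpl in D1, D2.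
  unfold Lap. rewrite D1, D2. dsimp. fcrush.
Qed.

Lemma derivation_pow D f c n : derivation D -> smooth f -> D f = fmul (fcst c) f ->
  D (fpow f n) = fmul (fcst (RtoC (INR n) * c)) (fpow f n).
Proof.
  intros HD Hf H. induction n as [|n IH].
  - simpl. rewrite (der_cst _ HD). fcrush.
  - simpl fpow. rewrite (der_mul _ HD), H, IH, S_INR, RtoC_plus by auto with sm. fcrush.
Qed.

Lemma Ta_mono a b : Ta (mono a b) = fmul (fcst (RtoC (INR a) * Ci)) (mono a b).
Proof.
  unfold mono. rewrite (der_mul _ derivation_Ta) by auto with sm.
  rewrite (derivation_pow Ta fz Ci), (derivation_pow Ta fw 0); auto with sm.
  - fcrush.
  - rewrite Ta_comb. unfold comb. dsimp. fcrush.
  - rewrite Ta_comb. unfold comb. dsimp. fcrush.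
Qed.

Lemma Tb_mono a b : Tb (mono a b) = fmul (fcst (RtoC (INR b) * Ci)) (mono a b).
Proof.
  unfold mono. rewrite (der_mul _ derivation_Tb) by auto with sm.
  rewrite (derivation_pow Tb fz 0), (derivation_pow Tb fw Ci); auto with sm.
  - fcrush.
  - rewrite Tb_comb. unfold comb. dsimp. fcrush.
  - rewrite Tb_comb. unfold comb. dsimp. fcrush.
Qed.

Lemma Ci_sq : Ci * Ci = - (1).
Proof. apply C_ext; simpl; ring. Qed.

Lemma conj_INR_Ci n : Cconj (RtoC (INR n) * Ci) = - (RtoC (INR n) * Ci).
Proof. apply C_ext; simpl; ring. Qed.

Lemma INR_Ci_inj m n x : RtoC (INR m) * Ci * x = RtoC (INR n) * Ci * x -> m <> n -> x = 0.
Proof.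
  intros H Hmn.
  assert (K : (RtoC (INR m) - RtoC (INR n)) * x = 0).
  { transitivity (- Ci * (RtoC (INR m) * Ci * x - RtoC (INR n) * Ci * x)).
    - transitivity (- (Ci * Ci) * ((RtoC (INR m) - RtoC (INR n)) * x)); [rewrite Ci_sq; ring|ring].
    - rewrite H. ring. }
  assert (N : RtoC (INR m) - RtoC (INR n) <> 0).
  { rewrite <- RtoC_minus. intros E. apply RtoC_inj in E. apply Hmn, INR_eq. lra. }
  transitivity (/ (RtoC (INR m) - RtoC (INR n)) * ((RtoC (INR m) - RtoC (INR n)) * x)); [field; exact N|].
  rewrite K. ring.
Qed.

(** Monomials are eigenfunctions of the skew-adjoint rotation fields [Ta] and [Tb] with eigenvalues
    $ia$ and $ib$, and at least one of these differs for two distinct monomials. *)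
Lemma mono_orth a b a' b' : (a, b) <> (a', b') -> ip (mono a b) (mono a' b') = 0.
Proof.
  intros H. destruct (Nat.eq_dec a a') as [Ha|Ha].
  - apply (INR_Ci_inj b b'); [|congruence].
    rewrite <- ip_scal_l, <- Tb_mono, ip_Tb, Tb_mono, ip_scal_r, conj_INR_Ci by auto with sm. ring.
  - apply (INR_Ci_inj a a'); [|exact Ha].
    rewrite <- ip_scal_l, <- Ta_mono, ip_Ta, Ta_mono, ip_scal_r, conj_INR_Ci by auto with sm. ring.
Qed.

Lemma hom_weight_orth m n P Q : hom m 0 P -> hom n 0 Q -> m <> n -> ip P Q = 0.
Proof.
  intros HP HQ Hmn. pose proof (smooth_hom _ _ _ HP). pose proof (smooth_hom _ _ _ HQ).
  apply (INR_Ci_inj m n); [|exact Hmn].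
  assert (E : forall k F, hom k 0 F -> T F = fmul (fcst (RtoC (INR k) * Ci)) F).
  { intros k F HF. rewrite (hom_T _ _ _ HF). simpl INR. fcrush. }
  rewrite <- ip_scal_l, <- (E m), ip_T, (E n), ip_scal_r, conj_INR_Ci by auto with sm. ring.
Qed.

Definition mono_norm2 (a b : nat) : C := ip (mono a b) (mono a b).

(** Integrate $|z|^2+|w|^2=1$ against $|z^aw^b|^2$. *)
Lemma mono_norm2_sum a b : mono_norm2 (S a) b + mono_norm2 a (S b) = mono_norm2 a b.
Proof.
  unfold mono_norm2. rewrite !ip_sphere_int, <- sphere_int_add by auto with sm. apply sphere_int_ext. intros z w Hz.
  rewrite mono_Sa, mono_Sb. apply r2_onS3 in Hz. unfold r2, fadd, fmul, fzb, fwb, conjf in *.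
  rewrite !Cmult_conj.
  transitivity ((fz z w * Cconj (fz z w) + fw z w * Cconj (fw z w)) * (mono a b z w * Cconj (mono a b z w))); [ring|].
  rewrite Hz. ring.
Qed.

Lemma dz_mono a b : dz (mono (S a) b) = fmul (fcst (RtoC (INR a) + 1)) (mono a b).
Proof.
  induction a as [|a IH].
  - rewrite mono_Sa. dsimp. replace (dz (mono 0 b)) with (fcst 0).
    + simpl INR. fcrush.
    + induction b as [|b IH]; [unfold mono; simpl; dsimp; fcrush|].
      rewrite mono_Sb. dsimp. rewrite <- IH. fcrush.
  - rewrite mono_Sa. dsimp. rewrite IH, (mono_Sa a b), S_INR, RtoC_plus. fcrush.
Qed.

Lemma dw_mono a b : dw (mono a (S b)) = fmul (fcst (RtoC (INR b) + 1)) (mono a b).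
Proof.
  induction b as [|b IH].
  - rewrite mono_Sb. dsimp. replace (dw (mono a 0)) with (fcst 0).
    + simpl INR. fcrush.
    + induction a as [|a IH]; [unfold mono; simpl; dsimp; fcrush|].
      rewrite mono_Sa. dsimp. rewrite <- IH. fcrush.
  - rewrite mono_Sb. dsimp. rewrite IH, (mono_Sb a b), S_INR, RtoC_plus. fcrush.
Qed.

(** Since $Z_{\bar1}$ kills $z^aw^b$, this monomial is orthogonal to $Z_1(z^{a+1}w^{b+1})$; writing
    out this pairing gives the identity. With [mono_norm2_sum] it determines all norms from the
    volume. *)
Lemma mono_norm2_balance a b : (RtoC (INR a) + 1) * mono_norm2 a (S b) = (RtoC (INR b) + 1) * mono_norm2 (S a) b.
Proof.
  assert (S1 : smooth (mono (S a) (S b))) by auto with sm.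
  pose proof (ip_Zb1 (mono a b) (mono (S a) (S b)) ltac:(auto with sm) S1) as H.
  rewrite (hom_Zb1_0 _ _ (hom_monomial a b)), ip_0_l in H by auto with sm.
  rewrite Z1_eq, dz_mono, dw_mono in H.
  rewrite ip_add_r in H by auto 10 with sm.
  assert (E1 : ip (mono a b) (fmul fwb (fmul (fcst (RtoC (INR a) + 1)) (mono a (S b))))
     = (RtoC (INR a) + 1) * mono_norm2 a (S b)).
  { unfold mono_norm2. rewrite !ip_sphere_int, <- sphere_int_scal by auto with sm. f_equal.
    rewrite !conj_mul, conj_cst. unfold fwb. rewrite conj_conj, (mono_Sb a b), conj_mul.
    replace (Cconj (RtoC (INR a) + 1)) with (RtoC (INR a) + 1) by (apply C_ext; simpl; ring). fcrush. }
  assert (E2 : ip (mono a b) (fmul (fcst (-(1))) (fmul fzb (fmul (fcst (RtoC (INR b) + 1)) (mono (S a) b))))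
     = - ((RtoC (INR b) + 1) * mono_norm2 (S a) b)).
  { transitivity ((- (RtoC (INR b) + 1)) * mono_norm2 (S a) b); [|ring].
    unfold mono_norm2. rewrite !ip_sphere_int, <- sphere_int_scal by auto with sm. f_equal.
    rewrite !conj_mul, !conj_cst. unfold fzb. rewrite conj_conj, (mono_Sa a b), conj_mul.
    replace (Cconj (RtoC (INR b) + 1)) with (RtoC (INR b) + 1) by (apply C_ext; simpl; ring).
    replace (Cconj (- (1))) with (- (1)) by (apply C_ext; simpl; ring). fcrush. }
  rewrite E1, E2 in H.
  transitivity ((RtoC (INR b) + 1) * mono_norm2 (S a) b - - ((RtoC (INR a) + 1) * mono_norm2 a (S b) + - ((RtoC (INR b) + 1) * mono_norm2 (S a) b)));
    [ring|]. rewrite <- H. ring.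
Qed.

Lemma mono_norm2_Sa a b : (RtoC (INR a) + RtoC (INR b) + 2) * mono_norm2 (S a) b = (RtoC (INR a) + 1) * mono_norm2 a b.
Proof.
  rewrite <- (mono_norm2_sum a b). pose proof (mono_norm2_balance a b) as H.
  transitivity ((RtoC (INR a) + 1) * mono_norm2 (S a) b + (RtoC (INR b) + 1) * mono_norm2 (S a) b); [ring|].
  rewrite <- H. ring.
Qed.

Lemma mono_norm2_Sb a b : (RtoC (INR a) + RtoC (INR b) + 2) * mono_norm2 a (S b) = (RtoC (INR b) + 1) * mono_norm2 a b.
Proof.
  rewrite <- (mono_norm2_sum a b). pose proof (mono_norm2_balance a b) as H.
  transitivity ((RtoC (INR a) + 1) * mono_norm2 a (S b) + (RtoC (INR b) + 1) * mono_norm2 a (S b)); [ring|].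
  rewrite H. ring.
Qed.

Definition vol : C := mono_norm2 0 0.

Lemma vol_val : vol = RtoC (2 * PI ^ 2)%R.
Proof.
  unfold vol, mono_norm2. rewrite ip_sphere_int.
  replace (fmul (mono 0 0) (conjf (mono 0 0))) with (fcst 1).
  2: { unfold mono; simpl. apply fext; intros; unfold fmul, fcst, conjf. apply C_ext; simpl; ring. }
  apply C_ext; simpl.
  - unfold hopf_int.
    assert (E : forall e, RInt (fun a => RInt (fun b => Re (fcst 1 (hz e a) (hw e b) * wt e)) 0 (2 * PI)) 0 (2 * PI)
       = (4 * PI ^ 2 * (sin e * cos e))%R).
    { intros e.
      rewrite (RInt_ext _ (fun _ => (2 * PI * (sin e * cos e))%R)).
      - rewrite RInt_const. unfold scal; simpl; unfold mult; simpl. ring.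
      - intros a _. rewrite (RInt_ext _ (fun _ => (sin e * cos e)%R)).
        + rewrite RInt_const. unfold scal; simpl; unfold mult; simpl. ring.
        + intros b _. unfold fcst, wt. simpl. ring. }
    rewrite (RInt_ext _ (fun e => (4 * PI ^ 2 * (sin e * cos e))%R)) by (intros e _; apply E).
    rewrite (RInt_is_derive (fun e => (2 * PI ^ 2 * (sin e * sin e))%R)).
    + rewrite sin_PI2, sin_0. ring.
    + intros e. auto_derive; auto. ring.
    + intros e. apply continuous_Rmult; [apply continuous_const|].
      apply continuous_Rmult; [apply continuous_sin|apply continuous_cos].
  - unfold hopf_int. do 3 (apply RInt_zero; intros ?). unfold fcst, wt. simpl. ring.
Qed.

Lemma vol_neq : vol <> 0.
Proof.
  rewrite vol_val. intros E. apply RtoC_inj in E. pose proof PI_RGT_0. nra.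
Qed.

Fixpoint binom (n k : nat) : C :=
  match n, k with
  | _, O => RtoC 1
  | O, S _ => RtoC 0
  | S m, S j => binom m j + binom m (S j)
  end.

Lemma binom_0 n : binom n 0 = 1.
Proof. destruct n; reflexivity. Qed.

Lemma binom_gt n k : (n < k)%nat -> binom n k = 0.
Proof.
  revert k; induction n as [|n IH]; intros [|k] H; try lia; simpl; [reflexivity|].
  rewrite !IH by lia. ring.
Qed.

(* The kernel [(n + 1) / vol * <x, s>^n] reproduces the holomorphic polynomials of degree [n]. *)
Lemma binom_mono_norm2 n a b : (a + b = n)%nat -> (RtoC (INR n) + 1) * (binom n a * mono_norm2 a b) = vol.
Proof.
  revert a b; induction n as [|n IH]; intros a b H.
  - replace a with 0%nat by lia. replace b with 0%nat by lia. simpl. fold vol. ring.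
  - rewrite S_INR, RtoC_plus. destruct a as [|a].
    + destruct b as [|b]; [lia|]. rewrite binom_0. pose proof (mono_norm2_Sb 0 b) as E.
      pose proof (IH 0%nat b ltac:(lia)) as I. rewrite binom_0 in I.
      replace n with b in * by lia. simpl (INR 0) in E.
      transitivity ((RtoC 0 + RtoC (INR b) + 2) * mono_norm2 0 (S b)); [ring|]. rewrite E, <- I. ring.
    + simpl binom. pose proof (IH a b ltac:(lia)) as I1. pose proof (mono_norm2_Sa a b) as E1.
      assert (HI : RtoC (INR n) = RtoC (INR a) + RtoC (INR b)).
      { rewrite <- RtoC_plus, <- plus_INR. f_equal. f_equal. lia. }
      pose proof (RtoC_INR_S_neq n) as Hn.
      destruct b as [|b].
      * rewrite (binom_gt n (S a)) by lia. simpl (INR 0) in *.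
        transitivity ((binom n a) * ((RtoC (INR a) + RtoC 0 + 2) * mono_norm2 (S a) 0)); [rewrite HI; ring|].
        rewrite E1, <- I1, HI. ring.
      * pose proof (IH (S a) b ltac:(lia)) as I2. pose proof (mono_norm2_Sb (S a) b) as E2.
        rewrite S_INR, RtoC_plus in E2, HI.
        rewrite S_INR, RtoC_plus in E1.
        (* Pascal's rule splits the coefficient. In one half the exponent of $z$ is lowered, in the
           other that of $w$, and both then fall under the induction hypothesis. *)
        transitivity (binom n a * ((RtoC (INR a) + (RtoC (INR b) + 1) + 2) * mono_norm2 (S a) (S b))
          + binom n (S a) * ((RtoC (INR a) + 1 + RtoC (INR b) + 2) * mono_norm2 (S a) (S b))); [rewrite HI; ring|].
        rewrite E1, E2.
        transitivity (/ (RtoC (INR n) + 1) * ((RtoC (INR a) + 1) * ((RtoC (INR n) + 1) * (binom n a * mono_norm2 a (S b)))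
          + (RtoC (INR b) + 1) * ((RtoC (INR n) + 1) * (binom n (S a) * mono_norm2 (S a) b)))); [field; exact Hn|].
        rewrite I1, I2.
        transitivity (/ (RtoC (INR n) + 1) * (((RtoC (INR a) + (RtoC (INR b) + 1)) + 1) * vol)); [ring|].
        rewrite <- HI. field. exact Hn.
Qed.

Lemma binomial n X Y : Cpow (X + Y) n = hom_sum n (binom n) X Y.
Proof.
  induction n as [|n IH].
  - unfold hom_sum. simpl. ring.
  - simpl Cpow. rewrite IH, Cmult_plus_distr_r, hom_sum_X, hom_sum_Y, hom_sum_add.
    apply hom_sum_ext. intros [|a] Ha.
    + rewrite !binom_0. simpl. ring.
    + simpl binom. destruct (Nat.leb (S a) n) eqn:E; [reflexivity|].
      apply Nat.leb_gt in E. rewrite (binom_gt n (S a)) by lia. ring.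
Qed.

(** * Holomorphic components through the Szego kernel *)

Definition szego_form (x y : C) : fn := fadd (fmul (fcst x) fzb) (fmul (fcst y) fwb).
(** Up to the factor $(n+1)/\mathrm{vol}$ this is the $H_{n,0}$-component of $F$; the normalisation
    is left to the coefficients of the series. *)
Definition hol_comp (F : fn) (n : nat) : fn := fun x y => sphere_int (fmul F (fpow (szego_form x y) n)).

Lemma smooth_szego_form x y : smooth (szego_form x y).
Proof. unfold szego_form; auto with sm. Qed.
#[local] Hint Resolve smooth_szego_form : sm.

Lemma Cpow_mult x y n : Cpow (x * y) n = Cpow x n * Cpow y n.
Proof. induction n; simpl; [ring|]. rewrite IHn. ring. Qed.
Lemma Cpow_conj' x n : Cpow (Cconj x) n = Cconj (Cpow x n).
Proof. induction n; simpl; [apply C_ext; simpl; ring|]. rewrite IHn, Cmult_conj. reflexivity. Qed.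

Lemma contF_Csum l (f : nat -> fn) : (forall a, contF (f a)) -> contF (fun z w => Csum l (fun a => f a z w)).
Proof.
  intros H. induction l as [|x l IH]; [exact (contF_cst 0)|].
  exact (contF_add _ _ (H x) IH).
Qed.

Lemma sphere_int_Csum l (f : nat -> fn) : (forall a, contF (f a)) ->
  sphere_int (fun z w => Csum l (fun a => f a z w)) = Csum l (fun a => sphere_int (f a)).
Proof.
  intros H. induction l as [|x l IH].
  - change (sphere_int (fcst 0) = 0). replace (fcst 0) with (fmul (fcst 0) (fcst 0)) by fcrush.
    rewrite sphere_int_scal by auto with sm. ring.
  - change (sphere_int (fadd (f x) (fun z w => Csum l (fun a => f a z w))) = sphere_int (f x) + Csum l (fun a => sphere_int (f a))).
    rewrite sphere_int_add, IH; auto. now apply contF_Csum.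
Qed.

Lemma hol_comp_expand F n x y : contF F ->
  hol_comp F n x y = Csum (seq 0 (S n)) (fun a => binom n a * ip F (mono a (n - a)) * mono a (n - a) x y).
Proof.
  intros HF. unfold hol_comp.
  replace (fmul F (fpow (szego_form x y) n)) with
    (fun z w => Csum (seq 0 (S n)) (fun a => fmul (fcst (binom n a * mono a (n - a) x y)) (fmul F (conjf (mono a (n - a)))) z w)).
  - rewrite (sphere_int_Csum _ (fun a => fmul (fcst (binom n a * mono a (n - a) x y)) (fmul F (conjf (mono a (n - a)))))) by auto with sm.
    apply Csum_ext. intros a _. rewrite sphere_int_scal by auto with sm. rewrite <- ip_sphere_int. ring.
  - apply fext; intros z w. unfold fmul at 3. rewrite fpow_val. unfold szego_form, fadd at 1, fmul at 3 4.
    rewrite binomial. unfold hom_sum. rewrite <- Csum_scal. apply Csum_ext. intros a _.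
    unfold fmul, fcst, conjf, fzb, fwb, conjf, fz, fw. rewrite !mono_val, !Cpow_mult, !Cpow_conj', Cmult_conj. ring.
Qed.

Lemma hol_comp_hom F n : contF F -> hom n 0 (hol_comp F n).
Proof.
  intros HF.
  replace (hol_comp F n) with (fun x y => Csum (seq 0 (S n)) (fun a => fmul (fcst (binom n a * ip F (mono a (n - a)))) (mono a (n - a)) x y)).
  - apply (hom_Csum n 0 _ (fun a => fmul (fcst (binom n a * ip F (mono a (n - a)))) (mono a (n - a)))).
    intros a Ha. apply in_seq in Ha. apply hom_scal. pose proof (hom_monomial a (n - a)) as H.
    now replace (a + (n - a))%nat with n in H by lia.
  - apply fext; intros x y. symmetry. apply hol_comp_expand. exact HF.
Qed.

(** In the binomial expansion orthogonality leaves a single monomial, and [binom_mono_norm2] shows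
    that its constant depends on the degree $a+b$ only. *)
Lemma hol_comp_mono F a b : contF F ->
  ip (hol_comp F (a + b)) (mono a b) = vol / (RtoC (INR (a + b)) + 1) * ip F (mono a b).
Proof.
  intros HF. set (n := (a + b)%nat).
  replace (hol_comp F n) with (fun x y => Csum (seq 0 (S n)) (fun a => fmul (fcst (binom n a * ip F (mono a (n - a)))) (mono a (n - a)) x y)).
  2: { apply fext; intros x y. symmetry. apply hol_comp_expand. exact HF. }
  rewrite ip_sphere_int.
  replace (fmul _ (conjf (mono a b))) with (fun z w => Csum (seq 0 (S n)) (fun k =>
    fmul (fmul (fcst (binom n k * ip F (mono k (n - k)))) (mono k (n - k))) (conjf (mono a b)) z w)).
  2: { apply fext; intros z w. unfold fmul at 3. rewrite Cmult_comm, <- Csum_scal.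
       apply Csum_ext. intros k _. unfold fmul. ring. }
  rewrite (sphere_int_Csum _ (fun k => fmul (fmul (fcst (binom n k * ip F (mono k (n - k)))) (mono k (n - k))) (conjf (mono a b)))) by auto with sm.
  rewrite (Csum_single _ a).
  2: unfold n; lia.
  2: intros k Hk; rewrite <- ip_sphere_int, ip_scal_l, mono_orth by (auto with sm; congruence); ring.
  rewrite <- ip_sphere_int, ip_scal_l by auto with sm. replace (n - a)%nat with b by (unfold n; lia).
  fold (mono_norm2 a b). rewrite <- (binom_mono_norm2 n a b eq_refl). field. apply RtoC_INR_S_neq.
Qed.

Lemma hom_mono_span p P : hom p 0 P -> exists c, P = fun z w => Csum (seq 0 (S p)) (fun a => fmul (fcst (c a)) (mono a (p - a)) z w).
Proof.
  intros H. destruct (hom_hpoly _ _ _ H) as [c ->]. exists (fun a => c a 0%nat).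
  apply fext; intros z w. apply Csum_ext. intros a _. unfold fmul, fcst. rewrite mono_val. simpl. ring.
Qed.

Lemma hol_comp_repr F p P : contF F -> hom p 0 P ->
  ip (hol_comp F p) P = vol / (RtoC (INR p) + 1) * ip F P.
Proof.
  intros HF HP. destruct (hom_mono_span _ _ HP) as [c E].
  assert (SH : smooth (hol_comp F p)) by exact (smooth_hom _ _ _ (hol_comp_hom F p HF)).
  assert (K : forall G, contF G -> ip G P = Csum (seq 0 (S p)) (fun a => Cconj (c a) * ip G (mono a (p - a)))).
  { intros G HG. rewrite ip_sphere_int, E.
    replace (fmul G _) with (fun z w => Csum (seq 0 (S p)) (fun a => fmul (fcst (Cconj (c a))) (fmul G (conjf (mono a (p - a)))) z w)).
    - rewrite (sphere_int_Csum _ (fun a => fmul (fcst (Cconj (c a))) (fmul G (conjf (mono a (p - a)))))) by auto with sm.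
      apply Csum_ext. intros a _. rewrite sphere_int_scal by auto with sm. now rewrite <- ip_sphere_int.
    - apply fext; intros z w. unfold fmul at 3, conjf at 2. clear E.
      induction (seq 0 (S p)) as [|k l IH]; simpl; [rewrite conj_RtoC; ring|].
      rewrite Cplus_conj, Cmult_plus_distr_l, <- IH. f_equal. unfold fmul, fcst, conjf. rewrite Cmult_conj. ring. }
  rewrite (K (hol_comp F p)), (K F), <- Csum_scal by auto with sm. apply Csum_ext. intros a Ha.
  apply in_seq in Ha. pose proof (hol_comp_mono F a (p - a) HF) as M.
  replace (a + (p - a))%nat with p in M by lia. rewrite M. ring.
Qed.

(** * Series of holomorphic polynomials *)

Definition inv_sq (n : nat) : R := (/ (INR n + 1) ^ 2)%R.

Lemma INR1_pos n : (0 < INR n + 1)%R.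
Proof. pose proof (pos_INR n). lra. Qed.

Lemma inv_sq_pos n : (0 < inv_sq n)%R.
Proof. apply Rinv_0_lt_compat, pow_lt, INR1_pos. Qed.

(** Comparison with $2/((n+1)(n+2))$, whose partial sums telescope. *)
Lemma ex_series_inv_sq : ex_series inv_sq.
Proof.
  apply (ex_series_le (K := R_AbsRing) (V := R_CompleteNormedModule) inv_sq
    (fun n => 2 * / ((INR n + 1) * (INR n + 2)))%R).
  - intros n. unfold norm; simpl; unfold abs; simpl.
    rewrite Rabs_pos_eq by apply Rlt_le, inv_sq_pos. unfold inv_sq.
    pose proof (pos_INR n).
    assert (H1 : (0 < (INR n + 1) ^ 2)%R) by (apply pow_lt; lra).
    assert (H2 : (0 < (INR n + 1) * (INR n + 2))%R) by nra.
    apply Rmult_le_reg_r with ((INR n + 1) ^ 2)%R; [exact H1|].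
    rewrite Rinv_l by lra.
    apply Rmult_le_reg_r with ((INR n + 1) * (INR n + 2))%R; [exact H2|].
    replace (2 * / ((INR n + 1) * (INR n + 2)) * (INR n + 1) ^ 2 * ((INR n + 1) * (INR n + 2)))%R
      with (2 * (INR n + 1) ^ 2)%R by (field; lra). nra.
  - assert (H : ex_series (fun n => / ((INR n + 1) * (INR n + 2)))%R); [|exact (ex_series_scal 2%R _ H)].
    exists 1%R. change (is_lim_seq (sum_n (fun n => / ((INR n + 1) * (INR n + 2)))%R) 1%R).
    apply is_lim_seq_ext with (u := fun n => (1 - / (INR n + 2))%R).
    + induction n as [|n IH].
      * rewrite sum_O. simpl. field.
      * rewrite sum_Sn, <- IH, !S_INR. unfold plus; simpl. pose proof (pos_INR n). field. lra.
    + replace (Finite 1) with (Rbar_minus (Finite 1) (Finite 0)) by (simpl; f_equal; ring).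
      apply is_lim_seq_minus'; [apply is_lim_seq_const|].
      replace (Finite 0) with (Rbar_inv p_infty) by reflexivity.
      apply is_lim_seq_inv; [|discriminate].
      apply (is_lim_seq_plus _ _ p_infty 2%R); [apply is_lim_seq_INR|apply is_lim_seq_const|reflexivity].
Qed.

Definition dom (u : nat -> C) (c : R) : Prop := forall n, (Cmod (u n) <= c * inv_sq n)%R.

Definition Cseries (u : nat -> C) : C :=
  (Series (fun n => Re (u n)), Series (fun n => Im (u n))).

Lemma dom_ex u c : dom u c -> ex_series (fun n => Rabs (Re (u n))) /\ ex_series (fun n => Rabs (Im (u n))).
Proof.
  intros H.
  assert (K : ex_series (fun n => c * inv_sq n)%R) by exact (ex_series_scal c inv_sq ex_series_inv_sq).
  split; apply (ex_series_le (K := R_AbsRing) (V := R_CompleteNormedModule) _ (fun n => c * inv_sq n)%R); auto;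
    intros n; unfold norm; simpl; unfold abs; simpl; rewrite Rabs_Rabsolu.
  - eapply Rle_trans; [apply re_le_Cmod|apply H].
  - eapply Rle_trans; [apply im_le_Cmod|apply H].
Qed.

Lemma dom_ex' u c : dom u c -> ex_series (fun n => Re (u n)) /\ ex_series (fun n => Im (u n)).
Proof. intros H. destruct (dom_ex _ _ H). split; now apply ex_series_Rabs. Qed.

Lemma Cseries_plus u v c d : dom u c -> dom v d -> Cseries (fun n => u n + v n) = Cseries u + Cseries v.
Proof.
  intros Hu Hv. destruct (dom_ex' _ _ Hu), (dom_ex' _ _ Hv).
  apply C_ext; simpl; apply Series_plus; assumption.
Qed.

Lemma Cseries_scal k u c : dom u c -> Cseries (fun n => k * u n) = k * Cseries u.
Proof.
  intros Hu. destruct (dom_ex' _ _ Hu) as [H1 H2]. destruct k as [a b].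
  assert (S1 := ex_series_scal a _ H1). assert (S2 := ex_series_scal b _ H2).
  assert (S3 := ex_series_scal a _ H2). assert (S4 := ex_series_scal b _ H1).
  apply C_ext; simpl.
  - etransitivity; [exact (Series_minus _ _ S1 S2)|]. f_equal; apply Series_scal_l.
  - etransitivity; [exact (Series_plus _ _ S3 S4)|]. f_equal; apply Series_scal_l.
Qed.

Definition Bsum : R := (2 * Series inv_sq)%R.

Lemma Bsum_nonneg : (0 <= Bsum)%R.
Proof.
  assert (E : forall n, Rabs (inv_sq n) = inv_sq n) by (intros n; apply Rabs_pos_eq, Rlt_le, inv_sq_pos).
  pose proof (Series_Rabs inv_sq (ex_series_ext _ _ (fun n => eq_sym (E n)) ex_series_inv_sq)) as H.
  rewrite (Series_ext _ _ E) in H. pose proof (Rabs_pos (Series inv_sq)). unfold Bsum. lra.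
Qed.

Lemma Cseries_bound u c : dom u c -> (Cmod (Cseries u) <= c * Bsum)%R.
Proof.
  intros Hu. destruct (dom_ex _ _ Hu) as [H1 H2].
  replace (c * Bsum)%R with (2 * (c * Series inv_sq))%R by (unfold Bsum; ring).
  rewrite <- Series_scal_l.
  apply Cmod_le_parts; simpl.
  - eapply Rle_trans; [apply (Series_Rabs (fun n => Re (u n)) H1)|].
    apply Series_le; [|exact (ex_series_scal c inv_sq ex_series_inv_sq)].
    intros n; split; [apply Rabs_pos|]. eapply Rle_trans; [apply re_le_Cmod|apply Hu].
  - eapply Rle_trans; [apply (Series_Rabs (fun n => Im (u n)) H2)|].
    apply Series_le; [|exact (ex_series_scal c inv_sq ex_series_inv_sq)].
    intros n; split; [apply Rabs_pos|]. eapply Rle_trans; [apply im_le_Cmod|apply Hu].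
Qed.

Lemma Cseries_S u c : dom u c -> Cseries u = u 0%nat + Cseries (fun k => u (S k)).
Proof.
  intros Hu. destruct (dom_ex' _ _ Hu). apply C_ext; simpl; apply Series_incr_1; assumption.
Qed.

Lemma inv_sq_add N k : (inv_sq (N + k) <= inv_sq k)%R.
Proof.
  unfold inv_sq. apply Rinv_le_contravar; [apply pow_lt, INR1_pos|].
  apply pow_incr. rewrite plus_INR. pose proof (pos_INR N). pose proof (pos_INR k). lra.
Qed.

Lemma dom_shift u c N : (0 <= c)%R -> dom u c -> dom (fun k => u (N + k)%nat) c.
Proof.
  intros Hc H k. eapply Rle_trans; [apply H|]. apply Rmult_le_compat_l; [exact Hc|apply inv_sq_add].
Qed.

Lemma Cseries_split u c N : (0 <= c)%R -> dom u c ->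
  Cseries u = Csum (seq 0 N) u + Cseries (fun k => u (N + k)%nat).
Proof.
  intros Hc Hu. induction N as [|N IH].
  - change (Cseries u = 0 + Cseries u). ring.
  - rewrite IH, (Cseries_S _ c (dom_shift u c N Hc Hu)), seq_S, Csum_app. simpl (Csum (_ :: nil) _).
    rewrite Nat.add_0_r. replace (fun k => u (N + S k)%nat) with (fun k => u (S N + k)%nat); [ring|].
    apply functional_extensionality; intros k. f_equal. lia.
Qed.

(** One power more than the summable majorant [inv_sq]: after a shift by $N$ the spare power gives
    the factor $1/(N+1)$ that makes tails small. *)
Definition inv_cube (n : nat) : R := (/ (INR n + 1) ^ 3)%R.

Lemma inv_cube_inv_sq N k : (inv_cube (N + k) <= / (INR N + 1) * inv_sq k)%R.
Proof.
  unfold inv_cube, inv_sq. rewrite <- Rinv_mult.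
  pose proof (pos_INR N). pose proof (pos_INR k).
  apply Rinv_le_contravar.
  - apply Rmult_lt_0_compat; [lra|]. apply pow_lt; lra.
  - rewrite plus_INR.
    assert (INR k + 1 <= INR N + INR k + 1)%R by lra.
    assert ((INR k + 1) ^ 2 <= (INR N + INR k + 1) ^ 2)%R by (apply pow_incr; lra).
    replace ((INR N + INR k + 1) ^ 3)%R with ((INR N + INR k + 1) * (INR N + INR k + 1) ^ 2)%R by ring.
    apply Rmult_le_compat; try lra. apply pow2_ge_0.
Qed.

Lemma inv_cube_dom u c : (0 <= c)%R -> (forall n, (Cmod (u n) <= c * inv_cube n)%R) -> dom u c.
Proof.
  intros Hc H n. eapply Rle_trans; [apply H|]. apply Rmult_le_compat_l; [exact Hc|].
  pose proof (inv_cube_inv_sq 0 n) as K. simpl in K. rewrite Rplus_0_l, Rinv_1 in K. lra.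
Qed.

Lemma Cseries_tail u c N : (0 <= c)%R -> (forall n, (Cmod (u n) <= c * inv_cube n)%R) ->
  (Cmod (Cseries u - Csum (seq 0 N) u) <= c * / (INR N + 1) * Bsum)%R.
Proof.
  intros Hc H. rewrite (Cseries_split u c N Hc (inv_cube_dom u c Hc H)).
  replace (Csum (seq 0 N) u + Cseries (fun k => u (N + k)%nat) - Csum (seq 0 N) u) with
    (Cseries (fun k => u (N + k)%nat)) by ring.
  apply Cseries_bound. intros k. eapply Rle_trans; [apply H|]. rewrite Rmult_assoc.
  apply Rmult_le_compat_l; [exact Hc|apply inv_cube_inv_sq].
Qed.

(** * Rapid decay of the components of a smooth function *)

Definition Rop (F : fn) : fn := fadd F (fmul (fcst (- Ci)) (T F)).
Fixpoint Rit (k : nat) (F : fn) : fn := match k with O => F | S j => Rit j (Rop F) end.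

Definition wgt (n : nat) (M : fn) : Prop :=
  smooth M /\ T M = fmul (fcst (RtoC (INR n) * - Ci)) M.

Lemma smooth_Rop F : smooth F -> smooth (Rop F).
Proof. intros; unfold Rop; auto with sm. Qed.
Lemma smooth_Rit k F : smooth F -> smooth (Rit k F).
Proof. revert F; induction k; simpl; auto using smooth_Rop. Qed.

(** Integration by parts: $-iT$ on $F$ becomes $iT$ on $M$, which is multiplication by $n$. The
    identity added in [Rop] turns $n$ into $n+1$, so that the estimate is meaningful for $n=0$
    too. *)
Lemma sphere_int_Rop n F M : smooth F -> wgt n M -> sphere_int (fmul (Rop F) M) = (RtoC (INR n) + 1) * sphere_int (fmul F M).
Proof.
  intros HF [HM E].
  pose proof (sphere_int_T (fmul F M) ltac:(auto with sm)) as H.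
  rewrite (der_mul _ derivation_T), sphere_int_add in H by auto with sm. rewrite E in H.
  replace (fmul F (fmul (fcst (RtoC (INR n) * - Ci)) M)) with (fmul (fcst (RtoC (INR n) * - Ci)) (fmul F M)) in H by fcrush.
  rewrite sphere_int_scal in H by auto with sm.
  unfold Rop. replace (fmul (fadd F (fmul (fcst (- Ci)) (T F))) M) with
    (fadd (fmul F M) (fmul (fcst (- Ci)) (fmul (T F) M))) by fcrush.
  rewrite sphere_int_add, sphere_int_scal by auto with sm.
  transitivity (sphere_int (fmul F M) - Ci * (sphere_int (fmul (T F) M) + RtoC (INR n) * - Ci * sphere_int (fmul F M))
    - (Ci * Ci) * RtoC (INR n) * sphere_int (fmul F M)); [ring|].
  rewrite H, Ci_sq. ring.
Qed.

Lemma sphere_int_Rit n k F M : smooth F -> wgt n M ->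
  sphere_int (fmul (Rit k F) M) = RtoC ((INR n + 1) ^ k)%R * sphere_int (fmul F M).
Proof.
  intros HF HM. revert F HF; induction k as [|k IH]; intros F HF; simpl.
  - ring.
  - rewrite IH by now apply smooth_Rop. rewrite (sphere_int_Rop n) by assumption.
    rewrite RtoC_mult, RtoC_plus. ring.
Qed.

Lemma sphere_int_decay n k F M m : smooth F -> wgt n M -> (forall z w, onS3 z w -> (Cmod (M z w) <= m)%R) ->
  ((INR n + 1) ^ k * Cmod (sphere_int (fmul F M)) <= 2 * (m * nu (Rit k F)))%R.
Proof.
  intros HF HM Hm. pose proof (smooth_Rit k F HF).
  replace ((INR n + 1) ^ k * Cmod (sphere_int (fmul F M)))%R with (Cmod (sphere_int (fmul (Rit k F) M))).
  - apply sphere_int_bound; [auto with sm|exact (smooth_contF _ (proj1 HM))|exact Hm].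
  - rewrite (sphere_int_Rit n) by assumption. rewrite Cmod_mult, Cmod_R. f_equal. apply Rabs_pos_eq.
    apply pow_le, Rlt_le, INR1_pos.
Qed.

Definition polyg (lam : nat -> C) : Prop :=
  exists (L : R) (d : nat), (0 <= L)%R /\ forall n, (Cmod (lam n) <= L * (INR n + 1) ^ d)%R.

(** The constant depends neither on $n$ nor on the test function $M$. This uniformity is what allows
    $M$ to be a power of the kernel as well as a Taylor remainder of such a power. *)
Lemma term_bound lam F e : polyg lam -> smooth F -> exists K : R, (0 <= K)%R /\
  forall (n : nat) M m, wgt n M -> (0 <= m)%R ->
    (forall z w, onS3 z w -> (Cmod (M z w) <= m * (INR n + 1) ^ e)%R) ->
    (Cmod (lam n * sphere_int (fmul F M)) <= m * K * inv_cube n)%R.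
Proof.
  intros (L & d & HL & Hl) HF. set (k := (d + e + 3)%nat).
  pose proof (smooth_Rit k F HF) as HR. pose proof (nu_nonneg _ (smooth_contF _ HR)) as Hnu.
  exists (L * (2 * nu (Rit k F)))%R. split; [apply Rmult_le_pos; lra|].
  intros n M m HM Hm Hb. pose proof (sphere_int_decay n k F M _ HF HM Hb) as D.
  set (x := (INR n + 1)%R) in *. assert (Hx : (0 < x)%R) by apply INR1_pos.
  unfold inv_cube. fold x. rewrite Cmod_mult.
  pose proof (Hl n) as Hn. fold x in Hn. pose proof (Cmod_ge_0 (sphere_int (fmul F M))).
  pose proof (pow_lt x d Hx). pose proof (pow_lt x e Hx). pose proof (pow_lt x 3 Hx).
  eapply Rle_trans; [apply Rmult_le_compat_r; [assumption|exact Hn]|].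
  apply Rmult_le_reg_l with (x ^ e * x ^ 3)%R; [now apply Rmult_lt_0_compat|].
  replace (x ^ e * x ^ 3 * (L * x ^ d * Cmod (sphere_int (fmul F M))))%R with
    (L * (x ^ k * Cmod (sphere_int (fmul F M))))%R by (unfold k; rewrite !pow_add; ring).
  replace (x ^ e * x ^ 3 * (m * (L * (2 * nu (Rit k F))) * / x ^ 3))%R with
    (L * (2 * (m * x ^ e * nu (Rit k F))))%R by (field; lra).
  apply Rmult_le_compat_l; assumption.
Qed.

Lemma wgt_pow x y n : wgt n (fpow (szego_form x y) n).
Proof.
  split; [auto with sm|]. rewrite (derivation_pow T (szego_form x y) (- Ci)); auto with sm.
  rewrite (hom_T 0 1).
  - simpl INR. fcrush.
  - unfold szego_form. apply hom_add; apply hom_scal.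
    + replace fzb with (fmul fzb (fcst 1)) by fcrush. apply hom_zb. constructor.
    + replace fwb with (fmul fwb (fcst 1)) by fcrush. apply hom_wb. constructor.
Qed.

Lemma wgt_add n M N : wgt n M -> wgt n N -> wgt n (fadd M N).
Proof.
  intros [H1 E1] [H2 E2]. split; [auto with sm|].
  rewrite (der_add _ derivation_T), E1, E2 by assumption. fcrush.
Qed.

Lemma wgt_scal n c M : wgt n M -> wgt n (fmul (fcst c) M).
Proof.
  intros [H1 E1]. split; [auto with sm|].
  rewrite (der_scal _ _ _ derivation_T), E1 by assumption. fcrush.
Qed.

Lemma wgt_mul n k M N : wgt n M -> wgt k N -> wgt (n + k) (fmul M N).
Proof.
  intros [H1 E1] [H2 E2]. split; [auto with sm|].
  rewrite (der_mul _ derivation_T), E1, E2, plus_INR, RtoC_plus by assumption. fcrush.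
Qed.

Definition Ball (x y : C) : Prop := (Cmod x ^ 2 + Cmod y ^ 2 <= 1)%R.

Lemma szego_form_ball x y z w : Ball x y -> onS3 z w -> (Cmod (szego_form x y z w) <= 1)%R.
Proof.
  unfold Ball, onS3. intros HB HS. unfold szego_form, fadd, fmul, fcst, fzb, fwb, conjf, fz, fw.
  eapply Rle_trans; [apply Cmod_triangle|]. rewrite !Cmod_mult, !Cmod_conj.
  pose proof (pow2_ge_0 (Cmod x - Cmod z)). pose proof (pow2_ge_0 (Cmod y - Cmod w)). nra.
Qed.

Lemma szego_form_small x y z w : onS3 z w -> (Cmod (szego_form x y z w) <= Cmod x + Cmod y)%R.
Proof.
  unfold onS3. intros HS. unfold szego_form, fadd, fmul, fcst, fzb, fwb, conjf, fz, fw.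
  eapply Rle_trans; [apply Cmod_triangle|]. rewrite !Cmod_mult, !Cmod_conj.
  pose proof (Cmod_ge_0 x). pose proof (Cmod_ge_0 y). pose proof (Cmod_ge_0 z). pose proof (Cmod_ge_0 w).
  assert (Cmod z <= 1)%R by nra. assert (Cmod w <= 1)%R by nra. nra.
Qed.

Lemma Cmod_Cpow x n : Cmod (Cpow x n) = (Cmod x ^ n)%R.
Proof. induction n; simpl; [apply Cmod_1|]. now rewrite Cmod_mult, IHn. Qed.

Lemma Cmod_Cpow_le1 x n : (Cmod x <= 1)%R -> (Cmod (Cpow x n) <= 1)%R.
Proof.
  intros H. rewrite Cmod_Cpow. rewrite <- (pow1 n). apply pow_incr. split; [apply Cmod_ge_0|exact H].
Qed.

Definition Dpow (X V : C) (n : nat) : C :=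
  match n with O => 0 | S m => RtoC (INR n) * (V * Cpow X m) end.

Lemma pow_taylor X Y n : (Cmod X <= 1)%R -> (Cmod Y <= 1)%R ->
  (Cmod (Cpow X n - Cpow Y n - Dpow Y (X - Y) n) <= INR n ^ 2 * Cmod (X - Y) ^ 2)%R.
Proof.
  intros HX HY. induction n as [|n IH].
  - simpl. replace (1 - 1 - 0) with (RtoC 0) by ring. rewrite Cmod_0. simpl. lra.
  - assert (E : Cpow X (S n) - Cpow Y (S n) - Dpow Y (X - Y) (S n)
      = X * (Cpow X n - Cpow Y n - Dpow Y (X - Y) n) + (X - Y) * Dpow Y (X - Y) n).
    { destruct n as [|n].
      - simpl. ring.
      - unfold Dpow. rewrite (S_INR (S n)), RtoC_plus. simpl Cpow. ring. }
    rewrite E. eapply Rle_trans; [apply Cmod_triangle|]. rewrite !Cmod_mult.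
    set (r := Cmod (X - Y)) in *. assert (Hr : (0 <= r)%R) by apply Cmod_ge_0.
    assert (B : (Cmod (Dpow Y (X - Y) n) <= INR n * r)%R).
    { destruct n as [|n]; unfold Dpow; [rewrite Cmod_0; simpl; lra|].
      rewrite !Cmod_mult, Cmod_R, Rabs_pos_eq by apply pos_INR. fold r.
      apply Rmult_le_compat_l; [apply pos_INR|].
      pose proof (Cmod_Cpow_le1 Y n HY). rewrite <- (Rmult_1_r r) at 2. now apply Rmult_le_compat_l. }
    pose proof (Cmod_ge_0 (Cpow X n - Cpow Y n - Dpow Y (X - Y) n)) as H0.
    set (c := Cmod (Cpow X n - Cpow Y n - Dpow Y (X - Y) n)) in *.
    assert (Cmod X * c <= 1 * c)%R by (apply Rmult_le_compat_r; assumption).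
    assert (r * Cmod (Dpow Y (X - Y) n) <= r * (INR n * r))%R by (apply Rmult_le_compat_l; assumption).
    rewrite S_INR. pose proof (pos_INR n). nra.
Qed.

Definition hol_series (lam : nat -> C) (F : fn) (x y : C) : C := Cseries (fun n => lam n * hol_comp F n x y).
Definition shift_coef (lam : nat -> C) (n : nat) : C := RtoC (INR (S n)) * lam (S n).

Lemma polyg_shift_coef lam : polyg lam -> polyg (shift_coef lam).
Proof.
  intros (L & d & HL & H). exists (L * 2 ^ S d)%R, (S d). split.
  - apply Rmult_le_pos; [exact HL|]. apply pow_le; lra.
  - intros n. unfold shift_coef. rewrite Cmod_mult, Cmod_R, Rabs_pos_eq by apply pos_INR.
    specialize (H (S n)). rewrite Rmult_assoc, <- Rpow_mult_distr.
    pose proof (pos_INR n). rewrite S_INR in *.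
    assert (P1 : ((INR n + 1 + 1) ^ d <= (2 * (INR n + 1)) ^ d)%R) by (apply pow_incr; lra).
    assert (P0 : (0 <= (INR n + 1 + 1) ^ d)%R) by (apply pow_le; lra).
    simpl ((2 * (INR n + 1)) ^ S d)%R.
    apply Rle_trans with ((INR n + 1) * (L * (2 * (INR n + 1)) ^ d))%R.
    + apply Rmult_le_compat_l; [lra|]. eapply Rle_trans; [exact H|]. now apply Rmult_le_compat_l.
    + assert (0 <= L * (2 * (INR n + 1)) ^ d)%R by (apply Rmult_le_pos; lra).
      replace (L * (2 * (INR n + 1) * (2 * (INR n + 1)) ^ d))%R with
        (2 * ((INR n + 1) * (L * (2 * (INR n + 1)) ^ d)))%R by ring.
      assert (0 <= (INR n + 1) * (L * (2 * (INR n + 1)) ^ d))%R by (apply Rmult_le_pos; lra). lra.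
Qed.

Lemma hol_series_terms lam F : polyg lam -> smooth F -> exists K : R, (0 <= K)%R /\
  forall x y, Ball x y -> forall n, (Cmod (lam n * hol_comp F n x y) <= K * inv_cube n)%R.
Proof.
  intros Hl HF. destruct (term_bound lam F 0 Hl HF) as (K & HK & H). exists K. split; [exact HK|].
  intros x y HB n. replace K with (1 * K)%R by ring. apply (H n (fpow (szego_form x y) n) 1%R); [apply wgt_pow|lra|].
  intros z w Hz. rewrite fpow_val. simpl. rewrite Rmult_1_r. apply Cmod_Cpow_le1. now apply szego_form_ball.
Qed.

Definition Dk (x y v1 v2 : C) (n : nat) : fn :=
  match n with O => fcst 0 | S m => fmul (fcst (RtoC (INR n))) (fmul (szego_form v1 v2) (fpow (szego_form x y) m)) end.

Lemma Dk_val x y v1 v2 n z w : Dk x y v1 v2 n z w = Dpow (szego_form x y z w) (szego_form v1 v2 z w) n.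
Proof. destruct n; unfold Dk, Dpow, fmul, fcst; [reflexivity|]. now rewrite fpow_val. Qed.

Lemma wgt_Dk x y v1 v2 n : wgt n (Dk x y v1 v2 n).
Proof.
  destruct n as [|n]; unfold Dk.
  - split; [auto with sm|]. rewrite (der_cst _ derivation_T). fcrush.
  - apply wgt_scal. change (S n) with (1 + n)%nat. apply wgt_mul; [|apply wgt_pow].
    pose proof (wgt_pow v1 v2 1) as H. simpl in H.
    replace (fmul (szego_form v1 v2) (fcst 1)) with (szego_form v1 v2) in H by fcrush. exact H.
Qed.

Lemma sphere_int_Dk F x y v1 v2 n : smooth F -> sphere_int (fmul F (Dk x y v1 v2 (S n))) =
  RtoC (INR (S n)) * (v1 * hol_comp (fmul F fzb) n x y + v2 * hol_comp (fmul F fwb) n x y).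
Proof.
  intros HF. unfold hol_comp, Dk.
  rewrite <- (sphere_int_scal v1), <- (sphere_int_scal v2), <- sphere_int_add, <- sphere_int_scal by auto 10 with sm.
  f_equal. unfold szego_form at 1. fcrush.
Qed.

Lemma hol_series_taylor lam F : polyg lam -> smooth F -> exists K : R, (0 <= K)%R /\
  forall x y x' y', Ball x y -> Ball x' y' ->
  (Cmod (hol_series lam F x' y' - hol_series lam F x y - ((x' - x) * hol_series (shift_coef lam) (fmul F fzb) x y
     + (y' - y) * hol_series (shift_coef lam) (fmul F fwb) x y)) <= K * (Cmod (x' - x) + Cmod (y' - y)) ^ 2)%R.
Proof.
  intros Hl HF.
  destruct (term_bound lam F 2 Hl HF) as (K & HK & HT).
  destruct (hol_series_terms lam F Hl HF) as (K0 & HK0 & H0).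
  assert (SFz : smooth (fmul F fzb)) by auto with sm.
  assert (SFw : smooth (fmul F fwb)) by auto with sm.
  destruct (hol_series_terms (shift_coef lam) _ (polyg_shift_coef _ Hl) SFz) as (K1 & HK1 & H1).
  destruct (hol_series_terms (shift_coef lam) _ (polyg_shift_coef _ Hl) SFw) as (K2 & HK2 & H2).
  pose proof Bsum_nonneg as HB0.
  exists (K * Bsum)%R. split; [now apply Rmult_le_pos|].
  intros x y x' y' HB HB'. set (v1 := x' - x). set (v2 := y' - y).
  set (r := (Cmod v1 + Cmod v2)%R).
  assert (Hr : (0 <= r)%R) by (pose proof (Cmod_ge_0 v1); pose proof (Cmod_ge_0 v2); unfold r; lra).
  set (M := fun n => fadd (fpow (szego_form x' y') n) (fadd (fmul (fcst (-(1))) (fpow (szego_form x y) n))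
     (fmul (fcst (-(1))) (Dk x y v1 v2 n)))).
  set (u' := fun n => lam n * hol_comp F n x' y'). set (u := fun n => lam n * hol_comp F n x y).
  set (d := fun n => lam n * sphere_int (fmul F (Dk x y v1 v2 n))).
  set (m := fun n => lam n * sphere_int (fmul F (M n))).
  assert (HM : forall n, (Cmod (m n) <= r ^ 2 * K * inv_cube n)%R).
  { intros n. apply HT; [|apply pow2_ge_0|].
    - apply wgt_add; [apply wgt_pow|]. apply wgt_add; apply wgt_scal; [apply wgt_pow|apply wgt_Dk].
    - intros z w Hz. unfold M, fadd, fmul, fcst. rewrite Dk_val, !fpow_val.
      pose proof (szego_form_ball x y z w HB Hz) as B1. pose proof (szego_form_ball x' y' z w HB' Hz) as B2.
      assert (EV : szego_form v1 v2 z w = szego_form x' y' z w - szego_form x y z w).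
      { unfold v1, v2, szego_form, fadd, fmul, fcst. ring. }
      pose proof (pow_taylor _ _ n B2 B1) as Q. rewrite <- EV in Q.
      replace (Cpow (szego_form x' y' z w) n + (- (1) * Cpow (szego_form x y z w) n + - (1) * Dpow (szego_form x y z w) (szego_form v1 v2 z w) n))
        with (Cpow (szego_form x' y' z w) n - Cpow (szego_form x y z w) n - Dpow (szego_form x y z w) (szego_form v1 v2 z w) n) by ring.
      eapply Rle_trans; [exact Q|]. rewrite Rmult_comm.
      pose proof (szego_form_small v1 v2 z w Hz) as B3. fold r in B3. pose proof (Cmod_ge_0 (szego_form v1 v2 z w)).
      pose proof (pos_INR n). apply Rmult_le_compat; try apply pow2_ge_0; apply pow_incr; lra. }
  assert (Du' : dom u' K0) by (apply inv_cube_dom; [exact HK0|]; intros n; now apply H0).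
  assert (Du : dom u K0) by (apply inv_cube_dom; [exact HK0|]; intros n; now apply H0).
  assert (Hr2 : (0 <= r ^ 2 * K)%R) by (apply Rmult_le_pos; [apply pow2_ge_0|exact HK]).
  assert (Dm : dom m (r ^ 2 * K)) by (apply inv_cube_dom; [exact Hr2|exact HM]).
  assert (Em : forall n, u' n = u n + (d n + m n)).
  { intros n. unfold u', u, d, m, M, hol_comp.
    replace (fmul F (fadd (fpow (szego_form x' y') n) (fadd (fmul (fcst (-(1))) (fpow (szego_form x y) n)) (fmul (fcst (-(1))) (Dk x y v1 v2 n)))))
      with (fadd (fmul F (fpow (szego_form x' y') n)) (fadd (fmul (fcst (-(1))) (fmul F (fpow (szego_form x y) n)))
        (fmul (fcst (-(1))) (fmul F (Dk x y v1 v2 n))))) by fcrush.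
    pose proof (smooth_contF _ (proj1 (wgt_Dk x y v1 v2 n))).
    rewrite !sphere_int_add, !sphere_int_scal by auto 10 with sm. ring. }
  assert (Dd : dom d (K0 + (K0 + r ^ 2 * K))).
  { intros n. replace (d n) with (u' n + (- u n + - m n)) by (rewrite Em; ring).
    eapply Rle_trans; [apply Cmod_triangle|]. rewrite Rmult_plus_distr_r.
    apply Rplus_le_compat; [apply Du'|]. eapply Rle_trans; [apply Cmod_triangle|].
    rewrite !Cmod_opp, Rmult_plus_distr_r. apply Rplus_le_compat; [apply Du|apply Dm]. }
  assert (Sd : Cseries d = v1 * hol_series (shift_coef lam) (fmul F fzb) x y + v2 * hol_series (shift_coef lam) (fmul F fwb) x y).
  { rewrite (Cseries_S d _ Dd). unfold d at 1. simpl Dk.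
    replace (fmul F (fcst 0)) with (fmul (fcst 0) F) by fcrush. rewrite sphere_int_scal by auto with sm.
    unfold hol_series.
    assert (D1 : dom (fun n => shift_coef lam n * hol_comp (fmul F fzb) n x y) K1) by (apply inv_cube_dom; [exact HK1|]; intros n; now apply H1).
    assert (D2 : dom (fun n => shift_coef lam n * hol_comp (fmul F fwb) n x y) K2) by (apply inv_cube_dom; [exact HK2|]; intros n; now apply H2).
    rewrite <- (Cseries_scal v1 _ _ D1), <- (Cseries_scal v2 _ _ D2).
    assert (D1' : dom (fun n => v1 * (shift_coef lam n * hol_comp (fmul F fzb) n x y)) (Cmod v1 * K1)).
    { intros n. rewrite Cmod_mult, Rmult_assoc. apply Rmult_le_compat_l; [apply Cmod_ge_0|apply D1]. }
    assert (D2' : dom (fun n => v2 * (shift_coef lam n * hol_comp (fmul F fwb) n x y)) (Cmod v2 * K2)).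
    { intros n. rewrite Cmod_mult, Rmult_assoc. apply Rmult_le_compat_l; [apply Cmod_ge_0|apply D2]. }
    rewrite <- (Cseries_plus _ _ _ _ D1' D2').
    rewrite Cmult_0_l, Cmult_0_r, Cplus_0_l. f_equal. apply functional_extensionality; intros n.
    unfold d. rewrite sphere_int_Dk by exact HF. unfold shift_coef. ring. }
  assert (Dd' : dom (fun n => d n + m n) (K0 + (K0 + r ^ 2 * K) + r ^ 2 * K)).
  { intros n. eapply Rle_trans; [apply Cmod_triangle|]. rewrite (Rmult_plus_distr_r (K0 + _)).
    apply Rplus_le_compat; [apply Dd|apply Dm]. }
  assert (Eu : hol_series lam F x' y' = hol_series lam F x y + (Cseries d + Cseries m)).
  { unfold hol_series. change (Cseries u' = Cseries u + (Cseries d + Cseries m)).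
    rewrite <- (Cseries_plus _ _ _ _ Dd Dm), <- (Cseries_plus _ _ _ _ Du Dd'). f_equal.
    apply functional_extensionality; intros n. apply Em. }
  rewrite Eu, <- Sd.
  replace (hol_series lam F x y + (Cseries d + Cseries m) - hol_series lam F x y - Cseries d) with (Cseries m) by ring.
  eapply Rle_trans; [apply (Cseries_bound m _ Dm)|]. lra.
Qed.

Lemma is_derive_quad (f : R -> R) t c : f t = 0%R ->
  (exists d : posreal, forall s, (Rabs (s - t) < d)%R -> (Rabs (f s) <= c * (s - t) ^ 2)%R) ->
  is_derive f t 0%R.
Proof.
  intros H0 [d Hd]. apply is_derive_Reals. intros eps Heps.
  set (k := (eps / (Rabs c + 1))%R).
  assert (Hk : (0 < k)%R) by (apply Rdiv_lt_0_compat; [exact Heps|pose proof (Rabs_pos c); lra]).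
  assert (Hm : (0 < Rmin d k)%R) by (apply Rmin_pos; [apply cond_pos|exact Hk]).
  exists (mkposreal _ Hm). simpl. intros h Hh0 Hh.
  pose proof (Rmin_l d k). pose proof (Rmin_r d k).
  rewrite H0, !Rminus_0_r. unfold Rdiv. rewrite Rabs_mult, Rabs_inv.
  pose proof (Rabs_pos_lt h Hh0) as Hp.
  apply Rmult_lt_reg_r with (Rabs h); [exact Hp|]. rewrite Rmult_assoc, Rinv_l, Rmult_1_r by lra.
  eapply Rle_lt_trans; [apply Hd; replace (t + h - t)%R with h by ring; lra|].
  replace (t + h - t)%R with h by ring. rewrite <- (Rabs_pos_eq (h ^ 2)) by apply pow2_ge_0.
  rewrite <- RPow_abs. pose proof (Rle_abs c). pose proof (Rabs_pos c).
  assert (E : (k * (Rabs c + 1) = eps)%R) by (unfold k; field; lra). rewrite <- E.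
  replace (c * Rabs h ^ 2)%R with (Rabs h * (c * Rabs h))%R by ring.
  replace (k * (Rabs c + 1) * Rabs h)%R with (Rabs h * (k * (Rabs c + 1)))%R by ring.
  apply Rmult_lt_compat_l; [exact Hp|]. nra.
Qed.

Lemma is_derive_lip (f : R -> R) t l : is_derive f t l ->
  exists d : posreal, forall s, (Rabs (s - t) < d)%R -> (Rabs (f s - f t) <= (Rabs l + 1) * Rabs (s - t))%R.
Proof.
  intros H. apply is_derive_Reals in H. destruct (H 1%R Rlt_0_1) as [d Hd]. exists d.
  intros s Hs. destruct (Req_dec s t) as [->|Hn].
  - replace (f t - f t)%R with 0%R by ring. rewrite Rabs_R0.
    apply Rmult_le_pos; [pose proof (Rabs_pos l); lra|apply Rabs_pos].
  - assert (Hh : (s - t <> 0)%R) by lra. specialize (Hd (s - t)%R Hh Hs).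
    replace (t + (s - t))%R with s in Hd by ring.
    assert (E : (f s - f t = (f s - f t) / (s - t) * (s - t))%R) by (field; exact Hh).
    rewrite E, Rabs_mult. apply Rmult_le_compat_r; [apply Rabs_pos|].
    replace ((f s - f t) / (s - t))%R with (((f s - f t) / (s - t) - l) + l)%R by ring.
    eapply Rle_trans; [apply Rabs_triang|]. lra.
Qed.

Lemma Cmod_le_sum c : (Cmod c <= Rabs (Re c) + Rabs (Im c))%R.
Proof.
  replace c with (RtoC (Re c) + Ci * RtoC (Im c)) at 1 by (apply C_ext; simpl; ring).
  eapply Rle_trans; [apply Cmod_triangle|]. rewrite Cmod_mult, Cmod_Ci, !Cmod_R. lra.
Qed.

Lemma is_dR_lip g t l : is_dR g t l -> exists (c : R) (d : posreal), (0 <= c)%R /\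
  forall s, (Rabs (s - t) < d)%R -> (Cmod (g s - g t) <= c * Rabs (s - t))%R.
Proof.
  intros [H1 H2]. destruct (is_derive_lip _ _ _ H1) as [d1 D1]. destruct (is_derive_lip _ _ _ H2) as [d2 D2].
  exists ((Rabs (Re l) + 1) + (Rabs (Im l) + 1))%R.
  assert (Hm : (0 < Rmin d1 d2)%R) by (apply Rmin_pos; apply cond_pos).
  exists (mkposreal _ Hm). simpl. pose proof (Rabs_pos (Re l)). pose proof (Rabs_pos (Im l)).
  split; [lra|]. intros s Hs. pose proof (Rmin_l d1 d2). pose proof (Rmin_r d1 d2).
  specialize (D1 s ltac:(lra)). specialize (D2 s ltac:(lra)).
  eapply Rle_trans; [apply Cmod_le_sum|]. rewrite Rmult_plus_distr_r. apply Rplus_le_compat; assumption.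
Qed.

Lemma is_dR_quad (g : R -> C) t c : g t = 0 ->
  (exists d : posreal, forall s, (Rabs (s - t) < d)%R -> (Cmod (g s) <= c * (s - t) ^ 2)%R) ->
  is_dR g t 0.
Proof.
  intros H0 [d Hd]. split.
  - apply is_derive_quad with c; [now rewrite H0|]. exists d. intros s Hs.
    eapply Rle_trans; [apply re_le_Cmod|auto].
  - apply is_derive_quad with c; [now rewrite H0|]. exists d. intros s Hs.
    eapply Rle_trans; [apply im_le_Cmod|auto].
Qed.

Lemma hol_series_chain lam F (a b : R -> C) t a' b' : polyg lam -> smooth F ->
  (forall s, Ball (a s) (b s)) -> is_dR a t a' -> is_dR b t b' ->
  is_dR (fun s => hol_series lam F (a s) (b s)) t
    (a' * hol_series (shift_coef lam) (fmul F fzb) (a t) (b t) + b' * hol_series (shift_coef lam) (fmul F fwb) (a t) (b t)).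
Proof.
  intros Hl HF HB Ha Hb. destruct (hol_series_taylor lam F Hl HF) as (K & HK & HT).
  set (g1 := hol_series (shift_coef lam) (fmul F fzb) (a t) (b t)). set (g2 := hol_series (shift_coef lam) (fmul F fwb) (a t) (b t)).
  set (D := fun s => hol_series lam F (a s) (b s) - hol_series lam F (a t) (b t) - ((a s - a t) * g1 + (b s - b t) * g2)).
  assert (HD : is_dR D t 0).
  { destruct (is_dR_lip _ _ _ Ha) as (c1 & d1 & C1 & D1). destruct (is_dR_lip _ _ _ Hb) as (c2 & d2 & C2 & D2).
    apply is_dR_quad with (K * (c1 + c2) ^ 2)%R.
    - unfold D. ring.
    - assert (Hm : (0 < Rmin d1 d2)%R) by (apply Rmin_pos; apply cond_pos).
      exists (mkposreal _ Hm). simpl pos. intros s Hs. pose proof (Rmin_l d1 d2). pose proof (Rmin_r d1 d2).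
      specialize (D1 s ltac:(lra)). specialize (D2 s ltac:(lra)).
      eapply Rle_trans; [apply (HT _ _ _ _ (HB t) (HB s))|]. rewrite Rmult_assoc.
      apply Rmult_le_compat_l; [exact HK|].
      rewrite <- (Rabs_pos_eq ((s - t) ^ 2)), <- RPow_abs, <- Rpow_mult_distr by apply pow2_ge_0.
      apply pow_incr. pose proof (Cmod_ge_0 (a s - a t)). pose proof (Cmod_ge_0 (b s - b t)). lra. }
  eapply is_dR_eq.
  - apply is_dR_ext with (f := fun s => (hol_series lam F (a t) (b t) - (a t * g1 + b t * g2)) + ((a s * g1 + b s * g2) + D s)).
    + intros s. unfold D. ring.
    + exact (is_dR_plus _ _ _ _ _ (is_dR_const _ t) (is_dR_plus _ _ _ _ _ (is_dR_plus _ _ _ _ _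
        (is_dR_mult _ _ _ _ _ Ha (is_dR_const g1 t)) (is_dR_mult _ _ _ _ _ Hb (is_dR_const g2 t))) HD)).
  - cbv beta. ring.
Qed.

(* The map [x -> exp ((1 - |x|^2) / 2) x] sends [C^2] into the closed unit ball, since
   [r^2 exp (1 - r^2) <= 1], and restricts to the identity on the sphere. *)
Definition sfac : fn := fexp (fmul (fcst (/ 2)) (fadd (fcst 1) (fmul (fcst (-(1))) r2))).
Definition Psi1 : fn := fmul sfac fz.
Definition Psi2 : fn := fmul sfac fw.

Lemma smooth_sfac : smooth sfac.
Proof. apply smooth_fexp. auto with sm. Qed.
Lemma smooth_Psi1 : smooth Psi1.
Proof. apply smooth_mul; [apply smooth_sfac|auto with sm]. Qed.
Lemma smooth_Psi2 : smooth Psi2.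
Proof. apply smooth_mul; [apply smooth_sfac|auto with sm]. Qed.

Lemma sfac_val z w : sfac z w = RtoC (exp ((1 - (Cmod z ^ 2 + Cmod w ^ 2)) / 2)).
Proof.
  unfold sfac, fexp. f_equal. f_equal. unfold fmul, fadd, fcst, r2, fadd, fmul, fzb, fwb, conjf, fz, fw.
  rewrite <- !Cmod2_conj. simpl. field.
Qed.

Lemma Psi_ball z w : Ball (Psi1 z w) (Psi2 z w).
Proof.
  unfold Ball, Psi1, Psi2, fmul. rewrite sfac_val. unfold fz, fw. rewrite !Cmod_mult, !Cmod_R.
  set (r := (Cmod z ^ 2 + Cmod w ^ 2)%R).
  rewrite Rabs_pos_eq by apply Rlt_le, exp_pos.
  replace ((exp ((1 - r) / 2) * Cmod z) ^ 2 + (exp ((1 - r) / 2) * Cmod w) ^ 2)%R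
    with ((exp ((1 - r) / 2) * exp ((1 - r) / 2)) * r)%R by (unfold r; ring).
  rewrite <- exp_plus. replace ((1 - r) / 2 + (1 - r) / 2)%R with (- (r - 1))%R by field.
  rewrite exp_Ropp. pose proof (exp_ineq1_le (r - 1)). pose proof (exp_pos (r - 1)).
  apply Rmult_le_reg_l with (exp (r - 1)); [assumption|]. rewrite <- Rmult_assoc, Rinv_r by lra. lra.
Qed.

Lemma Psi_onS3 z w : onS3 z w -> Psi1 z w = z /\ Psi2 z w = w.
Proof.
  unfold onS3, Psi1, Psi2, fmul. intros H. rewrite sfac_val, H. replace ((1 - 1) / 2)%R with 0%R by field.
  rewrite exp_0. unfold fz, fw. split; ring.
Qed.

Definition hol_ext (lam : nat -> C) (F : fn) : fn := fun z w => hol_series lam F (Psi1 z w) (Psi2 z w).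

Lemma hol_ext_dir lam F v : polyg lam -> smooth F -> forall z w,
  is_dR (fun t => hol_ext lam F (z + RtoC t * fst v) (w + RtoC t * snd v)) 0
   (fadd (fmul (dir v Psi1) (hol_ext (shift_coef lam) (fmul F fzb))) (fmul (dir v Psi2) (hol_ext (shift_coef lam) (fmul F fwb))) z w).
Proof.
  intros Hl HF z w.
  pose proof (hol_series_chain lam F (fun t => Psi1 (z + RtoC t * fst v) (w + RtoC t * snd v))
    (fun t => Psi2 (z + RtoC t * fst v) (w + RtoC t * snd v)) 0%R _ _ Hl HF (fun s => Psi_ball _ _)
    (smooth_diffF _ smooth_Psi1 v z w) (smooth_diffF _ smooth_Psi2 v z w)) as H.
  cbv beta in H. rewrite !line_0 in H. exact H.
Qed.

Lemma continuous_of_bound {U : UniformSpace} (h : U -> C) (b : U -> R) p :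
  (forall q, (Cmod (h q - h p) <= b q)%R) -> continuous b p -> b p = 0%R -> continuous h p.
Proof.
  intros H Hb H0.
  assert (K : forall pr : C -> R, (forall c d, (Rabs (pr c - pr d) <= Cmod (c - d))%R) ->
     continuous (fun q => pr (h q)) p).
  { intros pr Hpr P [eps HP].
    assert (L : locally (b p) (fun v => (v < eps)%R)).
    { exists eps. intros v Hv. change (Rabs (v - b p) < eps)%R in Hv. rewrite H0 in Hv.
      apply Rabs_lt_between in Hv. lra. }
    pose proof (Hb _ L) as LB. unfold filtermap in *.
    revert LB. apply filter_imp. intros q Hq. apply HP.
    change (Rabs (pr (h q) - pr (h p)) < eps)%R.
    eapply Rle_lt_trans; [apply Hpr|]. eapply Rle_lt_trans; [apply H|exact Hq]. }
  apply continuous_C.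
  - apply (K Re). intros c d. replace (Re c - Re d)%R with (Re (c - d)) by reflexivity. apply re_le_Cmod.
  - apply (K Im). intros c d. replace (Im c - Im d)%R with (Im (c - d)) by reflexivity. apply im_le_Cmod.
Qed.

Lemma hol_ext_contF lam F : polyg lam -> smooth F -> contF (hol_ext lam F).
Proof.
  intros Hl HF z w. destruct (hol_series_taylor lam F Hl HF) as (K & HK & HT).
  set (g1 := hol_series (shift_coef lam) (fmul F fzb) (Psi1 z w) (Psi2 z w)).
  set (g2 := hol_series (shift_coef lam) (fmul F fwb) (Psi1 z w) (Psi2 z w)).
  set (e1 := fun q : C * C => Cmod (Psi1 (fst q) (snd q) + - Psi1 z w)).
  set (e2 := fun q : C * C => Cmod (Psi2 (fst q) (snd q) + - Psi2 z w)).
  assert (Z : forall x : C, Cmod (x + - x) = 0%R) by (intros x; replace (x + - x) with (RtoC 0) by ring; apply Cmod_0).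
  assert (E1 : continuous e1 (z, w)).
  { exact (continuous_Cmod _ _ (continuous_Cplus _ _ _ (smooth_contF _ smooth_Psi1 z w) (continuous_const _ _))). }
  assert (E2 : continuous e2 (z, w)).
  { exact (continuous_Cmod _ _ (continuous_Cplus _ _ _ (smooth_contF _ smooth_Psi2 z w) (continuous_const _ _))). }
  pose proof (continuous_Rplus _ _ _ E1 E2) as E12.
  apply (continuous_of_bound (fun p => hol_ext lam F (fst p) (snd p))
    (fun q => (e1 q * Cmod g1 + e2 q * Cmod g2) + K * ((e1 q + e2 q) * (e1 q + e2 q)))%R).
  - intros q. unfold hol_ext. simpl fst; simpl snd.
    pose proof (HT _ _ _ _ (Psi_ball z w) (Psi_ball (fst q) (snd q))) as T0.
    fold g1 g2 in T0. change (Cmod (Psi1 (fst q) (snd q) - Psi1 z w)) with (e1 q) in T0.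
    change (Cmod (Psi2 (fst q) (snd q) - Psi2 z w)) with (e2 q) in T0.
    set (d1 := Psi1 (fst q) (snd q) - Psi1 z w) in *. set (d2 := Psi2 (fst q) (snd q) - Psi2 z w) in *.
    set (Gq := hol_series lam F (Psi1 (fst q) (snd q)) (Psi2 (fst q) (snd q))) in *.
    set (G0 := hol_series lam F (Psi1 z w) (Psi2 z w)) in *.
    assert (B : (Cmod (Gq - G0) <= (e1 q * Cmod g1 + e2 q * Cmod g2) + K * ((e1 q + e2 q) * (e1 q + e2 q)))%R).
    { replace (Gq - G0) with ((d1 * g1 + d2 * g2) + (Gq - G0 - (d1 * g1 + d2 * g2))) by ring.
      eapply Rle_trans; [apply Cmod_triangle|]. apply Rplus_le_compat.
      - eapply Rle_trans; [apply Cmod_triangle|]. rewrite !Cmod_mult. apply Rle_refl.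
      - eapply Rle_trans; [exact T0|]. right. ring. }
    exact B.
  - apply continuous_Rplus; [apply continuous_Rplus|].
    + exact (continuous_Rmult _ _ _ E1 (continuous_const _ _)).
    + exact (continuous_Rmult _ _ _ E2 (continuous_const _ _)).
    + exact (continuous_Rmult _ _ _ (continuous_const _ _) (continuous_Rmult _ _ _ E12 E12)).
  - unfold e1, e2. simpl fst; simpl snd. rewrite !Z. ring.
Qed.

Lemma smooth_hol_ext lam F : polyg lam -> smooth F -> smooth (hol_ext lam F).
Proof.
  intros Hl0 HF0.
  apply gen_smooth with (B := fun H => smooth H \/ exists lam F, polyg lam /\ smooth F /\ H = hol_ext lam F).
  2: { apply gen_base. right. exists lam, F. auto. }
  clear lam F Hl0 HF0. intros H [HS|(lam & F & Hl & HF & ->)].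
  - split; [now apply smooth_diffF|split; [now apply smooth_contF|]].
    intros v. apply gen_base. left. now apply smooth_dir.
  - assert (E : forall v, dir v (hol_ext lam F) = fadd (fmul (dir v Psi1) (hol_ext (shift_coef lam) (fmul F fzb)))
       (fmul (dir v Psi2) (hol_ext (shift_coef lam) (fmul F fwb)))).
    { intros v. apply fext; intros z w. apply is_dR_unique. now apply hol_ext_dir. }
    split; [|split].
    + intros v z w. rewrite E. now apply hol_ext_dir.
    + now apply hol_ext_contF.
    + intros v. rewrite E.
      assert (SB : forall x, smooth x -> gen (fun H => smooth H \/ exists lam F, polyg lam /\ smooth F /\ H = hol_ext lam F)
         (hol_ext (shift_coef lam) (fmul F x))).
      { intros x Hx. apply gen_base. right. exists (shift_coef lam), (fmul F x).
        split; [now apply polyg_shift_coef|]. split; [auto with sm|reflexivity]. }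
      apply gen_add; apply gen_mul; try (apply SB; auto with sm); apply gen_base; left;
        apply smooth_dir; [apply smooth_Psi1|apply smooth_Psi2].
Qed.

Lemma Ball_onS3 z w : onS3 z w -> Ball z w.
Proof. intros H. unfold Ball. rewrite H. lra. Qed.

Lemma ip_hol_ext lam F P p : polyg lam -> smooth F -> contF P ->
  (forall n, n <> p -> ip (hol_comp F n) P = 0) -> ip (hol_ext lam F) P = lam p * ip (hol_comp F p) P.
Proof.
  intros Hl HF HP Ho. destruct (hol_series_terms lam F Hl HF) as (K & HK & HT).
  pose proof Bsum_nonneg as HB. pose proof (smooth_hol_ext lam F Hl HF) as SG.
  assert (SH : forall n, smooth (hol_comp F n)).
  { intros n. exact (smooth_hom _ _ _ (hol_comp_hom F n (smooth_contF _ HF))). }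
  set (SN := fun N z w => Csum (seq 0 N) (fun n => fmul (fcst (lam n)) (hol_comp F n) z w)).
  assert (CN : forall N, contF (SN N)).
  { intros N. apply (contF_Csum (seq 0 N) (fun n => fmul (fcst (lam n)) (hol_comp F n))). intros n. auto with sm. }
  assert (IN : forall N, (p < N)%nat -> ip (SN N) P = lam p * ip (hol_comp F p) P).
  { intros N HN. rewrite ip_sphere_int.
    replace (fmul (SN N) (conjf P)) with (fun z w => Csum (seq 0 N) (fun n => fmul (fmul (fcst (lam n)) (hol_comp F n)) (conjf P) z w)).
    2: { apply fext; intros z w. unfold fmul at 3. rewrite Cmult_comm. unfold SN. rewrite <- Csum_scal.
         apply Csum_ext. intros n _. unfold fmul. ring. }
    rewrite (sphere_int_Csum _ (fun n => fmul (fmul (fcst (lam n)) (hol_comp F n)) (conjf P))) by auto with sm.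
    assert (V : forall n, sphere_int (fmul (fmul (fcst (lam n)) (hol_comp F n)) (conjf P)) = lam n * ip (hol_comp F n) P).
    { intros n. rewrite <- ip_sphere_int, ip_scal_l by auto with sm. reflexivity. }
    rewrite (Csum_single _ p) by (exact HN || (intros k Hk; rewrite V, Ho by exact Hk; ring)).
    apply V. }
  set (c := (2 * (K * Bsum * nu (conjf P)))%R).
  assert (Hnu : (0 <= nu (conjf P))%R) by (apply nu_nonneg; auto with sm).
  assert (Hc : (0 <= c)%R).
  { unfold c. apply Rmult_le_pos; [lra|]. apply Rmult_le_pos; [now apply Rmult_le_pos|exact Hnu]. }
  assert (Bd : forall N, (p < N)%nat -> (Cmod (ip (hol_ext lam F) P - lam p * ip (hol_comp F p) P) <= c * / (INR N + 1))%R).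
  { intros N HN. rewrite <- (IN N HN).
    replace (ip (hol_ext lam F) P - ip (SN N) P) with (sphere_int (fmul (conjf P) (fadd (hol_ext lam F) (fmul (fcst (-(1))) (SN N))))).
    - replace (c * / (INR N + 1))%R with (2 * (K * / (INR N + 1) * Bsum * nu (conjf P)))%R by (unfold c; ring).
      apply sphere_int_bound; [auto with sm|auto with sm|]. intros z w Hz.
      unfold fadd, fmul, fcst, hol_ext. destruct (Psi_onS3 z w Hz) as [-> ->].
      pose proof (Cseries_tail (fun n => lam n * hol_comp F n z w) K N HK (HT z w (Ball_onS3 z w Hz))) as CT.
      replace (hol_series lam F z w + - (1) * SN N z w) with (hol_series lam F z w - SN N z w) by ring. exact CT.
    - replace (fmul (conjf P) (fadd (hol_ext lam F) (fmul (fcst (-(1))) (SN N)))) with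
        (fadd (fmul (hol_ext lam F) (conjf P)) (fmul (fcst (-(1))) (fmul (SN N) (conjf P)))) by fcrush.
      rewrite sphere_int_add, sphere_int_scal, !ip_sphere_int by auto with sm. ring. }
  set (x := ip (hol_ext lam F) P - lam p * ip (hol_comp F p) P) in *.
  assert (Zx : x = 0).
  { apply Cmod_eq_0. apply Rle_antisym; [|apply Cmod_ge_0]. apply le_epsilon. intros eps Heps.
    destruct (INR_unbounded (c / eps)) as [M HM]. set (N := (p + S M)%nat).
    eapply Rle_trans; [apply (Bd N); unfold N; lia|]. rewrite Rplus_0_l.
    pose proof (INR1_pos N). apply Rmult_le_reg_r with (INR N + 1)%R; [assumption|].
    rewrite Rmult_assoc, Rinv_l, Rmult_1_r by lra.
    assert (HN : (INR M <= INR N)%R) by (apply le_INR; unfold N; lia).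
    apply Rmult_lt_compat_r with (r := eps) in HM; [|exact Heps].
    replace (c / eps * eps)%R with c in HM by (field; lra). nra. }
  transitivity (x + lam p * ip (hol_comp F p) P); [unfold x; ring|]. rewrite Zx. ring.
Qed.

(** * The projection onto the components with [q] in [{0, 1}] *)

Definition lamS (n : nat) : C := (RtoC (INR n) + 1) / vol.
Definition lamE (n : nat) : C :=
  match n with O => 0 | S m => - / (RtoC (INR m) + 1) * lamS n end.

Lemma polyg_lamS : polyg lamS.
Proof.
  exists (/ Cmod vol)%R, 1%nat. pose proof (proj1 (Cmod_gt_0 vol) vol_neq) as Hv.
  split; [now apply Rlt_le, Rinv_0_lt_compat|]. intros n. unfold lamS.
  rewrite Cmod_div by apply vol_neq. rewrite <- RtoC_plus, Cmod_R, Rabs_pos_eq by apply Rlt_le, INR1_pos.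
  right. field. lra.
Qed.

Lemma polyg_lamE : polyg lamE.
Proof.
  destruct polyg_lamS as (L & d & HL & H). exists L, d. split; [exact HL|]. intros [|n].
  - simpl lamE. rewrite Cmod_0. apply Rmult_le_pos; [exact HL|]. apply pow_le, Rlt_le, INR1_pos.
  - simpl lamE. rewrite Cmod_mult, Cmod_opp, Cmod_inv by apply RtoC_INR_S_neq.
    rewrite <- RtoC_plus, Cmod_R, Rabs_pos_eq by apply Rlt_le, INR1_pos.
    eapply Rle_trans; [|apply H]. rewrite <- (Rmult_1_l (Cmod (lamS (S n)))) at 2.
    apply Rmult_le_compat_r; [apply Cmod_ge_0|]. pose proof (pos_INR n).
    rewrite <- Rinv_1. apply Rinv_le_contravar; lra.
Qed.

Lemma ip_hol_ext_sph lam F p P : polyg lam -> smooth F -> sph p 0 P ->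
  ip (hol_ext lam F) P = lam p * (vol / (RtoC (INR p) + 1) * ip F P).
Proof.
  intros Hl HF HP. pose proof (smooth_sph _ _ _ HP) as SP.
  assert (Ho : forall n, n <> p -> ip (hol_comp F n) P = 0).
  { intros n Hn. apply (hom_weight_orth n p); [apply hol_comp_hom; auto with sm|apply HP|exact Hn]. }
  rewrite (ip_hol_ext lam F P p Hl HF) by auto with sm.
  now rewrite hol_comp_repr by (auto with sm; apply HP).
Qed.

Lemma ip_hol_ext_perp lam F P : polyg lam -> smooth F -> contF P ->
  (forall n Q, sph n 0 Q -> ip Q P = 0) -> ip (hol_ext lam F) P = 0.
Proof.
  intros Hl HF HP H.
  assert (K : forall n, ip (hol_comp F n) P = 0).
  { intros n. apply (H n). apply hom_sph, hol_comp_hom. auto with sm. }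
  rewrite (ip_hol_ext lam F P 0 Hl HF HP) by auto. rewrite K. ring.
Qed.

Lemma sph_0_perp n Q p q P : sph n 0 Q -> sph p (S q) P -> ip Q P = 0.
Proof.
  intros HQ HP. apply (Zb1_kernel_perp Q p q P (smooth_sph _ _ _ HQ)); [|exact HP].
  intros z w _. rewrite (hom_Zb1_0 n Q) by apply HQ. reflexivity.
Qed.

(* The [q = 1] part is [- Z1 (sum over m >= 1 of (1/m) g_m)], with [g_m] the holomorphic component of
   degree [m] of [Zb1 F], because [Z1 Zb1 = - m] on [H_{m-1,1}]. *)
Definition proj01 (F : fn) : fn := fadd (hol_ext lamS F) (Z1 (hol_ext lamE (Zb1 F))).

Lemma smooth_proj01 F : smooth F -> smooth (proj01 F).
Proof.
  intros HF. apply smooth_add; [apply smooth_hol_ext|apply smooth_Z1, smooth_hol_ext]; auto with sm;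
    [apply polyg_lamS|apply polyg_lamE].
Qed.

Lemma ip_proj01 F P : smooth F -> smooth P ->
  ip (proj01 F) P = ip (hol_ext lamS F) P - ip (hol_ext lamE (Zb1 F)) (Zb1 P).
Proof.
  intros HF HP.
  assert (S1 : smooth (hol_ext lamS F)) by (apply smooth_hol_ext; [apply polyg_lamS|exact HF]).
  assert (S2 : smooth (hol_ext lamE (Zb1 F))) by (apply smooth_hol_ext; [apply polyg_lamE|auto with sm]).
  unfold proj01. rewrite ip_add_l, ip_Z1 by auto with sm. ring.
Qed.

Lemma proj01_D0perp F : smooth F -> inD0perp (proj01 F).
Proof.
  intros HF. apply inD0perp_sph. intros p q P HP. pose proof (smooth_sph _ _ _ HP) as SP.
  rewrite ip_proj01 by assumption.
  rewrite ip_hol_ext_perp; [|apply polyg_lamS|exact HF|auto with sm|intros n Q HQ; exact (sph_0_perp _ _ _ _ _ HQ HP)].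
  rewrite ip_hol_ext_perp; [ring|apply polyg_lamE|auto with sm|auto with sm|].
  intros n Q HQ. exact (sph_0_perp _ _ _ _ _ HQ (sph_Zb1 _ _ _ HP)).
Qed.

Lemma ip_proj01_0 F p P : smooth F -> sph p 0 P -> ip (proj01 F) P = ip F P.
Proof.
  intros HF HP. pose proof (smooth_sph _ _ _ HP) as SP.
  assert (S2 : smooth (hol_ext lamE (Zb1 F))) by (apply smooth_hol_ext; [apply polyg_lamE|auto with sm]).
  rewrite ip_proj01, (hom_Zb1_0 p P), ip_0_r by (auto with sm; apply HP).
  rewrite (ip_hol_ext_sph lamS F p P polyg_lamS HF HP). unfold lamS. field.
  split; [apply RtoC_INR_S_neq|apply vol_neq].
Qed.

Lemma ip_proj01_1 F p P : smooth F -> sph p 1 P -> ip (proj01 F) P = ip F P.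
Proof.
  intros HF HP. pose proof (smooth_sph _ _ _ HP) as SP.
  rewrite ip_proj01 by assumption.
  rewrite ip_hol_ext_perp; [|apply polyg_lamS|exact HF|auto with sm|intros n Q HQ; exact (sph_0_perp _ _ _ _ _ HQ HP)].
  rewrite (ip_hol_ext_sph lamE (Zb1 F) (S p) (Zb1 P) polyg_lamE ltac:(auto with sm) (sph_Zb1 _ _ _ HP)).
  rewrite ip_Zb1, (sph_eigen _ _ _ HP), ip_scal_r by auto with sm.
  simpl lamE. unfold lamS.
  replace (Cconj (- RtoC (INR 1) * (RtoC (INR p) + 1))) with (- (RtoC (INR p) + 1)) by (apply C_ext; simpl; ring).
  field. repeat split; first [apply RtoC_INR_S_neq|apply vol_neq].
Qed.

Definition proj2 (F : fn) : fn := fadd F (fmul (fcst (-(1))) (proj01 F)).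

Lemma smooth_proj2 F : smooth F -> smooth (proj2 F).
Proof. intros HF. pose proof (smooth_proj01 F HF). unfold proj2; auto with sm. Qed.

Lemma ip_proj2 F P : smooth F -> smooth P -> ip (proj2 F) P = ip F P - ip (proj01 F) P.
Proof.
  intros HF HP. pose proof (smooth_proj01 F HF).
  unfold proj2. rewrite ip_add_l, ip_scal_l by auto with sm. ring.
Qed.

Lemma proj2_D0 F : smooth F -> inD0 (proj2 F).
Proof.
  intros HF. apply inD0_sph. split; intros p P HP; rewrite ip_proj2 by (auto; exact (smooth_sph _ _ _ HP)).
  - rewrite (ip_proj01_0 F p) by assumption. ring.
  - rewrite (ip_proj01_1 F p) by assumption. ring.
Qed.

Lemma D0perp_proj01 F : smooth F -> inD0perp F -> forall z w, onS3 z w -> F z w = proj01 F z w.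
Proof.
  intros HF H z w Hz.
  assert (Z : proj2 F z w = 0).
  { apply D0_inter; [now apply smooth_proj2|now apply proj2_D0| |exact Hz].
    apply inD0perp_sph. intros p q P HP. pose proof (smooth_sph _ _ _ HP) as SP.
    rewrite ip_proj2 by assumption.
    rewrite (proj1 (inD0perp_sph F) H _ _ _ HP).
    rewrite (proj1 (inD0perp_sph (proj01 F)) (proj01_D0perp F HF) _ _ _ HP). ring. }
  unfold proj2, fadd, fmul, fcst in Z.
  transitivity ((F z w + - (1) * proj01 F z w) + proj01 F z w); [ring|]. rewrite Z. ring.
Qed.

Lemma D0perp_orth F H : smooth F -> inD0perp F -> smooth H -> inD0 H -> ip F H = 0.
Proof.
  intros HF HFp HH HD. apply inD0_sph in HD. destruct HD as [D0 D1].
  rewrite (ip_ext_l F (proj01 F)) by now apply D0perp_proj01.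
  rewrite ip_proj01 by assumption.
  rewrite ip_hol_ext_perp; [|apply polyg_lamS|exact HF|auto with sm|].
  - rewrite ip_hol_ext_perp; [ring|apply polyg_lamE|auto with sm|auto with sm|].
    intros n Q HQ. pose proof (smooth_sph _ _ _ HQ) as SQ.
    replace (ip Q (Zb1 H)) with (- ip (Z1 Q) H) by (rewrite ip_Z1 by assumption; ring).
    destruct n as [|n].
    + rewrite (hom_Z1_0 _ _ (proj1 HQ)), ip_0_l by auto with sm. ring.
    + pose proof (sph_Z1 _ _ _ HQ) as H1. rewrite (ip_sym H), (D1 _ _ H1) by auto with sm.
      apply C_ext; simpl; ring.
  - intros n Q HQ. pose proof (smooth_sph _ _ _ HQ) as SQ.
    rewrite (ip_sym H), (D0 _ _ HQ) by auto with sm. apply C_ext; simpl; ring.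
Qed.

Lemma orth_D0perp F : smooth F -> (forall H, smooth H -> inD0 H -> ip F H = 0) -> inD0perp F.
Proof.
  intros HF H. apply inD0perp_sph. intros p q P HP. pose proof (smooth_sph _ _ _ HP) as SP.
  apply H; [exact SP|].
  assert (K : forall n k Q, sph n k Q -> Zb1 (Zb1 Q) = fcst 0 -> ip P Q = 0).
  { intros n k Q HQ Z0. pose proof (smooth_sph _ _ _ HQ) as SQ. rewrite (ip_sym Q P) by auto with sm.
    rewrite (Zb1_sq_kernel_perp Q p q P SQ); [apply C_ext; simpl; ring| |exact HP].
    intros z w _. now rewrite Z0. }
  apply inD0_sph. split; intros n Q HQ; apply (K _ _ _ HQ).
  - rewrite (hom_Zb1_0 n Q) by apply HQ. apply der_cst. auto with sm.
  - apply (hom_Zb1_0 (S n)). apply (sph_Zb1 _ _ _ HQ).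
Qed.

Lemma mono_D0perp a : inD0perp (mono a 0).
Proof.
  apply inD0perp_sph. intros p q P HP. apply (sph_0_perp (a + 0) _ p (S q)); [|exact HP].
  apply hom_sph, hom_monomial.
Qed.

Lemma mono_norm2_neq a b : mono_norm2 a b <> 0.
Proof.
  intros E. apply vol_neq. rewrite <- (binom_mono_norm2 (a + b) a b eq_refl), E. ring.
Qed.

Lemma mono_independent n (a : nat -> C) :
  (forall z w, onS3 z w -> Csum (seq 0 n) (fun i => a i * mono i 0 z w) = 0) ->
  forall i, (i < n)%nat -> a i = 0.
Proof.
  intros H i Hi.
  assert (E : sphere_int (fun z w => Csum (seq 0 n) (fun k => fmul (fcst (a k)) (fmul (mono k 0) (conjf (mono i 0))) z w)) = 0).
  { rewrite (sphere_int_ext _ (fcst 0)).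
    - replace (fcst 0) with (fmul (fcst 0) (fcst 0)) by fcrush. rewrite sphere_int_scal by auto with sm. ring.
    - intros z w Hz. transitivity (conjf (mono i 0) z w * Csum (seq 0 n) (fun k => a k * mono k 0 z w)).
      + rewrite <- Csum_scal. apply Csum_ext. intros k _. unfold fmul, fcst. ring.
      + rewrite H by exact Hz. unfold fcst. ring. }
  rewrite (sphere_int_Csum _ (fun k => fmul (fcst (a k)) (fmul (mono k 0) (conjf (mono i 0))))) in E by auto with sm.
  rewrite (Csum_single _ i) in E.
  2: exact Hi.
  2: intros k Hk; rewrite sphere_int_scal by auto with sm; rewrite <- ip_sphere_int, mono_orth by congruence; ring.
  rewrite sphere_int_scal in E by auto with sm. rewrite <- ip_sphere_int in E. fold (mono_norm2 i 0) in E.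
  transitivity (/ mono_norm2 i 0 * (a i * mono_norm2 i 0)); [field; apply mono_norm2_neq|]. rewrite E. ring.
Qed.

Theorem theorem1p1 :
  (* D_0^perp is infinite dimensional (over C, as functions on S^3) *)
  (forall n : nat, exists phi : nat -> C -> C -> C,
      (forall i, (i < n)%nat -> smooth (phi i) /\ inD0perp (phi i)) /\
      (forall a : nat -> C,
          (forall z w, onS3 z w -> Csum (seq 0 n) (fun i => a i * phi i z w) = 0) ->
          forall i, (i < n)%nat -> a i = 0)) /\
  (* D_0^perp is the L^2-orthogonal complement of D_0 in D *)
  (forall F, smooth F ->
      (inD0perp F <-> (forall G, smooth G -> inD0 G -> ip F G = 0))) /\
  (* D = D_0 (+) D_0^perp *)
  (forall F, smooth F -> exists F0 F1,
      smooth F0 /\ smooth F1 /\ inD0 F0 /\ inD0perp F1 /\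
      (forall z w, onS3 z w -> F z w = F0 z w + F1 z w)) /\
  (forall F, smooth F -> inD0 F -> inD0perp F -> forall z w, onS3 z w -> F z w = 0) /\
  (* every element of D_0^perp solves D O = 0 *)
  (forall F, smooth F -> inD0perp F -> forall z w, onS3 z w -> DO F z w = 0) /\
  (* no nonzero element of D_0^perp is trivial *)
  (forall F, smooth F -> inD0perp F -> trivial_deformation F ->
      forall z w, onS3 z w -> F z w = 0).
Proof.
  split; [|split; [|split; [|split; [|split]]]].
  - intros n. exists (fun i => mono i 0). split.
    + intros i _. split; [apply smooth_mono|apply mono_D0perp].
    + intros a. apply mono_independent.
  - intros F HF. split.
    + intros HP H. now apply D0perp_orth.
    + apply orth_D0perp, HF.
  - intros F HF. exists (proj2 F), (proj01 F).
    split; [now apply smooth_proj2|]. split; [now apply smooth_proj01|].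
    split; [now apply proj2_D0|]. split; [now apply proj01_D0perp|].
    intros z w _. unfold proj2, fadd, fmul, fcst. ring.
  - exact D0_inter.
  - exact DO_zero.
  - exact D0perp_trivial.
Qed.
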